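(* Let $M,N$ be sublattices of a Euclidean space, each isometric to $EE_8$, such that $L=M+N$ is integral and rootless, and suppose that the associated involutions $t_M,t_N$ generate a dihedral group $D=\langle t_M,t_N\rangle$ of order at most $12$. Then the pair $(M,N)$ is one of the following eleven types. In each line the name encodes the order of $D$ and the rank of $L$ (as explained in the context), ''$L\ge Y$'' means that $L$ contains a sublattice isometric to $Y$, and the last entry is the invariant factor sequence of the discriminant group $\mathcal D(L)=L^*/L$ (with $a^k$ meaning that $a$ is repeated $k$ times, for a total of $\operatorname{rank}(L)$ entries): 1. $DIH_4(12)$: $|D|=4$, $L\ge DD_4^{\perp 3}$, $1^42^64^2$; 2. $DIH_4(14)$: $|D|=4$, $L\ge AA_1^{\perp 2}\perp DD_6^{\perp 2}$, $1^42^84^2$; 3. $DIH_4(15)$: $|D|=4$, $L\ge AA_1\perp EE_7^{\perp 2}$, $1^22^{12}4^1$; 4. $DIH_4(16)$: $|D|=4$, $L\cong EE_8\perp EE_8$, $2^{16}$; 5. $DIH_6(14)$: $|D|=6$, $L\ge AA_2\perp (A_2\otimes E_6)$, $1^93^36^2$; 6. $DIH_6(16)$: $|D|=6$, $L\cong A_2\otimes E_8$, $1^83^8$; 7. $DIH_8(15)$: $|D|=8$, $L\ge AA_1^{\perp 7}\perp EE_8$, $1^{10}4^5$; 8. $DIH_8(16,DD_4)$: $|D|=8$, $L\ge DD_4^{\perp 2}\perp EE_8$, $1^82^44^4$; 9. $DIH_8(16,0)$: $|D|=8$, $L\cong BW_{16}$, $1^82^8$; 10. $DIH_{10}(16)$: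 $|D|=10$, $L\ge A_4\otimes A_4$, $1^{12}5^4$; 11. $DIH_{12}(16)$: $|D|=12$, $L\ge AA_2\perp AA_2\perp (A_2\otimes E_6)$, $1^{12}6^4$. All eleven types exist. For each type the pair is uniquely determined by the name up to isometry of pairs: if $(M,N)$ and $(M',N')$ both satisfy the hypotheses and have the same name, there is an isometry $M+N\to M'+N'$ carrying $M$ to $M'$ and $N$ to $N'$. Except for $DIH_4(15)$, in every type the lattice $L$ embeds isometrically as a sublattice of the Leech lattice.
   Context: A lattice is a finite rank free abelian group with a rational valued positive definite symmetric bilinear form $(\cdot,\cdot)$; it is integral if the form is integer valued. The norm of $x$ is $(x,x)$. A root is a norm $2$ vector; an integral lattice is rootless if it has no roots. $A_n,D_n,E_n$ denote the root lattices, and $AA_n,DD_n,EE_n$ denote lattices isometric to $\sqrt2$ times $A_n,D_n,E_n$ respectively. $X^{\perp n}$ is the orthogonal sum of $n$ copies of $X$. The tensor product $A\otimes B$ of lattices has form $(a\otimes b,a'\otimes b')=(a,a')(b,b')$. $L^*$ is the dual lattice of $L$. For a subset $X$ of Euclidean space, $t_X$ is the orthogonal transformation which is $-1$ on the span of $X$ and $1$ on $X^\perp$. A dihedral group here has order at least $4$ (so $M\neq N$; the dihedral group of order 4 is the four-group). For $S\subseteq L$ and a sublattice $M$, $ann_M(S)=\{v\in M: (v,s)=0\ \forall s\in S\}$. Names: $DIH_n(r)$ denotes a pair $M,N\cong EE_8$ (and its sum $L=M+N$) with $L$ integral and rootless, $|\langle t_M,t_N\rangle|=n$ and $\operatorname{rank}(M+N)=r$.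 $DIH_8(16,X)$ denotes a $DIH_8(16)$ with $ann_M(N)\cong ann_N(M)\cong X$. $BW_{16}$ is the Barnes–Wall lattice of rank 16; it is isometric to $\frac1{\sqrt2}\{x\in\mathbb Z^{16}: x \bmod 2\in RM(1,4),\ \sum x_i\equiv 0 \bmod 4\}$, where $RM(1,4)$ is the first order Reed–Muller $[16,5,8]$ code. The Leech lattice is the unique even unimodular rootless lattice of rank 24. *)

(* Defs.v *)
From HB Require Import structures.
From mathcomp Require Import all_boot all_order all_algebra.
From mathcomp Require Import boolp classical_sets functions cardinality reals.

Set Implicit Arguments.
Unset Strict Implicit.
Unset Printing Implicit Defensive.

Import Order.TTheory GRing.Theory Num.Theory.
Local Open Scope classical_set_scope.
Local Open Scope card_scope.
Local Open Scope ring_scope.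

(* Euclidean d-space is 'rV[R]_d with the standard scalar product, for a      *)
(* model R of the real numbers; its lattices are represented by their sets of *)
(* vectors.                                                                   *)

Section Euclidean.
Context {R : realType}.

Definition dot d (x y : 'rV[R]_d) : R := (x *m y^T) 0 0.

Definition real_span d (X : set 'rV[R]_d) : set 'rV[R]_d :=
  [set x | exists n (B : 'M[R]_(n, d)),
     (forall i, X (row i B)) /\ (x <= B)%MS].

Definition orth d (X : set 'rV[R]_d) : set 'rV[R]_d :=
  [set y | forall x, X x -> dot y x = 0].

(* Linear maps act on row vectors from the right. *)
Definition invol_spec d (X : set 'rV[R]_d) : set 'M[R]_d :=
  [set T | (forall x, real_span X x -> x *m T = - x) /\
           (forall y, orth X y -> y *m T = y)].

(* The involution t_X; by [invol_specP] and [invol_spec_uniq] below it is the *)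
(* unique element of [invol_spec X], so that the default value is not used.   *)
Definition invol d (X : set 'rV[R]_d) : 'M[R]_d := xget 1%:M (invol_spec X).

Definition linear_group d (G : set 'M[R]_d) : Prop :=
  [/\ G 1%:M,
      forall g h, G g -> G h -> G (g *m h),
      forall g, G g -> G (invmx g) &
      G `<=` [set g | g \in unitmx]].

Definition invol_group d (M N : set 'rV[R]_d) : set 'M[R]_d :=
  smallest (@linear_group d) [set invol M; invol N].

Definition int_basis d r (B : 'M[R]_(r, d)) (L : set 'rV[R]_d) : Prop :=
  row_free B /\ L = [set map_mx intr c *m B | c in [set: 'rV[int]_r]].

Definition has_rank d (L : set 'rV[R]_d) (r : nat) : Prop :=
  exists B : 'M[R]_(r, d), int_basis B L.

Definition integral d (L : set 'rV[R]_d) : Prop :=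
  forall x y, L x -> L y -> dot x y \is a Num.int.

Definition even_lattice d (L : set 'rV[R]_d) : Prop :=
  integral L /\ forall x, L x -> exists k : int, dot x x = (2 * k)%:~R.

Definition rootless d (L : set 'rV[R]_d) : Prop :=
  forall x, L x -> dot x x != 2.

Definition dual d (L : set 'rV[R]_d) : set 'rV[R]_d :=
  [set x | real_span L x /\ forall y, L y -> dot x y \is a Num.int].

Definition sumL d (M N : set 'rV[R]_d) : set 'rV[R]_d :=
  [set x + y | x in M & y in N].

Definition ann d (M S : set 'rV[R]_d) : set 'rV[R]_d := M `&` orth S.

Definition isometry m n (f : 'rV[R]_m -> 'rV[R]_n)
    (L : set 'rV[R]_m) (K : set 'rV[R]_n) : Prop :=
  [/\ set_bij L K f,
      forall x y, L x -> L y -> f (x + y) = f x + f y &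
      forall x y, L x -> L y -> dot (f x) (f y) = dot x y].

Definition isometric m n (L : set 'rV[R]_m) (K : set 'rV[R]_n) : Prop :=
  exists f, isometry f L K.

(* K is isometric to a sublattice of L. *)
Definition contains m n (L : set 'rV[R]_m) (K : set 'rV[R]_n) : Prop :=
  exists K' : set 'rV[R]_m, K' `<=` L /\ isometric K K'.

(* The group L^* / L is isomorphic to the direct product of the Z/s_i: the    *)
(* map f, read modulo the s_i, is an epimorphism from L^* with kernel L.      *)
Definition discr_iso d (L : set 'rV[R]_d) (s : seq nat) : Prop :=
  exists f : 'rV[R]_d -> 'I_(size s) -> int,
    [/\ forall x y, dual L x -> dual L y -> forall i,
          (f (x + y) i = f x i + f y i %[mod (nth 0%N s i)%:Z])%Z,
        forall v : 'I_(size s) -> int, exists2 x, dual L x &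
          forall i, (f x i = v i %[mod (nth 0%N s i)%:Z])%Z &
        forall x, dual L x ->
          (L x <-> forall i, ((nth 0%N s i)%:Z %| f x i)%Z)].

Definition discr_invariants d (L : set 'rV[R]_d) (s : seq nat) : Prop :=
  [/\ has_rank L (size s), sorted dvdn s & discr_iso L s].

Definition scaleL d (a : R) (L : set 'rV[R]_d) : set 'rV[R]_d :=
  [set a *: x | x in L].

Definition osum m n (A : set 'rV[R]_m) (B : set 'rV[R]_n) :
    set 'rV[R]_(m + n) :=
  [set row_mx x y | x in A & y in B].

Definition int_submod d (S : set 'rV[R]_d) : Prop :=
  S 0 /\ forall x y, S x -> S y -> S (x - y).

Definition pure_tensor m n (x : 'rV[R]_m) (y : 'rV[R]_n) : 'rV[R]_(m * n) :=
  mxvec (x^T *m y).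

Definition tensorL m n (A : set 'rV[R]_m) (B : set 'rV[R]_n) :
    set 'rV[R]_(m * n) :=
  smallest (@int_submod (m * n)) [set pure_tensor x y | x in A & y in B].

Definition zeroL : set 'rV[R]_0 := [set 0].

Unset Implicit Arguments.

Definition opow (k : nat) {n : nat} (A : set 'rV[R]_n) : set 'rV[R]_(k * n) :=
  [set mxvec Z | Z in [set Z : 'M[R]_(k, n) | forall i, A (row i Z)]].

Definition rootA n : set 'rV[R]_n.+1 :=
  [set map_mx intr z | z in [set z : 'rV[int]_n.+1 | \sum_i z 0 i = 0]].

Definition rootD n : set 'rV[R]_n :=
  [set map_mx intr z | z in [set z : 'rV[int]_n | (2 %| \sum_i z 0 i)%Z]].

Definition rootE8 : set 'rV[R]_8 :=
  rootD 8 `|` [set x + const_mx 2^-1 | x in rootD 8].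

(* The orthogonal complement in E_8 of the root (1/2, ..., 1/2). *)
Definition rootE7 : set 'rV[R]_8 :=
  [set x | rootE8 x /\ \sum_i x 0 i = 0].

(* The orthogonal complement in E_8 of the A_2 spanned by (1/2, ..., 1/2) and *)
(* (1, 0, ..., 0, 1).                                                         *)
Definition rootE6 : set 'rV[R]_8 :=
  [set x | rootE7 x /\ x 0 ord0 + x 0 ord_max = 0].

Definition AA n := scaleL (Num.sqrt 2) (rootA n).
Definition DD n := scaleL (Num.sqrt 2) (rootD n).
Set Implicit Arguments.

Definition EE7 := scaleL (Num.sqrt 2) rootE7.
Definition EE8 := scaleL (Num.sqrt 2) rootE8.

(* First order Reed-Muller code: the values of the affine functions on the    *)
(* points of F_2^4, the point number i being given by the binary digits of i. *)
Definition RM14 : set 'rV['F_2]_16 :=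
  [set \row_i (b + \sum_(j < 4) a 0 j * (odd (i %/ 2 ^ j))%:R)
     | b in [set: 'F_2] & a in [set: 'rV['F_2]_4]].

Definition BW16 : set 'rV[R]_16 :=
  scaleL (Num.sqrt 2)^-1
    [set map_mx intr z | z in [set z : 'rV[int]_16 |
       RM14 (map_mx intr z) /\ (4 %| \sum_i z 0 i)%Z]].

Definition is_Leech (K : set 'rV[R]_24) : Prop :=
  [/\ has_rank K 24, even_lattice K, dual K = K & rootless K].

Definition embeds_in_Leech d (L : set 'rV[R]_d) : Prop :=
  exists2 K : set 'rV[R]_24, is_Leech K & contains K L.

Definition EE8_pair d (M N : set 'rV[R]_d) : Prop :=
  [/\ isometric M EE8, isometric N EE8,
      integral (sumL M N) & rootless (sumL M N)].

(* The group generated by the two involutions is dihedral as soon as its      *)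
(* order is at least 4.                                                       *)
Definition dihedral_le12 d (M N : set 'rV[R]_d) : Prop :=
  exists2 n : nat, (4 <= n <= 12)%N & invol_group M N #= `I_n.

Definition pair_isometric m n (M N : set 'rV[R]_m) (M' N' : set 'rV[R]_n) :
    Prop :=
  exists f, [/\ isometry f (sumL M N) (sumL M' N'), f @` M = M' & f @` N = N'].

End Euclidean.

Inductive dih : Type :=
  | DIH4_12 | DIH4_14 | DIH4_15 | DIH4_16
  | DIH6_14 | DIH6_16
  | DIH8_15 | DIH8_16_DD4 | DIH8_16_0
  | DIH10_16
  | DIH12_16.

Definition dih_order (t : dih) : nat :=
  match t with
  | DIH4_12 | DIH4_14 | DIH4_15 | DIH4_16 => 4
  | DIH6_14 | DIH6_16 => 6
  | DIH8_15 | DIH8_16_DD4 | DIH8_16_0 => 8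
  | DIH10_16 => 10
  | DIH12_16 => 12
  end%N.

Definition dih_rank (t : dih) : nat :=
  match t with
  | DIH4_12 => 12
  | DIH4_14 | DIH6_14 => 14
  | DIH4_15 | DIH8_15 => 15
  | DIH4_16 | DIH6_16 | DIH8_16_DD4 | DIH8_16_0 | DIH10_16 | DIH12_16 => 16
  end%N.

Definition dih_discr (t : dih) : seq nat :=
  match t with
  | DIH4_12 => nseq 4 1 ++ nseq 6 2 ++ nseq 2 4
  | DIH4_14 => nseq 4 1 ++ nseq 8 2 ++ nseq 2 4
  | DIH4_15 => nseq 2 1 ++ nseq 12 2 ++ nseq 1 4
  | DIH4_16 => nseq 16 2
  | DIH6_14 => nseq 9 1 ++ nseq 3 3 ++ nseq 2 6
  | DIH6_16 => nseq 8 1 ++ nseq 8 3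
  | DIH8_15 => nseq 10 1 ++ nseq 5 4
  | DIH8_16_DD4 => nseq 8 1 ++ nseq 4 2 ++ nseq 4 4
  | DIH8_16_0 => nseq 8 1 ++ nseq 8 2
  | DIH10_16 => nseq 12 1 ++ nseq 4 5
  | DIH12_16 => nseq 12 1 ++ nseq 4 6
  end%N.

Section Types.
Context {R : realType}.

Definition dih_ann (t : dih) d (M N : set 'rV[R]_d) : Prop :=
  match t with
  | DIH8_16_DD4 =>
      isometric (ann M N) (DD 4) /\ isometric (ann N M) (DD 4)
  | DIH8_16_0 =>
      isometric (ann M N) zeroL /\ isometric (ann N M) zeroL
  | _ => True
  end.

Definition has_name (t : dih) d (M N : set 'rV[R]_d) : Prop :=
  [/\ EE8_pair M N, invol_group M N #= `I_(dih_order t),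
      has_rank (sumL M N) (dih_rank t) & dih_ann t M N].

Definition dih_sub (t : dih) d (L : set 'rV[R]_d) : Prop :=
  match t with
  | DIH4_12 => contains L (opow 3 (DD 4))
  | DIH4_14 => contains L (osum (opow 2 (AA 1)) (opow 2 (DD 6)))
  | DIH4_15 => contains L (osum (AA 1) (opow 2 EE7))
  | DIH4_16 => isometric L (osum EE8 EE8)
  | DIH6_14 => contains L (osum (AA 2) (tensorL (rootA 2) rootE6))
  | DIH6_16 => isometric L (tensorL (rootA 2) rootE8)
  | DIH8_15 => contains L (osum (opow 7 (AA 1)) EE8)
  | DIH8_16_DD4 => contains L (osum (opow 2 (DD 4)) EE8)
  | DIH8_16_0 => isometric L BW16
  | DIH10_16 => contains L (tensorL (rootA 4) (rootA 4))
  | DIH12_16 =>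
      contains L (osum (AA 2)
                    (osum (AA 2) (tensorL (rootA 2) rootE6)))
  end.

Definition of_type (t : dih) d (M N : set 'rV[R]_d) : Prop :=
  [/\ has_name t M N, dih_sub t (sumL M N) &
      discr_invariants (sumL M N) (dih_discr t)].

End Types.

Section Facts.
Context {R : realType}.

Lemma dotE d (x y : 'rV[R]_d) : dot x y = \sum_i x 0 i * y 0 i.
Proof. by rewrite /dot mxE; apply: eq_bigr => i _; rewrite mxE. Qed.

Lemma dot_pure_tensor m n (x x' : 'rV[R]_m) (y y' : 'rV[R]_n) :
  dot (pure_tensor x y) (pure_tensor x' y') = dot x x' * dot y y'.
Proof.
rewrite !dotE (reindex _ (curry_mxvec_bij m n)) /= mulr_suml.
transitivity (\sum_i \sum_j (x 0 i * x' 0 i * (y 0 j * y' 0 j))).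
  rewrite pair_big /=; apply: eq_bigr => -[i j] _ /=.
  rewrite !mxvecE !mxE !big_ord1 !mxE.
  by rewrite mulrACA.
by apply: eq_bigr => i _; rewrite mulr_sumr.
Qed.

Lemma dot_eq0 d (x : 'rV[R]_d) : dot x x = 0 -> x = 0.
Proof.
rewrite dotE => /eqP; rewrite psumr_eq0; last first.
  by move=> i _; rewrite -expr2 sqr_ge0.
move=> /allP h; apply/rowP => i; rewrite mxE.
by have := h i; rewrite mem_index_enum mulf_eq0 orbb => /(_ isT)/eqP.
Qed.

Lemma real_span_basis d (X : set 'rV[R]_d) :
  exists n (B : 'M[R]_(n, d)), (forall i, X (row i B)) /\
    forall x, X x -> (x <= B)%MS.
Proof.
pose P r := `[< exists n (B : 'M[R]_(n, d)),
  (forall i, X (row i B)) /\ \rank B = r >].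
have P0 : exists r, P r.
  exists 0%N; apply/asboolP; exists 0%N, 0; split; first by case.
  by rewrite mxrank0.
have Pd r : P r -> (r <= d)%N.
  by move=> /asboolP[n [B [_ <-]]]; exact: rank_leq_col.
case: (ex_maxnP P0 Pd) => r /asboolP[n [B [XB rB]]] maxr.
exists n, B; split=> // x Xx.
have rk : P (\rank (col_mx B x)).
  apply/asboolP; exists (n + 1)%N, (col_mx B x); split=> // i.
  case: (split_ordP i) => j ->; first by rewrite rowKu.
  by rewrite rowKd (ord1 j) row_id.
suff : (B + x <= B)%MS by exact: submx_trans (addsmxSr B x).
move: rk => /maxr; rewrite -rB -addsmxE => le.
have [_ <-] := mxrank_leqif_sup (addsmxSl B x).
by rewrite eqn_leq le mxrankS ?addsmxSl.
Qed.

Lemma capmx_orth n d (B : 'M[R]_(n, d)) : (B :&: kermx B^T = 0)%MS.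
Proof.
apply/eqP; rewrite -submx0; apply/row_subP => i.
have := row_sub i (B :&: kermx B^T)%MS.
rewrite sub_capmx => /andP[/submxP[c yE] /sub_kermxP y0].
suff -> : row i (B :&: kermx B^T)%MS = 0 by exact: sub0mx.
by apply: dot_eq0; rewrite /dot {2}yE trmx_mul mulmxA y0 mul0mx mxE.
Qed.

Lemma addsmx_orth n d (B : 'M[R]_(n, d)) : (1%:M <= B + kermx B^T)%MS.
Proof.
rewrite sub1mx /row_full; apply/eqP.
have := mxrank_sum_cap B (kermx B^T); rewrite capmx_orth mxrank0 addn0 => ->.
by rewrite mxrank_ker mxrank_tr subnKC // rank_leq_col.
Qed.

Lemma invol_spec_ex d (X : set 'rV[R]_d) : exists T, invol_spec X T.
Proof.
have [n [B [XB BX]]] := real_span_basis X.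
pose U := (<<B>>)%MS; pose W := kermx B^T.
have capUW : (U :&: W = 0)%MS.
  by apply/eqP; rewrite -submx0 -(capmx_orth B) capmxS ?genmxE.
have capWU : (W :&: U = 0)%MS by rewrite capmxC.
exists (proj_mx W U - proj_mx U W); split.
  move=> x [k [C [XC xC]]].
  have xU : (x <= U)%MS.
    rewrite genmxE; apply: (submx_trans xC); apply/row_subP => i.
    exact/BX/XC.
  by rewrite mulmxBr (proj_mx_id capUW xU) (proj_mx_0 capWU xU) sub0r.
move=> y Xy.
have yW : (y <= W)%MS.
  apply/sub_kermxP/rowP => i; rewrite mxE [RHS]mxE.
  transitivity (dot y (row i B)); last exact: Xy.
  by rewrite dotE; apply: eq_bigr => j _; rewrite !mxE.
by rewrite mulmxBr (proj_mx_0 capUW yW) (proj_mx_id capWU yW) subr0.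
Qed.

Lemma invol_specP d (X : set 'rV[R]_d) : invol_spec X (invol X).
Proof. by apply: xgetPex; exact: invol_spec_ex. Qed.

Lemma invol_spec_uniq d (X : set 'rV[R]_d) (T T' : 'M[R]_d) :
  invol_spec X T -> invol_spec X T' -> T = T'.
Proof.
move=> [T1 T2] [T1' T2']; have [n [B [XB BX]]] := real_span_basis X.
apply/row_matrixP => i; rewrite !rowE.
have sub : ((delta_mx 0 i : 'rV[R]_d) <= B + kermx B^T)%MS.
  by apply: submx_trans (addsmx_orth B); exact: submx1.
have /= [[u v] ->] := sub_addsmxP sub.
have spanB : real_span X (u *m B) by exists n, B; split=> //; exact: submxMl.
have orthv : orth X (v *m kermx B^T).
  move=> x /BX /submxP[c ->].
  by rewrite /dot trmx_mul mulmxA -(mulmxA v) mulmx_ker mulmx0 mul0mx mxE.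
rewrite /= !mulmxDl.
by rewrite (T1 _ spanB) (T1' _ spanB) (T2 _ orthv) (T2' _ orthv).
Qed.

End Facts.

(* Main.v *)
(** Idea. A pair (M, N) is encoded, in bases A of M and B of N with Gram matrix
    twice the E_8 Cartan matrix, by the integer matrix t = B A^T; two pairs with
    equal t are isometric, and t is defined up to the Weyl groups of both sides.
    A root p of N (norm 4) and a root q of M satisfy |(p, q)| <= 4, and
    (p, q) = 3 or -3 would make p - q or p + q a root of L; hence p t, read as
    a vector of E_8 through the dual basis, has norm at most 8 and lies in one
    of four Weyl orbits. An orderly search over the rows of t under these
    conditions, with its isomorph rejection recorded as a certificate, leaves
    thirteen matrices: the eleven types, the case M = N, and one for which the
    form on M + N would not be positive semidefinite.

    The order of the dihedral group, the discriminant group and the sublattices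
    named in each type are then read off from the Gram matrix of (A, B) by
    verified integer matrix identities. A model of each type but DIH_4(15) is
    given by 16 vectors of the Leech lattice, built here from the Golay code.

    If L of type DIH_4(15) were in the Leech lattice K, the coordinates of its
    16 generators modulo 2 would form a matrix c with c H c^T of rank 2, where H
    is invertible of size 24; so c has rank at most 13, and some half of a
    vector of L, not in L, lies in K. Reducing its two components modulo 2 E_8
    turns it into a vector of K of norm 2 or of odd norm. *)

From HB Require Import structures.
From Stdlib Require Import ZArith.
From mathcomp Require Import all_boot all_order all_algebra.
From mathcomp Require Import boolp classical_sets functions cardinality reals.
From mathcomp Require Import zify ssrZ ring lra.
Require Import Defs.

Set Implicit Arguments.
Unset Strict Implicit.
Unset Printing Implicit Defensive.

Import Order.TTheory GRing.Theory Num.Theory.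
Local Open Scope classical_set_scope.
Local Open Scope card_scope.
Local Open Scope ring_scope.

Delimit Scope Z_scope with BZ.

(** * Finite search *)

(** The 16 rows of [col_mx A B] generate L, but they are dependent as soon as L has rank below 16.
    Positive definiteness replaces independence: a combination of rows that the Gram matrix
    annihilates is zero ([gram_ker]). So identities between vectors of L, and between the orthogonal
    maps generated by the involutions, are tested on integers after multiplication by the Gram
    matrix.

    Soundness of the search is one-sided. Reflections applied to either basis turn a matrix
    presented by the pair into another one presented by it, so each candidate only has to be kept or
    be carried by listed reflections to a kept one.

    That the surviving matrices belong to different names comes from the invariants computed
    afterwards: order, rank and annihilators separate the eleven names. Hence a pair with a given
    name presents the one matrix of that name, and uniqueness as well as the embedding question
    reduce to that matrix. *)

Definition axpy (a : Z) (x y : seq Z) : seq Z :=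
  [seq Z.add (Z.mul a p.1) p.2 | p <- zip x y].

Definition dotl (x y : seq Z) : Z :=
  foldr (fun p s => Z.add (Z.mul p.1 p.2) s) 0%BZ (zip x y).

Definition lcomb (n : nat) (p : seq Z) (t : seq (seq Z)) : seq Z :=
  foldr (fun q s => if q.1 is Z0 then s else axpy q.1 q.2 s) (nseq n 0%BZ) (zip p t).

Definition cartan : seq (seq Z) := (
  [:: [:: 2;-1;0;0;0;0;0;0]; [:: -1;2;-1;0;0;0;0;0];
      [:: 0;-1;2;-1;-1;0;0;0]; [:: 0;0;-1;2;0;0;0;0];
      [:: 0;0;-1;0;2;-1;0;0]; [:: 0;0;0;0;-1;2;-1;0];
      [:: 0;0;0;0;0;-1;2;-1]; [:: 0;0;0;0;0;0;-1;2]])%BZ.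

Definition icartan : seq (seq Z) := (
  [:: [:: 4;7;10;5;8;6;4;2];
      [:: 7;14;20;10;16;12;8;4];
      [:: 10;20;30;15;24;18;12;6];
      [:: 5;10;15;8;12;9;6;3];
      [:: 8;16;24;12;20;15;10;5];
      [:: 6;12;18;9;15;12;8;4];
      [:: 4;8;12;6;10;8;6;3];
      [:: 2;4;6;3;5;4;3;2]])%BZ.

(** A weight is written by its pairings with the simple roots; reflecting it in the simple root r
    therefore subtracts a multiple of row r of the Cartan matrix. *)
Definition refl (r : nat) (c : seq Z) : seq Z :=
  let x := nth 0%BZ c r in
  if x is Z0 then c else axpy (Z.opp x) (nth [::] cartan r) c.

(** Reflection on the side of N, in the root with simple-root coordinates p. That root has the
    pairings p t with M, and the row of the i-th basis vector loses (alpha_i, p) times this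
    combination. *)
Definition rrefl (p : seq Z) (t : seq (seq Z)) : seq (seq Z) :=
  let v := lcomb 8 p t in
  [seq (if q.1 is Z0 then q.2 else axpy (Z.opp q.1) v q.2)
     | q <- zip [seq dotl r p | r <- cartan] t].

Definition fneg (c : seq Z) : nat := find (fun x => Z.ltb x 0) c.

Definition up (c : seq Z) : seq Z :=
  if (fneg c < size c)%N then refl (fneg c) c else c.

(* The Weyl orbit of a dominant weight [c], without repetitions: [up] leads    *)
(* from every weight back to [c] along a unique path.                          *)
Fixpoint desc (f : nat) (c : seq Z) : seq (seq Z) :=
  if f is f'.+1 then
    c :: flatten [seq desc f' d | d <- [seq refl r c | r <- iota 0 8]
                                & (d != c) && (up d == c)]
  else [::].

(* Unlike [all], [allb] stops at the first failure under call by value. *)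
Fixpoint allb (T : Type) (a : T -> bool) (s : seq T) : bool :=
  if s is x :: s' then if a x then allb a s' else false else true.

Definition fundw (r : nat) (a : Z) : seq Z := mkseq (fun k => if k == r then a else 0%BZ) 8.

(* Weights of norm at most 8 that do not pair to 3 with the highest root.      *)
Definition dominants : seq (Z * seq Z) :=
  [:: (0%BZ, fundw 0 0); (2%BZ, fundw 7 1); (4%BZ, fundw 0 1); (8%BZ, fundw 7 2)].

Definition images : seq (Z * seq Z) :=
  flatten [seq [seq (nc.1, c) | c <- desc 5000 nc.2] | nc <- dominants].

Definition posroots : seq (seq Z) :=
  [seq p <- [seq [seq dotl r c | r <- icartan] | c <- desc 5000 (fundw 7 1)]
     | all (Z.leb 0) p].

(* The remaining orbit of norm 8 consists of the doubled roots, whose          *)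
(* coordinates are even.                                                       *)
Definition image_norm (n : Z) (v : seq Z) : bool :=
  match n with
  | 0 | 2 | 4 => true
  | 8 => all Z.even v
  | _ => false
  end%BZ.

(** If every row is dominant for the stabiliser of the rows before it, these simple reflections
    generate the stabiliser of all the rows in the Weyl group of M. *)
Definition fixers (t : seq (seq Z)) : seq nat :=
  [seq r <- iota 0 8 | all (fun c => Z.eqb (nth 0%BZ c r) 0) t].

Definition jdom (J : seq nat) (w : seq Z) : bool :=
  allb (fun r => Z.leb 0 (nth 0%BZ w r)) J.

(** The roots whose last nonzero coordinate m is the j-th: these are the ones whose images become
    known once row j is chosen. If u is the contribution of the earlier rows and w the new row, the
    image is u + m w; the data independent of w, including the norm of u, are computed once, and
    [pass] expands the norm of u + m w from them. *)
Definition tests (roots : seq (seq Z)) (j : nat) (t : seq (seq Z)) : seq (Z * (seq Z * (seq Z * Z))) :=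
  [seq (let u := lcomb 8 (take j p) t in
        let e := [seq dotl r u | r <- icartan] in
        (nth 0%BZ p j, (u, (e, dotl u e))))
     | p <- roots & Z.ltb 0 (nth 0%BZ p j) && all (Z.eqb 0) (drop j.+1 p)].

Definition pass (nw : Z * seq Z) (q : Z * (seq Z * (seq Z * Z))) : bool :=
  let: (m, (u, (e, n))) := q in
  image_norm (Z.add n (Z.mul m (Z.add (Z.mul 2 (dotl e nw.2)) (Z.mul m nw.1))))
             (axpy m nw.2 u).

Definition children (imgs : seq (Z * seq Z)) (roots : seq (seq Z)) (j : nat)
    (t : seq (seq Z)) : seq (seq (seq Z)) :=
  let J := fixers t in let q := tests roots j t in
  [seq rcons t nw.2 | nw <- imgs & if jdom J nw.2 then allb (pass nw) q else false].

(** Looks for a simple reflection that fixes the earlier rows and meets a negative coordinate of the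
    next one. When there is none, each row is dominant for the stabiliser of its predecessors, which
    is the normal form that [canon] aims at. *)
Fixpoint badrefl (J : seq nat) (t : seq (seq Z)) : option nat :=
  if t is c :: t' then
    if [seq r <- J | Z.ltb (nth 0%BZ c r) 0] is r :: _ then Some r
    else let J' := [seq r <- J | Z.eqb (nth 0%BZ c r) 0] in
         if J' is [::] then None else badrefl J' t'
  else None.

Fixpoint canon (f : nat) (t : seq (seq Z)) : seq (seq Z) :=
  if f is f'.+1 then
    if badrefl (iota 0 8) t is Some r then canon f' [seq refl r c | c <- t] else t
  else t.

Definition move (roots : seq (seq Z)) (w : seq nat) (t : seq (seq Z)) : seq (seq Z) :=
  foldl (fun u i => canon 1000 (rrefl (nth [::] roots i) u)) t w.

Definition supported (j : nat) (p : seq Z) : bool := all (Z.eqb 0) (drop j p).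

(* A word in [ws] lists roots of [N] whose reflections carry a candidate to an *)
(* orbit representative; the empty word declares a new representative.         *)
Definition level imgs roots (j : nat) (ts : seq (seq (seq Z))) (ws : seq (seq nat)) :
    option (seq (seq (seq Z))) :=
  let ks := flatten [seq children imgs roots j t | t <- ts] in
  let news := [seq k.1 | k <- zip ks ws & nilp k.2] in
  if (size ks == size ws)
     && all (fun k => all (fun i => (i < size roots)%N && supported j.+1 (nth [::] roots i)) k.2
                      && (move roots k.2 k.1 \in news)) (zip ks ws)
  then Some news else None.

Fixpoint search imgs roots (j : nat) (ts : seq (seq (seq Z))) (cert : seq (seq (seq nat))) :=
  if cert is ws :: cert' then
    if level imgs roots j ts ws is Some ts' then search imgs roots j.+1 ts' cert' else None
  else Some ts.

(* Each 0 starts a new word; the letter [a] stands for the root number 120-a. *)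
Definition decode (s : seq nat) : seq (seq nat) :=
  (foldr (fun a q => if a is 0 then ([::], q.1 :: q.2) else ((120 - a)%N :: q.1, q.2))
    ([::], [::]) s).2.

(** One list for each of the eight rows, holding one word per candidate in the order in which
    [children] produces them. *)
Definition certificate : seq (seq (seq nat)) := map decode
 [::
[:: 0;0;0;0];
[:: 0;0;0;0;0;3;0;0;0;2;0;0;1;0;0;1;0;3;0;2;0;3;0;0;2;0;0;2;0;1;0;3;0;2;0;2;0;0;2];
[:: 0;0;0;0;0;0;4;0;6;0;4;0;4;0;0;4;0;0;0;0;0;4;0;4;0;5;0;0;0;0;0;0;6;0;4;0;3;5;0;6;0;0;5;0;2;0;
0;0;1;0;1;0;0;2;0;3;0;0;0;1;0;3;5;0;0;4;0;0;6;0;6;0;4;0;5;0;3;0;0;4;0;4;5;0;6;0;2;6;0;4;0;3;5;0;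
2;5;0;0;6;0;4;0;5;0;6;0;6;0;5;0;0;3;5;0;5;0;6;0;6;0;4;0;0;0;5;0;3;0;2;0;5;0;2;0;3;0;0;0;1;0;0;0;
1;0;0;0;1;0;3;0;2;0;5;0;0;1;0];
[:: 0;0;0;0;0;0;0;0;7;0;0;0;0;0;0;7;0;0;0;7;0;0;7;0;0;0;7;0;7;0;0;7;0;5;10;0;2;6;0;6;10;0;8;0;2;
6;0;0;0;0;8;0;8;9;0;4;0;8;10;0;8;0;4;0;7;0;0;0;0;0;8;0;4;0;8;0;8;0;7;0;7;0;5;10;0;0;0;2;6;0;8;0;
8;10;0;2;6;0;0;3;5;10;0;4;8;0;4;9;0;7;0;8;0;7;0;0;5;10;0;0;9;0;7;8;0;7;0;8;9;0;8;0;4;0;7;0;0;0;7;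
0;8;0;8;0;5;8;0;4;0;10;0;0;8;0;4;8;0;9;0;0;8;0;4;10;0;8;0;0;10;0;7;10;0;2;6;10;0;7;0;8;0;7;0;8;9;
0;0;8;0;0;0;7;0;5;10;0;0;0;6;10;0;8;0;3;5;10;0;7;0;8;0;7;0;3;5;10;0;0;0;7;0;5;10;0;8;0;4;9;0;9;0;
5;10;0;10;0;0;3;9;0;9;0;8;0;0;6;0;2;6;0;2;0;7;0;7;0;0;2;0;6;0;0;10;0;7;10;0;0;2;0;0;7;0;7;0;7;0;
2;7;0;0;4;10;0;0;9;0;3;7;0;3;0;7;0;7;10;0;1;7;0;4;8;10;0;6;8;0;7;0;0;0;4;0;5;0;1;0;3;5;0;6;0;5;0;
4;0;3;0;0;0;6;0;0;4;0;3;0;5;0;0;6;0;1;0;5;10;0;0;0;1;0;1;0;2;0;3;0;7;0;0;0;7;0;0;0;2;0;3;0;2;0;0;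
0;3;0;1;0;1;0;0;5;10;0;7;10;0;7;0;4;8;0;8;0;3;7;10;0;8;10;0;10;0;0;1;10;0;4;9;0;3;0;4;10;0;0;4;6;
9;0;3;0;0;5;9;0;2;7;0;4;10;0;2;6;9;0;2;10;0;6;9;0;5;9;0;0;8;10;0;9;10;0;6;8;9;0;8;0;2;10;0;8;9;0;
8;0;8;0;7;0;6;10;0;6;10;0;1;4;10;0;9;0;2;6;0;3;0;5;0;9;10;0;0;3;5;0;1;4;0;0;3;0;0;0;4;0;8;0;4;8;
0;10;0;0;6;8;0;0;0;3;0;6;0;3;0;4;0;4;0;0;8;0;6;0;8;9;0;0;6;0;3;5;0;6;9;0;0;5;9;10;0;1;0;2;5;9;0;
6;9;0;0;2;6;0;5;10;0;4;0;6;10;0;6;10;0;2;9;0;8;0;3;5;0;4;0;0;2;6;0;2;6;0;1;0;5;10;0;6;9;0;8;10;0;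
8;0;0;10;0;1;0;9;0;0;4;5;10;0;2;6;0;9;0;3;0;9;10;0;0;1;4;0;0;10;0;10;0;0;4;0;6;0;0;6;0;5;9;0;3;
10;0;3;9;0;3;9;0;0;2;0;7;0;0;2;0;7;0;8;0;0;0;1;0;9;0;0;2;0;0;5;0;4;0;4;0;3;0;1;0;6;0;0;6;0;2;6;0;
6;0;4;9;0;9;10;0;7;0;2;7;0;1;7;0;0;7;9;0;2;0;0;2;0;10;0;7;9;0;5;8;0;10;0;7;0;5;0;4;8;10;0;4;9;0;
5;0;4;10;0;7;0;9;0;0;6;8;0;7;0;4;10;0;3;5;0;7;0;3;7;0;7;0;9;0;0;3;7;0;3;0;9;0;0;9;0;9;0;2;5;9;0;
3;0;0;7;10;0;3;0;0;0;0;2;0;1;0;3;0;0;2;0;9;0;0;8;0;6;0;6;0;9;0;10;0;5;0;4;0;4;0;5;0;4;0;7;0;3;0;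
1;0;0;5;0;4;0;4;0;0;6;0;2;6;0;6;0;6;0;5;10;0;1;0;4;9;10;0;4;10;0;5;8;0;7;0;4;9;0;0;4;9;0;4;9;0;4;
9;0;2;9;0;7;9;10;0;5;10;0;6;10;0;7;0;2;10;0;7;9;0;2;10;0;6;10;0;7;9;0;4;10;0;9;0;0;9;0;3;0;0;9;0;
5;0;6;0;4;0];
[:: 0;0;0;0;0;15;20;0;0;11;0;0;0;15;20;0;0;15;20;0;15;20;0;0;15;20;0;0;0;11;0;0;15;20;0;15;20;0;
0;0;11;0;0;0;11;0;8;18;0;0;11;0;8;12;20;0;0;7;0;0;12;17;0;7;20;0;20;0;11;0;0;8;12;20;0;7;11;20;0;
7;15;0;14;20;0;4;12;15;0;4;9;20;0;11;0;7;11;0;8;12;0;0;0;7;0;11;0;4;15;0;11;15;20;0;11;0;8;12;20;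
0;0;7;11;0;6;17;0;7;11;0;11;0;4;12;20;0;11;0;8;18;0;7;11;0;11;0;11;0;8;12;20;0;0;7;0;0;0;12;0;14;
20;0;4;20;0;7;11;0;8;20;0;11;0;0;11;0;7;0;0;17;0;20;0;7;11;20;0;0;7;11;0;0;20;0;5;14;0;20;0;0;11;
0;7;11;0;10;15;0;10;15;19;0;15;19;0;8;0;4;10;15;0;0;5;20;0;0;7;0;20;0;7;15;20;0;0;13;20;0;8;0;0;
0;12;0;17;0;11;20;0;11;20;0;15;0;8;12;0;20;0;0;20;0;17;0;20;0;8;0;0;11;0;12;0;11;12;20;0;4;12;15;
20;0;15;0;7;15;0;12;15;0;11;0;12;0;8;20;0;0;7;0;11;17;0;20;0;0;0;0;0;11;20;0;15;0;0;20;0;20;0;11;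
20;0;14;17;0;14;0;12;17;0;9;18;0;18;0;17;18;0;9;17;19;0;11;17;20;0;8;15;0;12;14;0;0;5;14;16;0;3;
13;19;0;8;16;0;12;18;20;0;14;17;0;14;0;14;0;2;0;0;10;14;0;1;11;0;0;13;16;0;3;13;0;5;12;18;0;9;13;
20;0;17;19;0;19;20;0;14;18;0;0;1;0;2;0;13;19;0;0;4;13;19;20;0;6;12;18;0;5;12;19;0;5;0;0;17;0;4;0;
17;18;0;0;17;18;0;5;0;14;18;0;11;18;0;4;0;9;0;6;0;0;7;0;5;0;1;0;6;9;0;2;0;4;9;0;4;0;0;0;7;0;0;0;
7;0;8;0;6;0;9;0;4;0;10;0;2;6;0;11;0;7;17;0;11;0;15;20;0;5;19;0;15;18;20;0;17;20;0;17;18;0;16;20;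
0;16;18;19;0;6;0;5;0;4;0;15;20;0;12;15;20;0;4;0;0;11;0;0;11;0;0;2;0;3;0;9;17;0;15;20;0;10;14;18;
0;14;17;0;6;9;17;0;16;19;0;4;19;0;6;0;0;10;18;0;0;4;13;15;0;6;18;0;4;18;20;0;4;20;0;5;16;0;11;0;
12;18;0;6;18;0;7;0;0;2;0;1;0;0;0;8;12;20;0;7;0;0;16;0;7;20;0;14;16;0;7;18;20;0;15;16;0;4;20;0;10;
20;0;3;0;0;11;17;0;0;0;14;18;0;4;15;20;0;15;0;5;8;19;0;10;14;18;0;20;0;16;18;0;0;1;0;2;0;10;20;0;
6;17;0;13;15;0;16;20;0;7;16;20;0;3;16;20;0;10;16;18;20;0;9;19;0;2;11;0;10;19;0;16;0;4;5;13;0;19;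
0;4;14;0;11;15;16;0;11;19;20;0;6;13;20;0;5;19;20;0;4;14;20;0;14;16;18;0;5;16;0;9;19;20;0;6;13;0;
0;6;14;0;7;11;18;0;0;11;19;20;0;18;0;19;0;18;0;5;6;19;0;0;8;17;20;0;10;18;0;7;0;5;14;19;0;0;8;18;
20;0;17;0;5;6;20;0;18;0;0;11;16;0;4;20;0;8;20;0;0;3;0;18;0;0;4;0;8;0;2;11;20;0;20;0;3;7;11;0;1;
20;0;15;0;2;17;20;0;11;12;19;0;6;9;13;0;3;14;0;13;16;0;0;1;0;8;17;0;14;19;0;5;12;16;0;11;19;0;13;
0;0;0;14;0;0;9;0;13;0;0;11;17;0;13;20;0;13;16;0;13;17;0;8;16;0;17;0;2;17;0;16;0;0;17;0;11;19;0;4;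
19;0;17;0;5;19;0;17;0;19;0;8;15;20;0;0;0;12;0;15;18;0;12;19;0;13;15;0;11;17;0;2;7;18;0;14;20;0;
17;19;0;17;19;0;4;9;0;0;14;19;20;0;12;15;19;0;17;19;0;10;17;20;0;0;12;17;0;0;7;0;17;18;0;2;9;16;
0;13;17;0;12;0;12;0;8;16;18;19;0;11;18;0;7;20;0;8;17;18;0;13;0;15;20;0;17;18;0;11;19;0;8;16;0;1;
0;15;20;0;12;20;0;2;0;0;0;17;0;4;0;8;0;0;2;0;0;2;0;3;0;4;0;3;0;8;0;8;19;0;4;9;15;20;0;17;19;0];
[:: 0;0;21;0;21;0;21;0;36;0;0;22;36;0;0;0;22;36;0;0;11;35;0;11;35;0;36;0;0;36;0;36;0;10;14;36;0;
21;0;10;14;36;0;11;35;0;0;0;31;0;0;22;0;15;23;34;0;11;35;0;11;35;0;21;0;10;14;36;0;36;0;36;0;0;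
36;0;10;14;36;0;11;35;0;7;22;36;0;0;0;0;0;22;0;11;35;0;21;0;21;0;36;0;0;22;36;0;14;28;0;14;22;28;
0;22;0;23;34;36;0;17;25;0;23;29;34;0;35;36;0;0;21;35;0;10;14;0;7;0;21;35;0;11;0;0;6;17;0;6;17;0;
0;7;0;22;35;0;6;17;28;0;36;0;0;7;10;31;34;0;35;36;0;35;0;23;0;35;36;0;10;14;0;22;35;0;7;0;31;35;
0;0;6;17;0;35;36;0;0;10;14;0;7;36;0;31;0;0;8;21;23;36;0;23;31;34;0;11;22;0;27;36;0;0;7;0;8;0;12;
0;11;0;10;14;0;22;35;0;21;0;17;22;30;35;0;26;0;0;10;19;26;0;4;0;15;33;0;0;21;31;0;11;22;36;0;21;
34;36;0;5;10;30;0;11;20;34;0;4;23;29;0;31;0;23;0;4;31;0;21;34;0;0;15;0;21;28;0;26;0;0;21;0;28;0;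
31;0;9;34;36;0;18;30;32;0;21;36;0;16;34;35;0;14;25;36;0;12;22;33;35;0;14;25;0;0;21;29;34;0;22;26;
36;0;23;26;0;25;33;0;19;35;0;30;0;23;33;0;35;0;19;0;18;0;20;0;0;24;33;0;24;30;0;0;20;0;18;0;19;0;
17;28;0;29;35;36;0;2;0;0;10;29;35;36;0;17;25;35;0;0;28;0;10;25;36;0;2;0;25;36;0;17;25;36;0;12;35;
0;21;0;13;22;33;0;0;8;0;4;10;19;35;0;10;0;18;27;30;0;4;19;35;0;24;30;35;0;12;26;34;0;36;0;7;9;30;
36;0;3;7;30;36;0;7;8;30;36;0;7;30;36;0;7;8;29;36;0;7;29;36;0;16;0;14;0;4;0;0;7;0;13;0;16;19;0;1;
0;14;16;0;2;0;12;16;0;12;0;6;0;9;0;11;0;10;14;0;0;21;0;0;7;0;7;19;0;19;0;8;0;14;0;9;0;12;0;10;0;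
9;19;0;22;36;0;8;23;31;0;11;36;0;0;16;24;36;0;23;31;0;8;0;24;30;0;10;0;25;29;0;9;0;0;22;36;0;36;
0;0;11;0;6;21;0;5;21;0;4;21;0;21;0;11;35;0;22;35;0;0;0;36;0;6;21;28;0;21;26;0;21;27;0;21;28;0;26;
31;0;8;12;26;0;5;0;26;0;0;1;0;6;28;30;36;0;28;0;6;25;33;36;0;16;19;36;0;6;24;34;0;3;5;36;0;11;24;
36;0;25;35;36;0;8;31;0;35;36;0;21;0;3;21;31;0;4;20;31;36;0;21;31;0;1;21;0;18;0;7;0;0;3;0;0;1;0;
35;0;35;36;0;1;21;36;0;8;19;33;0;0;15;19;28;0;22;25;28;34;0;6;28;0;3;21;0;22;25;28;0;21;0;6;29;0;
29;31;0;3;36;0;2;3;36;0;0;17;26;30;0;3;0;28;34;0;8;32;35;0;9;21;34;0;10;28;35;0;11;14;25;0;14;22;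
24;0;6;29;36;0;25;30;0;2;13;29;36;0;18;32;36;0;25;28;30;0;33;34;0;24;33;0;26;30;34;0;2;18;0;0;7;
26;34;0;26;34;0;3;27;28;36;0;19;31;33;34;0;4;21;31;36;0;12;29;0;15;29;0;19;29;31;0;19;29;0;29;31;
0;29;0;4;29;0;8;29;0;18;34;0;4;12;32;0;23;30;33;0;24;27;0;0;28;34;0;32;0;0;33;36;0;0;2;0;1;0;19;
0;36;0;10;14;36;0;12;32;0;18;30;0;0;8;33;0;23;0;18;26;0;9;28;0;17;25;0;35;0;9;16;34;0;28;29;0;10;
29;34;0;28;29;0;25;29;0;15;27;35;0;0;14;0;8;31;32;0;0;21;0;11;0;13;0;16;0;0;6;0;10;0;1;0;0];
[:: 0;0;0;0;0;38;0;59;0;0;0;0;37;0;22;60;0;21;0;38;0;0;38;0;0;14;32;63;0;0;59;0;0;58;0;37;0;0;59;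
0;52;53;0;15;51;62;0;0;11;0;39;60;0;0;39;60;0;48;0;7;61;0;18;47;0;0;0;39;52;0;0;21;61;0;36;56;0;
52;53;61;0;46;58;0;56;59;63;0;0;0;0;24;41;52;63;0;8;27;30;60;0;0;1;0;0;3;0;37;38;0;37;39;0;37;0;
0;0;10;0;37;60;62;0;43;53;0;19;23;59;61;0;19;47;57;0;31;54;57;63;0;44;0;30;52;63;0;59;62;0;57;62;
0;15;59;62;0;37;45;59;0;17;59;62;0;18;30;52;63;0;37;39;59;63;0;5;30;52;63;0;9;60;0;0;32;0;29;0;
27;0;24;0;33;0;30;0;28;0;25;0;26;0;23;0;34;0;31;0;22;0;35;0;36;0;0;21;0;0;22;35;0;22;36;0;21;35;
0;21;36;0;23;36;0;21;34;0;24;36;0;21;32;0;25;36;0;21;33;0;59;0;17;35;47;0;39;52;0;18;35;47;0;5;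
35;47;0;3;35;47;0;39;59;63;0;35;47;0;39;59;62;0;35;46;0;14;47;59;60;0;11;16;20;45;0;25;28;47;60;
0;9;21;32;61;0;4;31;55;0;4;31;54;58;0;38;0;36;60;0;11;24;27;63;0;21;57;0;0;57;0;59;60;0;34;48;0;
4;42;0;6;38;59;0;38;59;0;0;0;0;20;0;19;0;22;50;61;0;22;28;60;0;14;49;62;0;44;48;63;0;5;16;44;0;
31;38;55;62;0;12;52;54;0;55;56;0;15;61;0;49;0;0;18;0;20;0;0;9;56;62;0;37;63;0;15;17;36;62;0;0;36;
0;35;0;6;35;51;55;0;34;56;57;62;63;0;13;44;57;63;0];
[:: 0;0;64;0;0;120;0;0;117;0;0;120;0;117;0;119;0;65;0;118;120;0;0;87;119;0;0;102;0;67;88;0;103;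
116;0;0;0;120;0;103;116;119;0;21;89;0;21;94;0;79;116;0;49;80;104;117;0;24;87;111;0;24;59;111;0;
75;85;111;120;0;19;89;111;115;0;5;10;85;112;0;74;92;114;117;0;74;92;115;117;0;0;120;0;119;0;108;
120;0;24;42;79;118;0;45;78;99;115;0;48;69;92;106;0;32;50;87;115;0;47;78;98;115;0;26;45;83;117;0;
43;78;101;115;0;28;44;84;117;0;43;77;100;115;0;27;45;84;117;0;0;88;97;0;41;70;115;0;0;119;0;64;0;
82;92;98;0;85;95;101;120;0;75;83;115;117;0;67;99;114;117;0;18;47;119;0;0;120;0]].

(** The zero matrix at the head is the orthogonal pair; the last entry, twice the Cartan matrix, is
    M = N; entry 2 is the one whose form is not positive semidefinite. *)
Definition finals : seq (seq (seq Z)) := (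
[:: [:: [:: 0;0;0;0;0;0;0;0]; [:: 0;0;0;0;0;0;0;0]; [:: 0;0;0;0;0;0;0;0]; [:: 0;0;0;0;0;0;0;0]; [:: 0;0;0;0;0;0;0;0]; [:: 0;0;0;0;0;0;0;0]; [:: 0;0;0;0;0;0;0;0]; [:: 0;0;0;0;0;0;0;0]];
[:: [:: 0;0;0;0;0;0;0;0]; [:: 0;0;0;0;0;0;0;0]; [:: 0;0;0;0;0;0;0;0]; [:: 0;0;0;0;0;0;0;0]; [:: 0;0;0;0;0;0;0;0]; [:: 0;0;0;0;0;0;0;0]; [:: 0;0;0;0;0;0;0;1]; [:: 0;0;0;0;0;0;0;-1]];
[:: [:: 0;0;0;0;0;0;0;0]; [:: 0;0;0;0;0;0;0;0]; [:: 0;0;0;0;0;0;0;0]; [:: 0;0;0;0;0;0;0;0]; [:: 0;0;0;0;0;0;0;1]; [:: 0;0;0;0;0;0;0;-1]; [:: 0;0;0;0;0;0;0;-1]; [:: 0;0;0;0;0;0;0;0]];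
[:: [:: 0;0;0;0;0;0;0;0]; [:: 0;0;0;0;0;0;0;0]; [:: 0;0;0;0;0;0;0;0]; [:: 0;0;0;0;0;0;0;0]; [:: 0;0;0;0;0;0;0;1]; [:: 0;0;0;0;0;0;0;-1]; [:: 0;0;0;0;0;0;0;-1]; [:: 1;0;0;0;0;0;0;0]];
[:: [:: 0;0;0;0;0;0;0;0]; [:: 0;0;0;0;0;0;0;0]; [:: 0;0;0;0;0;0;0;0]; [:: 0;0;0;0;0;0;0;1]; [:: 0;0;0;0;0;0;0;-1]; [:: 0;0;0;0;0;0;1;-1]; [:: 1;0;0;0;0;0;-2;2]; [:: -2;0;0;0;0;1;0;0]];
[:: [:: 0;0;0;0;0;0;0;0]; [:: 0;0;0;0;0;0;0;0]; [:: 0;0;0;0;0;0;0;0]; [:: 1;0;0;0;0;0;0;0]; [:: -1;0;0;0;0;0;0;0]; [:: -1;0;0;0;0;1;0;0]; [:: 2;0;0;0;0;-2;0;2]; [:: 0;0;0;0;0;0;2;-4]];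
[:: [:: 0;0;0;0;0;0;0;0]; [:: 0;0;0;0;0;0;0;0]; [:: 0;0;0;0;0;0;0;1]; [:: 1;0;0;0;0;0;0;-2]; [:: -2;1;0;0;0;0;0;-1]; [:: 1;-2;0;0;1;0;0;1]; [:: 1;1;0;0;-2;1;0;0]; [:: 0;0;0;0;1;-2;1;0]];
[:: [:: 0;0;0;0;0;0;0;0]; [:: 0;0;0;0;0;0;0;1]; [:: 0;0;0;0;0;0;0;0]; [:: 0;0;0;1;0;0;0;-2]; [:: 0;0;0;-2;1;0;0;0]; [:: 0;1;0;1;-2;0;1;0]; [:: 0;-1;0;1;1;0;-2;1]; [:: 0;0;0;0;0;0;0;0]];
[:: [:: 0;0;0;0;0;0;0;1]; [:: 0;0;0;0;0;0;1;-2]; [:: 0;0;0;0;0;1;-2;1]; [:: 1;0;0;0;0;-1;1;0]; [:: -1;0;0;0;1;-1;0;0]; [:: 0;0;1;0;-2;0;1;1]; [:: 1;0;-2;1;1;1;0;-1]; [:: -1;1;0;-1;0;0;0;0]];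
[:: [:: 0;0;0;0;0;0;0;1]; [:: 0;0;0;0;0;0;1;-2]; [:: 0;0;0;0;0;1;-2;1]; [:: 0;0;0;0;1;-2;1;0]; [:: 1;0;0;0;-1;0;1;0]; [:: -2;1;0;0;0;0;0;0]; [:: 1;-2;1;0;0;0;0;0]; [:: 0;1;-2;1;1;0;0;0]];
[:: [:: 0;0;0;0;0;0;0;1]; [:: 0;0;0;0;0;0;1;-2]; [:: 0;1;0;0;0;0;-2;1]; [:: 0;-2;0;1;1;0;0;0]; [:: 0;0;0;-2;0;0;2;0]; [:: 1;-1;0;2;-1;1;-1;0]; [:: -2;1;0;0;0;0;0;0]; [:: 1;0;1;-1;0;-2;1;0]];
[:: [:: 1;0;0;0;0;0;0;0]; [:: -2;0;0;0;0;1;0;0]; [:: 0;0;1;0;0;-2;0;1]; [:: 0;1;-2;1;1;0;1;-2]; [:: 1;0;0;0;-2;2;0;0]; [:: 1;-2;0;0;2;-1;0;0]; [:: -1;2;0;-2;0;0;0;0]; [:: 0;0;-1;2;0;1;-2;1]];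
[:: [:: 0;0;0;0;0;0;0;2]; [:: 0;0;0;0;0;0;2;-4]; [:: 0;0;0;0;0;2;-4;2]; [:: 0;0;0;0;2;-4;2;0]; [:: 2;0;0;0;-2;0;2;0]; [:: -4;2;0;0;0;0;0;0]; [:: 2;-4;2;0;0;0;0;0]; [:: 0;2;-4;2;2;0;0;0]]])%BZ.

Definition inorm (v : seq Z) : Z := dotl v [seq dotl r v | r <- icartan].

Lemma search_finals : search images posroots 0 [:: [::]] certificate = Some finals.
Proof. by vm_cast_no_check (@erefl (option (seq (seq (seq Z)))) (Some finals)). Qed.

Lemma images_norm :
  all (fun q => Z.eqb (inorm q.2) q.1 && image_norm q.1 q.2) images.
Proof. by vm_cast_no_check (erefl true). Qed.

Lemma posroots_norm :
  all (fun p => (size p == 8) && Z.eqb (dotl p [seq dotl r p | r <- cartan]) 2) posroots.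
Proof. by vm_cast_no_check (erefl true). Qed.

(** * Integer matrices as lists *)

Lemma intZD x y : int_of_Z (Z.add x y) = int_of_Z x + int_of_Z y.
Proof. exact: rmorphD. Qed.

Lemma intZM x y : int_of_Z (Z.mul x y) = int_of_Z x * int_of_Z y.
Proof. exact: rmorphM. Qed.

Lemma intZN x : int_of_Z (Z.opp x) = - int_of_Z x.
Proof. exact: rmorphN. Qed.

Lemma intZ_inj : injective int_of_Z.
Proof. exact: can_inj int_of_ZK. Qed.

Lemma intZ_le x y : (int_of_Z x <= int_of_Z y) = Z.leb x y.
Proof. by apply/idP/idP; lia. Qed.

Lemma size_axpy a x y : size (axpy a x y) = minn (size x) (size y).
Proof. by rewrite size_map size_zip. Qed.

Lemma nth_axpy a x y k : size x = size y ->
  int_of_Z (nth 0%BZ (axpy a x y) k)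
  = int_of_Z a * int_of_Z (nth 0%BZ x k) + int_of_Z (nth 0%BZ y k).
Proof.
move=> sxy; case: (ltnP k (size x)) => lek; last first.
  by rewrite !nth_default ?size_axpy -?sxy ?minnn // mulr0.
rewrite (nth_map (0%BZ, 0%BZ)) ?size_zip -?sxy ?minnn // nth_zip //=.
by rewrite intZD intZM.
Qed.

Definition wide (n : nat) (t : seq (seq Z)) : bool := all (fun c => size c == n) t.

Lemma size_lcomb n p t : wide n t -> size (lcomb n p t) = n.
Proof.
rewrite /lcomb; elim: t p => [|c t IH] [|a p] //=; rewrite ?size_nseq //.
move=> /andP[/eqP sc wt]; case: a => [|a|a] /=; rewrite ?IH // size_axpy IH //.
  by rewrite sc minnn.
by rewrite sc minnn.
Qed.

Lemma nth_lcomb n p t k K : wide n t -> (size t <= K)%N ->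
  int_of_Z (nth 0%BZ (lcomb n p t) k) =
  \sum_(l < K) int_of_Z (nth 0%BZ p l) * int_of_Z (nth 0%BZ (nth [::] t l) k).
Proof.
rewrite /lcomb; elim: t p K => [|c t IH] [|a p] K /=.
- rewrite nth_nseq if_same => _ _; rewrite big1 // => l _.
  by rewrite !nth_nil mulr0.
- rewrite nth_nseq if_same => _ _; rewrite big1 // => l _.
  by rewrite !nth_nil mulr0.
- move=> _ _; rewrite nth_nseq if_same big1 // => l _.
  by rewrite nth_nil mul0r.
move=> /andP[/eqP sc wt]; case: K => [//|K] leK.
have E : int_of_Z (nth 0%BZ (axpy a c (lcomb n p t)) k) =
    \sum_(l < K.+1) int_of_Z (nth 0%BZ (a :: p) l)
       * int_of_Z (nth 0%BZ (nth [::] (c :: t) l) k).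
  rewrite nth_axpy ?size_lcomb // big_ord_recl /=; congr (_ + _).
  by rewrite (IH p K).
case: a E => [|a|a] //= E.
by rewrite (IH p K) // big_ord_recl /= mul0r add0r.
Qed.

Lemma dotlE x y K : (size y <= K)%N || (size x <= K)%N ->
  int_of_Z (dotl x y) =
  \sum_(l < K) int_of_Z (nth 0%BZ x l) * int_of_Z (nth 0%BZ y l).
Proof.
rewrite /dotl; elim: x y K => [|a x IH] [|b y] K /=.
- by move=> _; rewrite big1 // => l _; rewrite nth_nil mul0r.
- by move=> _; rewrite big1 // => l _; rewrite nth_nil mul0r.
- by move=> _; rewrite big1 // => l _; rewrite nth_nil mulr0.
case: K => [//|K] leK; rewrite big_ord_recl intZD intZM /=; congr (_ + _).
exact: IH.
Qed.

(** Missing entries read as 0, and entries outside the format are ignored. This is why the product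
    lemmas below bound the sizes of the lists. *)
Definition mxZ m n (l : seq (seq Z)) : 'M[int]_(m, n) :=
  \matrix_(i, j) int_of_Z (nth 0%BZ (nth [::] l i) j).

Definition rowZ n (x : seq Z) : 'rV[int]_n := \row_j int_of_Z (nth 0%BZ x j).

Lemma rowZE n x i : rowZ n x 0 i = int_of_Z (nth 0%BZ x i).
Proof. by rewrite mxE. Qed.

Lemma row_mxZ m n l (i : 'I_m) : row i (mxZ m n l) = rowZ n (nth [::] l i).
Proof. by apply/rowP => j; rewrite !mxE. Qed.

Lemma rowZ_inj n x y : size x = n -> size y = n -> rowZ n x = rowZ n y -> x = y.
Proof.
move=> sx sy /rowP e; apply: (@eq_from_nth _ 0%BZ); rewrite ?sx // => i lti.
by have := e (Ordinal lti); rewrite !mxE => /intZ_inj.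
Qed.

Lemma rowZ_lcomb m n p t : wide n t -> (size t <= m)%N ->
  rowZ n (lcomb n p t) = rowZ m p *m mxZ m n t.
Proof.
move=> wt st; apply/rowP => k; rewrite !mxE (nth_lcomb _ _ wt st).
by apply: eq_bigr => l _; rewrite !mxE.
Qed.

Lemma rowZ_axpy n a x y : size x = n -> size y = n ->
  rowZ n (axpy a x y) = int_of_Z a *: rowZ n x + rowZ n y.
Proof. by move=> sx sy; apply/rowP => k; rewrite !mxE nth_axpy // sx. Qed.

Definition mulZ n (a b : seq (seq Z)) : seq (seq Z) := [seq lcomb n r b | r <- a].

Lemma mxZ_mul m k n a b : wide n b -> (size b <= k)%N ->
  mxZ m n (mulZ n a b) = mxZ m k a *m mxZ k n b.
Proof.
move=> wb sb; apply/row_matrixP => i; rewrite row_mul !row_mxZ -rowZ_lcomb //.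
case: (ltnP i (size a)) => lei; first by rewrite (nth_map [::]).
rewrite nth_default ?size_map // [nth [::] a i]nth_default //.
by rewrite (@rowZ_lcomb k) //; apply/rowP => j; rewrite !mxE big1 ?nth_nil // => l _;
  rewrite mxE nth_nil mul0r.
Qed.

Definition trZ (m n : nat) (a : seq (seq Z)) : seq (seq Z) :=
  mkseq (fun j => mkseq (fun i => nth 0%BZ (nth [::] a i) j) m) n.

Lemma mxZ_tr m n a : mxZ n m (trZ m n a) = (mxZ m n a)^T.
Proof. by apply/matrixP => i j; rewrite !mxE !nth_mkseq. Qed.

Definition addZ (m n : nat) (c : Z) (a b : seq (seq Z)) : seq (seq Z) :=
  mkseq (fun i => mkseq (fun j =>
    Z.add (nth 0%BZ (nth [::] a i) j) (Z.mul c (nth 0%BZ (nth [::] b i) j))) n) m.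

Lemma mxZ_add m n c a b :
  mxZ m n (addZ m n c a b) = mxZ m n a + int_of_Z c *: mxZ m n b.
Proof. by apply/matrixP => i j; rewrite !mxE !nth_mkseq // intZD intZM. Qed.

Definition diagZ (s : seq Z) : seq (seq Z) :=
  mkseq (fun i => mkseq (fun j => if i == j then nth 0%BZ s i else 0%BZ) (size s)) (size s).

Definition scalZ (n : nat) (a : Z) := diagZ (nseq n a).

Lemma mxZ_scal n a : mxZ n n (scalZ n a) = (int_of_Z a)%:M.
Proof.
apply/matrixP => i j; rewrite !mxE !nth_mkseq ?size_nseq //.
by rewrite nth_nseq ltn_ord val_eqE; case: eqP.
Qed.

(** * Spans and Gram matrices *)

Section Spans.
Context {R : realType}.

Definition rz m n (C : 'M[int]_(m, n)) : 'M[R]_(m, n) := map_mx intr C.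

Lemma rzM m n p (A : 'M[int]_(m, n)) (B : 'M[int]_(n, p)) : rz (A *m B) = rz A *m rz B.
Proof. exact: map_mxM. Qed.

Lemma rzD m n (A B : 'M[int]_(m, n)) : rz (A + B) = rz A + rz B.
Proof. exact: map_mxD. Qed.

Lemma rzN m n (A : 'M[int]_(m, n)) : rz (- A) = - rz A.
Proof. exact: map_mxN. Qed.

Lemma rz_tr m n (A : 'M[int]_(m, n)) : rz A^T = (rz A)^T.
Proof. by rewrite /rz map_trmx. Qed.

Lemma rzZ m n a (A : 'M[int]_(m, n)) : rz (a *: A) = a%:~R *: rz A.
Proof. exact: map_mxZ. Qed.

Lemma rz_scalar n a : rz (a%:M : 'M[int]_n) = (a%:~R)%:M.
Proof. exact: map_scalar_mx. Qed.

Lemma rz0 m n : rz (0 : 'M_(m, n)) = 0.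
Proof. exact: map_mx0. Qed.

Lemma rz_inj m n : injective (@rz m n).
Proof.
move=> A B /matrixP e; apply/matrixP => i j.
by have := e i j; rewrite !mxE => /intr_inj.
Qed.

Lemma rz_row m n (A : 'M[int]_(m, n)) i : rz (row i A) = row i (rz A).
Proof. by rewrite /rz map_row. Qed.

Lemma rz_delta m n i j : rz (delta_mx i j : 'M_(m, n)) = delta_mx i j.
Proof. exact: map_delta_mx. Qed.

Lemma rz_int m n (A : 'M[R]_(m, n)) :
  (forall i j, A i j \is a Num.int) -> exists C, A = rz C.
Proof.
move=> h; exists (\matrix_(i, j) Num.floor (A i j)).
by apply/matrixP => i j; rewrite !mxE floorK.
Qed.

Definition zspan m d (B : 'M[R]_(m, d)) : set 'rV[R]_d :=
  [set rz c *m B | c in [set: 'rV[int]_m]].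

Lemma zspan_mul m d (B : 'M[R]_(m, d)) c : zspan B (rz c *m B).
Proof. by exists c. Qed.

Lemma zspan_row m d (B : 'M[R]_(m, d)) i : zspan B (row i B).
Proof. by exists (delta_mx 0 i) => //; rewrite rz_delta rowE. Qed.

Lemma zspan0 m d (B : 'M[R]_(m, d)) : zspan B 0.
Proof. by exists 0 => //; rewrite rz0 mul0mx. Qed.

Lemma zspanD m d (B : 'M[R]_(m, d)) x y : zspan B x -> zspan B y -> zspan B (x + y).
Proof. by move=> [a _ <-] [b _ <-]; exists (a + b) => //; rewrite rzD mulmxDl. Qed.

Lemma zspanN m d (B : 'M[R]_(m, d)) x : zspan B x -> zspan B (- x).
Proof. by move=> [a _ <-]; exists (- a) => //; rewrite rzN mulNmx. Qed.

Lemma zspan_int_submod m d (B : 'M[R]_(m, d)) : int_submod (zspan B).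
Proof. by split=> [|x y hx hy]; [exact: zspan0|apply: zspanD hx (zspanN hy)]. Qed.

Lemma zspan_subset m d (B : 'M[R]_(m, d)) (S : set 'rV[R]_d) :
  int_submod S -> (forall i, S (row i B)) -> zspan B `<=` S.
Proof.
move=> [S0 SB] SR x [c _ <-].
have SN y : S y -> S (- y) by move=> /(SB _ _ S0); rewrite sub0r.
have SD y z : S y -> S z -> S (y + z) by move=> hy /SN /(SB _ _ hy); rewrite opprK.
rewrite mulmx_sum_row; elim/big_ind: _ => // i _; rewrite mxE.
case: (c 0 i) => n; last first.
  rewrite NegzE mulrNz scaleNr; apply: SN; elim: (n.+1) => [|k IH].
    by rewrite scale0r.
  by rewrite intS mulrzDr scalerDl scale1r; apply: SD.
elim: n => [|k IH]; first by rewrite scale0r.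
by rewrite intS mulrzDr scalerDl scale1r; apply: SD.
Qed.

Lemma zspan_le m n d (C : 'M[R]_(m, d)) (B : 'M[R]_(n, d)) U :
  C = rz U *m B -> zspan C `<=` zspan B.
Proof. by move=> -> x [c _ <-]; exists (c *m U) => //; rewrite rzM mulmxA. Qed.

Lemma zspan_eq m n d (C : 'M[R]_(m, d)) (B : 'M[R]_(n, d)) U V :
  C = rz U *m B -> B = rz V *m C -> zspan C = zspan B.
Proof. by move=> e1 e2; rewrite eqEsubset; split; [apply: zspan_le e1|apply: zspan_le e2]. Qed.

Lemma zspan_rows m n d (C : 'M[R]_(m, d)) (B : 'M[R]_(n, d)) :
  (forall i, zspan B (row i C)) -> exists U, C = rz U *m B.
Proof.
move=> h.
have /choice[f fP] : forall i, exists c : 'rV[int]_n, rz c *m B = row i C.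
  by move=> i; have [c _ <-] := h i; exists c.
exists (\matrix_i f i); apply/row_matrixP => i.
by rewrite row_mul -rz_row rowK fP.
Qed.

Lemma dotC d (x y : 'rV[R]_d) : dot x y = dot y x.
Proof. by rewrite !dotE; apply: eq_bigr => i _; rewrite mulrC. Qed.

Lemma dotDl d (x y z : 'rV[R]_d) : dot (x + y) z = dot x z + dot y z.
Proof. by rewrite /dot mulmxDl mxE. Qed.

Lemma dotNl d (x z : 'rV[R]_d) : dot (- x) z = - dot x z.
Proof. by rewrite /dot mulNmx mxE. Qed.

Lemma dotZl d a (x z : 'rV[R]_d) : dot (a *: x) z = a * dot x z.
Proof. by rewrite /dot -scalemxAl mxE. Qed.

Lemma dotDr d (x y z : 'rV[R]_d) : dot x (y + z) = dot x y + dot x z.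
Proof. by rewrite dotC dotDl !(dotC x). Qed.

Lemma dotNr d (x z : 'rV[R]_d) : dot x (- z) = - dot x z.
Proof. by rewrite dotC dotNl (dotC x). Qed.

Lemma dotZr d a (x z : 'rV[R]_d) : dot x (a *: z) = a * dot x z.
Proof. by rewrite dotC dotZl (dotC x). Qed.

Definition dotE' := (dotDl, dotDr, dotNl, dotNr, dotZl, dotZr).

Lemma dot_ge0 d (x : 'rV[R]_d) : 0 <= dot x x.
Proof. by rewrite dotE sumr_ge0 // => i _; rewrite -expr2 sqr_ge0. Qed.

Lemma dot_mul m n d (x : 'rV[R]_m) (y : 'rV[R]_n) (A : 'M[R]_(m, d)) (B : 'M[R]_(n, d)) :
  dot (x *m A) (y *m B) = (x *m (A *m B^T) *m y^T) 0 0.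
Proof. by rewrite /dot trmx_mul !mulmxA. Qed.

Lemma dot_row m n d (A : 'M[R]_(m, d)) (B : 'M[R]_(n, d)) i j :
  dot (row i A) (row j B) = (A *m B^T) i j.
Proof. by rewrite dotE mxE; apply: eq_bigr => k _; rewrite !mxE. Qed.

Lemma gram_eq0 m d (X : 'M[R]_(m, d)) : X *m X^T = 0 -> X = 0.
Proof.
move=> X0; apply/row_matrixP => i; rewrite row0; apply: dot_eq0.
by rewrite dot_row X0 mxE.
Qed.

(** The Gram matrix of C A is C (A A^T) C^T. Relations between rows of A can thus be verified on the
    Gram matrix, whether or not the rows are independent. *)
Lemma gram_ker m n d (A : 'M[R]_(m, d)) (C : 'M[R]_(n, m)) :
  C *m (A *m A^T) = 0 -> C *m A = 0.
Proof.
move=> CA; apply: gram_eq0; rewrite trmx_mul mulmxA -(mulmxA C).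
by rewrite CA mul0mx.
Qed.

(** Equal Gram matrices force equal linear relations between rows, so sending the rows of A to those
    of B extends linearly. With a pseudo-inverse P of A, the matrix 1 - A P kills A, hence the Gram
    matrix, hence B. *)
Lemma gram_factor m d e (A : 'M[R]_(m, d)) (B : 'M[R]_(m, e)) :
  A *m A^T = B *m B^T -> exists T, A *m T = B.
Proof.
move=> AB; have AP := mulmxKpV (submx_refl A).
move: (pinvmx A) AP => P AP; exists (P *m B).
have /gram_ker : (1%:M - A *m P) *m (B *m B^T) = 0.
  by rewrite -AB mulmxA mulmxBl mul1mx AP subrr mul0mx.
by rewrite mulmxBl mul1mx mulmxA => /eqP; rewrite subr_eq0 => /eqP <-.
Qed.

Lemma gram_map m d e (A : 'M[R]_(m, d)) (B : 'M[R]_(m, e)) (T : 'M[R]_(d, e)) :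
  A *m A^T = B *m B^T -> A *m T = B ->
  isometry (fun x : 'rV_d => x *m T) (zspan A) (zspan B).
Proof.
move=> AB AT.
have dE x y : zspan A x -> zspan A y -> dot (x *m T) (y *m T) = dot x y.
  by move=> [a _ <-] [b _ <-]; rewrite -!mulmxA AT !dot_mul AB.
split=> //; last by move=> x y _ _; rewrite mulmxDl.
split.
- by move=> x [a _ <-]; exists a => //; rewrite -mulmxA AT.
- move=> x y /set_mem Ax /set_mem Ay xy; apply/subr0_eq/dot_eq0.
  have Axy : zspan A (x - y) by apply: zspanD Ax (zspanN Ay).
  by rewrite -dE // mulmxBl xy subrr /dot mul0mx mxE.
- by move=> y [a _ <-]; exists (rz a *m A); [exact: zspan_mul|rewrite -mulmxA AT].
Qed.

Lemma isometric_gram m d e (A : 'M[R]_(m, d)) (B : 'M[R]_(m, e)) :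
  A *m A^T = B *m B^T -> isometric (zspan A) (zspan B).
Proof.
by move=> AB; have [T AT] := gram_factor AB; exists (fun x => x *m T); exact: gram_map.
Qed.

Lemma contains_gram m d e (L : set 'rV[R]_d) (K : set 'rV[R]_e)
    (A : 'M[R]_(m, e)) (B : 'M[R]_(m, d)) :
  K `<=` zspan A -> zspan B `<=` L -> A *m A^T = B *m B^T -> contains L K.
Proof.
move=> KA BL AB; have [T AT] := gram_factor AB.
have [[f1 f2 _] f4 f5] := gram_map AB AT.
exists [set x *m T | x in K]; split.
  by move=> _ [x Kx <-]; apply/BL/f1/KA.
exists (fun x => x *m T); split.
- split=> [x Kx|x y /set_mem Kx /set_mem Ky|y [x Kx <-]]; [by exists x| |by exists x].
  by apply: f2; apply/mem_set/KA.
- by move=> x y Kx Ky; apply: f4; exact: KA.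
- by move=> x y Kx Ky; apply: f5; exact: KA.
Qed.

(* Preservation of the form makes the inverse of an isometry additive, even   *)
(* though [M] is not assumed to be a subgroup.                                *)
Lemma isometric_frame m d e (M : set 'rV[R]_d) (B : 'M[R]_(m, e)) :
  isometric M (zspan B) -> exists A : 'M[R]_(m, d), M = zspan A /\ A *m A^T = B *m B^T.
Proof.
move=> [f [[f1 f2 f3] _ fd]].
have /choice[g gP] : forall i, exists x, M x /\ f x = row i B.
  by move=> i; have [x Mx fx] := f3 _ (zspan_row B i); exists x.
pose A := \matrix_i g i.
have AB : A *m A^T = B *m B^T.
  apply/matrixP => i j; rewrite -!dot_row !rowK.
  by have [? <-] := gP i; have [? <-] := gP j; rewrite fd.
(* The two sides have the same norm, which is also their pairing with each other; their difference
   has norm 0. *)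
have key x c : M x -> f x = rz c *m B -> x = rz c *m A.
  move=> Mx fx.
  have xA : x *m A^T = rz c *m (A *m A^T).
    apply/rowP => i; rewrite AB mulmxA -fx.
    have -> : (x *m A^T) 0 i = dot x (g i).
      by rewrite /dot !mxE; apply: eq_bigr => k _; rewrite !mxE.
    have [Mg fg] := gP i; rewrite -fd // fg.
    by rewrite /dot !mxE; apply: eq_bigr => k _; rewrite !mxE.
  apply/subr0_eq/dot_eq0.
  rewrite !dotE' dot_mul opprK [dot (rz c *m A) x]dotC.
  have -> : dot x (rz c *m A) = (x *m A^T *m (rz c)^T) 0 0.
    by rewrite /dot trmx_mul mulmxA.
  by rewrite xA -fd // fx dot_mul -AB; ring.
exists A; split=> //; rewrite eqEsubset; split=> x.
  by move=> Mx; have [c _ fx] := f1 _ Mx; rewrite (key x c) //; exact: zspan_mul.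
move=> [c _ <-]; have [y My fy] := f3 _ (zspan_mul B c).
by rewrite -(key y c).
Qed.

End Spans.

(** * The lattices E_8 and EE_8 *)

Definition ec : 'M[int]_8 := mxZ 8 8 cartan.
Definition eic : 'M[int]_8 := mxZ 8 8 icartan.

Definition simple2 : seq (seq Z) := (
  [:: [:: 1;-1;-1;-1;-1;-1;-1;1]; [:: -2;2;0;0;0;0;0;0];
      [:: 0;-2;2;0;0;0;0;0]; [:: 2;2;0;0;0;0;0;0];
      [:: 0;0;-2;2;0;0;0;0]; [:: 0;0;0;-2;2;0;0;0];
      [:: 0;0;0;0;-2;2;0;0]; [:: 0;0;0;0;0;-2;2;0]])%BZ.

Definition simple_int : seq (seq Z) := (
  [:: [:: 0;-1;-1;-1;-1;-1;-1;0]; [:: -1;1;0;0;0;0;0;0];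
      [:: 0;-1;1;0;0;0;0;0]; [:: 1;1;0;0;0;0;0;0];
      [:: 0;0;-1;1;0;0;0;0]; [:: 0;0;0;-1;1;0;0;0];
      [:: 0;0;0;0;-1;1;0;0]; [:: 0;0;0;0;0;-1;1;0]])%BZ.

Lemma ecK : ec *m eic = 1%:M.
Proof.
rewrite -mxZ_mul // (_ : mulZ 8 cartan icartan = scalZ 8 1) ?mxZ_scal //.
Qed.

Lemma eicK : eic *m ec = 1%:M.
Proof. by apply: mulmx1C; exact: ecK. Qed.

Lemma ecT : ec^T = ec.
Proof. by rewrite -mxZ_tr; congr mxZ; vm_compute. Qed.

Lemma eicT : eic^T = eic.
Proof. by rewrite -mxZ_tr; congr mxZ; vm_compute. Qed.

Section E8Lattice.
Context {R : realType}.
Local Notation rz := (@rz R _ _).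

Definition one8 : 'rV[R]_8 := const_mx 1.

Lemma dot_rz n (x y : 'rV[int]_n) : dot (rz x) (rz y) = (\sum_i x 0 i * y 0 i)%:~R.
Proof.
by rewrite dotE rmorph_sum; apply: eq_bigr => i _; rewrite !mxE rmorphM.
Qed.

Lemma dot_rz_one (x : 'rV[int]_8) : dot (rz x) one8 = (\sum_i x 0 i)%:~R.
Proof. by rewrite dotE rmorph_sum; apply: eq_bigr => i _; rewrite !mxE mulr1. Qed.

Lemma dot_one_one : dot one8 one8 = 8.
Proof. by rewrite dotE; under eq_bigr do rewrite !mxE mulr1; rewrite sumr_const card_ord. Qed.

Lemma rootDE n (x : 'rV[R]_n) :
  rootD n x <-> exists2 z : 'rV[int]_n, (2 %| \sum_i z 0 i)%Z & x = rz z.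
Proof. by split=> [[z hz <-]|[z hz ->]]; exists z. Qed.

Lemma rootD_submod n : int_submod (rootD n : set 'rV[R]_n).
Proof.
split; first by apply/rootDE; exists 0; rewrite ?rz0 // big1 // => i _; rewrite mxE.
move=> x y /rootDE[z hz ->] /rootDE[w hw ->]; apply/rootDE.
exists (z - w); last by rewrite rzD rzN.
under eq_bigr do rewrite !mxE.
by rewrite big_split /= sumrN rpredB.
Qed.

Lemma rootE8E (x : 'rV[R]_8) : rootE8 x <->
  exists z : 'rV[int]_8, exists k : int,
    (2 %| \sum_i z 0 i)%Z /\ x = rz z + (k%:~R / 2) *: one8.
Proof.
split.
  case=> [/rootDE[z hz ->]|[_ /rootDE[z hz ->] <-]].
    by exists z, 0; split=> //; rewrite mul0r scale0r addr0.
  exists z, 1; split=> //; congr (_ + _); apply/rowP => i.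
  by rewrite !mxE mulr1 mul1r.
move=> [z [k [hz ->]]].
have hk := divz_eq k 2.
have sm q : (2 %| \sum_i (z + const_mx q : 'rV[int]_8) 0 i)%Z.
  under eq_bigr do rewrite !mxE.
  rewrite big_split /= rpredD // sumr_const card_ord.
  by rewrite -[_ *+ 8]mulr_natr; apply: dvdz_mull.
have r01 : (k %% 2)%Z = 0 \/ (k %% 2)%Z = 1.
  by have := modz_ge0 k (isT : 2 != 0 :> int); have := ltz_mod k (isT : 2 != 0 :> int); lia.
case: r01 => r; rewrite r in hk; [left|right; exists (rz (z + const_mx (k %/ 2)%Z))].
- apply/rootDE; exists (z + const_mx (k %/ 2)%Z) => //.
  rewrite rzD; congr (_ + _); apply/rowP => i; rewrite !mxE {1}hk addr0 rmorphM /=.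
  by rewrite mulr1 mulfK // pnatr_eq0.
- by apply/rootDE; exists (z + const_mx (k %/ 2)%Z).
- rewrite rzD -addrA; congr (_ + _); apply/rowP => i; rewrite !mxE {2}hk rmorphD rmorphM /=.
  by rewrite mulr1 mulrDl mulfK ?pnatr_eq0 // mul1r.
Qed.

Lemma rootE8_submod : int_submod (rootE8 : set 'rV[R]_8).
Proof.
split; first by left; case: (rootD_submod 8).
move=> x y /rootE8E[z [k [hz ->]]] /rootE8E[w [l [hw ->]]]; apply/rootE8E.
exists (z - w), (k - l); split.
  by under eq_bigr do rewrite !mxE; rewrite big_split /= sumrN rpredB.
rewrite rzD rzN rmorphB /= mulrBl scalerBl.
by rewrite opprD addrACA.
Qed.

Lemma rootE8_int (x y : 'rV[R]_8) : rootE8 x -> rootE8 y -> dot x y \is a Num.int.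
Proof.
move=> /rootE8E[z [k [/dvdzP[a ha] ->]]] /rootE8E[w [l [/dvdzP[b hb] ->]]].
rewrite !dotE' (dotC one8) !dot_rz_one dot_rz dot_one_one ha hb.
move: (\sum_i _) => s.
rewrite [X in X \is a _](_ : _ = (s + k * b + l * a + l * k * 2)%:~R) ?intr_int //.
by rewrite !rmorphD !rmorphM /=; field.
Qed.

(** The rows of P are equations satisfied by K and those of W read off coordinates with respect to
    B: on K the identity becomes x = (x W^T) B. *)
Lemma zspan_dual m n d (K : set 'rV[R]_d) (B W : 'M[R]_(m, d)) (P H : 'M[R]_(n, d)) :
  (forall x j, K x -> (x *m W^T) 0 j \is a Num.int) ->
  (forall x, K x -> x *m P^T = 0) -> W^T *m B + P^T *m H = 1%:M -> K `<=` zspan B.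
Proof.
move=> KW KP e x Kx; have [c cE] : exists c, x *m W^T = rz c.
  by apply: rz_int => i j; rewrite (ord1 i); exact: KW.
exists c => //; rewrite -cE -[RHS]mulmx1 -e mulmxDr !mulmxA KP //.
by rewrite mul0mx addr0.
Qed.

Definition basisE8 : 'M[R]_8 := 2^-1 *: rz (mxZ 8 8 simple2).

Lemma basisE8_gram : basisE8 *m basisE8^T = rz ec.
Proof.
rewrite /basisE8 linearZ /= -scalemxAl -scalemxAr scalerA -rz_tr -mxZ_tr -rzM.
rewrite -mxZ_mul // (_ : mulZ _ _ _ = mulZ 8 (scalZ 8 4) cartan); last by vm_compute.
rewrite (@mxZ_mul _ 8) // mxZ_scal mul_scalar_mx rzZ scalerA.
rewrite [X in X *: _](_ : _ = 1) ?scale1r //.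
by rewrite (_ : int_of_Z 4 = 4) //; field.
Qed.

Lemma basisE8_dual : basisE8^T *m rz eic *m basisE8 = 1%:M.
Proof.
have h : basisE8 *m (basisE8^T *m rz eic) = 1%:M.
  by rewrite mulmxA basisE8_gram -rzM ecK rz_scalar.
exact: mulmx1C h.
Qed.

Lemma basisE8_row i : rootE8 (row i basisE8).
Proof.
(* Only the simple root number 0 has half-integral coordinates: k is 1 there and the default 0
   elsewhere. *)
apply/rootE8E; exists (row i (mxZ 8 8 simple_int)), (int_of_Z (nth 0%BZ [:: 1%BZ] i)).
split.
  have := allP (isT : all (fun r => Z.even (dotl (nseq 8 1%BZ) r)) simple_int).
  move=> /(_ (nth [::] simple_int i)); rewrite mem_nth // => /(_ isT).
  move=> /Z.even_spec[q /(congr1 int_of_Z)].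
  rewrite (@dotlE _ _ 8) ?orbT // => e; apply/dvdzP; exists (int_of_Z q).
  rewrite mulrC (_ : 2 = int_of_Z 2) // -intZM -e; apply: eq_bigr => l _.
  by rewrite !mxE nth_nseq ltn_ord mul1r.
have e : mxZ 8 8 simple2 = mxZ 8 8 [:: nseq 8 1%BZ] + 2 *: mxZ 8 8 simple_int.
  by rewrite (_ : 2 = int_of_Z 2) // -mxZ_add; congr mxZ; vm_compute.
rewrite /basisE8 e; apply/rowP => j; rewrite !mxE mulr1.
have -> : nth 0%BZ (nth [::] [:: nseq 8 1%BZ] i) j = nth 0%BZ [:: 1%BZ] i.
  case: i => -[|[|i]] ? /=; rewrite ?nth_nil //.
  by case: j => -[|[|[|[|[|[|[|[|?]]]]]]]] ?.
by rewrite rmorphD rmorphM /=; field.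
Qed.

Lemma rootE8_span : rootE8 = zspan basisE8.
Proof.
rewrite eqEsubset; split; last first.
  by apply: zspan_subset; [exact: rootE8_submod|exact: basisE8_row].
apply: (@zspan_dual _ 0 _ _ _ (rz eic *m basisE8) 0 0).
- move=> x j Ex; rewrite -[_ j](_ : dot x (row j (rz eic *m basisE8)) = _).
    apply: rootE8_int => //.
    rewrite row_mul -rz_row; apply: zspan_subset (zspan_mul _ _).
      exact: rootE8_submod.
    exact: basisE8_row.
  by rewrite -{1}[x](row_id 0) dot_row.
- by move=> x _; rewrite trmx0 mulmx0.
- by rewrite mulmx0 addr0 trmx_mul -rz_tr eicT basisE8_dual.
Qed.

Lemma scaleL_span m d a (B : 'M[R]_(m, d)) : scaleL a (zspan B) = zspan (a *: B).
Proof.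
rewrite eqEsubset; split=> x.
  by move=> [_ [c _ <-] <-]; exists c => //; rewrite scalemxAr.
by move=> [c _ <-]; exists (rz c *m B); [exact: zspan_mul|rewrite scalemxAr].
Qed.

Definition basisEE8 : 'M[R]_8 := Num.sqrt 2 *: basisE8.

Lemma EE8_span : EE8 = zspan basisEE8.
Proof. by rewrite /EE8 rootE8_span scaleL_span. Qed.

Lemma scale_gram m n d a (A : 'M[R]_(m, d)) (B : 'M[R]_(n, d)) :
  (a *: A) *m (a *: B)^T = (a ^+ 2) *: (A *m B^T).
Proof. by rewrite linearZ /= -scalemxAl -scalemxAr scalerA. Qed.

Lemma basisEE8_gram : basisEE8 *m basisEE8^T = 2 *: rz ec.
Proof. by rewrite scale_gram basisE8_gram sqr_sqrtr // ler0n. Qed.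

Definition EE8_frame d (A : 'M[R]_(8, d)) (M : set 'rV[R]_d) : Prop :=
  M = zspan A /\ A *m A^T = 2 *: rz ec.

Lemma EE8_frameP d (M : set 'rV[R]_d) :
  isometric M EE8 <-> exists A, EE8_frame A M.
Proof.
rewrite EE8_span; split.
  move=> /isometric_frame[A [MA AA]]; exists A; split=> //.
  by rewrite AA basisEE8_gram.
by move=> [A [-> AA]]; apply: isometric_gram; rewrite AA basisEE8_gram.
Qed.

End E8Lattice.

(** * Weyl reflections *)

Definition square8 (t : seq (seq Z)) : bool := (size t == 8) && wide 8 t.

(** The Weyl vector, half the sum of the positive roots, in simple-root coordinates. It pairs to 1
    with every simple root, so reflecting at a negative coordinate raises the pairing with it; this
    is the termination measure of all climbs. *)
Definition heights : seq Z := [:: 46; 91; 135; 68; 110; 84; 57; 29]%BZ.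
Definition highest : seq Z := [:: 2; 4; 6; 3; 5; 4; 3; 2]%BZ.

Lemma wide_nth n t i : wide n t -> (i < size t)%N -> size (nth [::] t i) = n.
Proof. by move=> /allP wt lti; apply/eqP/wt/mem_nth. Qed.

Lemma wide_cartan : wide 8 cartan. Proof. by []. Qed.

Lemma size_refl r c : (r < 8)%N -> size c = 8 -> size (refl r c) = 8.
Proof.
move=> ltr sc; rewrite /refl; case: (nth _ c r) => // p;
  by rewrite size_axpy (wide_nth wide_cartan) // sc.
Qed.

Lemma rowZ_refl (r : 'I_8) c : size c = 8 ->
  rowZ 8 (refl r c) = rowZ 8 c - (rowZ 8 c 0 r) *: row r ec.
Proof.
move=> sc; have sr : size (nth [::] cartan r) = 8 by rewrite (wide_nth wide_cartan).
have E : rowZ 8 (axpy (Z.opp (nth 0%BZ c r)) (nth [::] cartan r) c) =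
   rowZ 8 c - (rowZ 8 c 0 r) *: row r ec.
  by rewrite rowZ_axpy // intZN row_mxZ rowZE scaleNr addrC.
move: E; rewrite /refl rowZE; case: (nth 0%BZ c r) => //.
by rewrite scale0r subr0.
Qed.

Lemma ec_diag (r : 'I_8) : ec r r = 2.
Proof. by rewrite mxE; case: r => -[|[|[|[|[|[|[|[|?]]]]]]]] ?. Qed.

Lemma reflK r c : (r < 8)%N -> size c = 8 -> refl r (refl r c) = c.
Proof.
move=> ltr sc; pose s := Ordinal ltr.
apply: (@rowZ_inj 8) => //; first by rewrite !size_refl.
rewrite -[r]/(nat_of_ord s) !rowZ_refl ?size_refl //.
move: (rowZ 8 c) (ec_diag s) => x; move: ec => G d; apply/rowP => j.
by rewrite !mxE d; ring.
Qed.

Lemma size_up c : size c = 8 -> size (up c) = 8.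
Proof. by move=> sc; rewrite /up sc; case: ifP => // ltf; rewrite size_refl. Qed.

Lemma descS f c : desc f.+1 c =
  c :: flatten [seq desc f d | d <- [seq refl r c | r <- iota 0 8]
                             & (d != c) && (up d == c)].
Proof. by []. Qed.

Lemma mem_desc m v c f : size v = 8 -> iter m up v = c -> (m < f)%N -> v \in desc f c.
Proof.
elim: m c f => [|m IH] c [//|f] sv; first by rewrite [iter _ _ _]/= => -> _; rewrite descS mem_head.
rewrite iterS; set d := iter m up v => dc ltm.
have sd : size d = 8 by rewrite /d; elim: {+}m => // k; exact: size_up.
(* If the last [up] step was idle it is dropped; otherwise it is an edge that [desc] retains. *)
have [e|ne] := eqVneq d c; first by apply: (IH c f.+1) => //; exact: ltnW.
rewrite descS inE; apply/orP; right; apply/flattenP; exists (desc f d); last exact: IH.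
apply: map_f; rewrite mem_filter ne dc eqxx; apply/mapP.
move: dc ne; rewrite /up sd; case: ifP => [ltf <- _|_ ->]; last by rewrite eqxx.
by exists (fneg d); rewrite ?mem_iota ?reflK.
Qed.

Fixpoint all_bounded (n b : nat) (P : seq nat -> bool) : bool :=
  if n is n'.+1 then all (fun a => all_bounded n' (b - a) (fun l => P (a :: l))) (iota 0 b.+1)
  else P [::].

Lemma all_boundedP n b P l : all_bounded n b P -> size l = n -> (sumn l <= b)%N -> P l.
Proof.
elim: n b P l => [|n IH] b P [|a l] //.
rewrite -[all_bounded _ _ _]/(all (fun a => all_bounded n (b - a) (fun l => P (a :: l)))
  (iota 0 b.+1)) => /allP H [sl] /= ab.
apply: (IH (b - a)%N (fun l => P (a :: l))) => //; last by lia.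
by apply: H; rewrite mem_iota; lia.
Qed.

Definition dominant_check (c : seq Z) : bool :=
  Z.leb (inorm c) 8 ==> ~~ Z.eqb (dotl highest c) 3 ==> has (fun nc => nc.2 == c) dominants.

Lemma dominants_complete : all_bounded 8 2 (fun l => dominant_check (map Z.of_nat l)).
Proof. by vm_compute. Qed.

Lemma inormE c : size c = 8 -> int_of_Z (inorm c) = (rowZ 8 c *m eic *m (rowZ 8 c)^T) 0 0.
Proof.
move=> sc; rewrite /inorm (@dotlE _ _ 8) ?sc ?orbT // -mulmxA mxE.
apply: eq_bigr => i _; rewrite !mxE; congr (_ * _).
rewrite (nth_map [::]) // (@dotlE _ _ 8) ?sc //.
by apply: eq_bigr => j _; rewrite !mxE.
Qed.

(** All entries of the inverse Cartan matrix are at least 2, so a dominant weight with coordinate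
    sum s has norm at least 2 s^2. *)
Lemma sum_le2 c : size c = 8 -> all (Z.leb 0) c -> Z.leb (inorm c) 8 ->
  (sumn [seq Z.to_nat x | x <- c] <= 2)%N.
Proof.
move=> sc c0; rewrite -intZ_le inormE // => le8.
have c0' (i : 'I_8) : 0 <= rowZ 8 c 0 i.
  rewrite rowZE -[0]/(int_of_Z 0) intZ_le.
  by apply: (allP c0); rewrite mem_nth ?sc.
have e2 i j : 2 <= eic i j.
  rewrite mxE -[2]/(int_of_Z 2) intZ_le.
  by case: i => -[|[|[|[|[|[|[|[|?]]]]]]]] ? //; case: j => -[|[|[|[|[|[|[|[|?]]]]]]]] ?.
have sE : \sum_i rowZ 8 c 0 i = (sumn [seq Z.to_nat x | x <- c])%:Z.
  rewrite sumnE big_map (big_nth 0%BZ) sc big_mkord -natz natr_sum.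
  apply: eq_bigr => i _; have := c0' i; rewrite rowZE natz.
  by case: (nth _ _ _) => //= p _; rewrite pmulrn.
move: le8; rewrite mxE.
have : 2 * (\sum_i rowZ 8 c 0 i) ^+ 2 <=
  \sum_j (rowZ 8 c *m eic) 0 j * (rowZ 8 c)^T j 0.
  rewrite expr2 mulrA big_distrr /=; apply: ler_sum => j _.
  rewrite [(_^T) _ _]mxE; apply: ler_wpM2r => //.
  by rewrite mxE mulr_sumr; apply: ler_sum => i _; rewrite mulrC ler_wpM2l.
rewrite sE => h1 h2.
have : 2 * (sumn [seq Z.to_nat x | x <- c])%:Z ^+ 2 <= 8 := le_trans h1 h2.
by move: (sumn _) => n; rewrite expr2; nia.
Qed.

Lemma fnegP c : (fneg c < size c)%N -> Z.ltb (nth 0%BZ c (fneg c)) 0.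
Proof. by move=> h; apply: (@nth_find _ 0%BZ (fun x => Z.ltb x 0)); rewrite has_find. Qed.

Lemma fnegN c : (size c <= fneg c)%N -> all (Z.leb 0) c.
Proof.
rewrite leqNgt -has_find -all_predC => /allP h; apply/allP => x /h /=.
by rewrite -Z.leb_antisym.
Qed.

(** Besides the weights listed in [dominants], norm at most 8 admits only the fundamental weights
    number 6 and 3, of norms 6 and 8, and both pair to 3 with the highest root. *)
Lemma dominantP c : size c = 8 -> all (Z.leb 0) c -> Z.leb (inorm c) 8 ->
  dotl highest c <> 3%BZ -> exists2 nc, nc \in dominants & nc.2 = c.
Proof.
move=> sc c0 c8 c3.
have cE : [seq Z.of_nat i | i <- [seq Z.to_nat x | x <- c]] = c.
  rewrite -map_comp map_id_in // => x /(allP c0) /Z.leb_le x0.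
  exact: Z2Nat.id.
have := all_boundedP dominants_complete (_ : size [seq Z.to_nat x | x <- c] = 8) (sum_le2 sc c0 c8).
rewrite size_map cE => /(_ sc).
rewrite /dominant_check c8 implyTb; case: Z.eqb_spec => // _.
by rewrite implyTb => /hasP[nc nd /eqP nE]; exists nc.
Qed.

Lemma heights_cartan : all (fun r => Z.eqb (dotl heights r) 1) cartan.
Proof. by []. Qed.

Lemma dotl_refl x r c : (r < 8)%N -> size c = 8 -> size x = 8 ->
  int_of_Z (dotl x (refl r c)) = int_of_Z (dotl x c)
    - int_of_Z (nth 0%BZ c r) * int_of_Z (dotl x (nth [::] cartan r)).
Proof.
move=> ltr sc sx; pose s := Ordinal ltr.
have dE (y : seq Z) : int_of_Z (dotl x y) = (rowZ 8 x *m (rowZ 8 y)^T) 0 0.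
  by rewrite (@dotlE _ _ 8) ?sx ?orbT // mxE; apply: eq_bigr => i _; rewrite !mxE.
rewrite !dE (rowZ_refl s) // linearB linearZ /= mulmxBr -scalemxAr !mxE row_mxZ.
by congr (_ - _ * _); apply: eq_bigr => i _; rewrite !mxE.
Qed.

Section Presentations.
Context {R : realType} (d : nat) (M N : set 'rV[R]_d).
Local Notation rz := (@rz R _ _).

Definition framed (A B : 'M[R]_(8, d)) : Prop := EE8_frame A M /\ EE8_frame B N.

(** The bases are quantified existentially so that they may be replaced by reflected ones while t
    changes. *)
Definition presents (t : seq (seq Z)) : Prop :=
  square8 t /\ exists A B, framed A B /\ B *m A^T = rz (mxZ 8 8 t).

Definition root_row (p : 'rV[int]_8) : Prop := p *m ec *m p^T = 2%:M.

(** Row i is the image of the i-th simple root under the reflection in p, in simple-root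
    coordinates; multiplying a basis by it from the left reflects the basis. *)
Definition reflect_mx (p : 'rV[int]_8) : 'M[int]_8 := 1%:M - ec *m p^T *m p.

Lemma reflect_mxK p : root_row p -> reflect_mx p *m reflect_mx p = 1%:M.
Proof.
rewrite /root_row => pp.
have e : ec *m p^T *m p *m (ec *m p^T *m p) = 2 *: (ec *m p^T *m p).
  have -> : ec *m p^T *m p *m (ec *m p^T *m p) = ec *m p^T *m (p *m ec *m p^T) *m p.
    by rewrite !mulmxA.
  by rewrite pp mul_mx_scalar -scalemxAl.
rewrite /reflect_mx; move: (ec *m p^T *m p) e => X e.
rewrite mulmxBl mul1mx mulmxBr mulmx1 e scaler_nat mulr2n.
by rewrite [- (X + X)]opprD addrA subrr add0r opprK subrK.
Qed.

Lemma reflect_mx_gram p : root_row p -> reflect_mx p *m ec *m (reflect_mx p)^T = ec.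
Proof.
move=> pp; have -> : reflect_mx p *m ec = ec *m (reflect_mx p)^T.
  by rewrite /reflect_mx [(_ - _)^T]linearB /= trmx1 !trmx_mul trmxK ecT mulmxBl mulmxBr mul1mx mulmx1 !mulmxA.
by rewrite -mulmxA -trmx_mul reflect_mxK // trmx1 mulmx1.
Qed.

Lemma reflect_frame p (A : 'M[R]_(8, d)) K :
  root_row p -> EE8_frame A K -> EE8_frame (rz (reflect_mx p) *m A) K.
Proof.
move=> pp [-> AA]; split.
  apply/esym/(@zspan_eq _ _ _ _ _ _ (reflect_mx p) (reflect_mx p)) => //.
  by rewrite mulmxA -rzM reflect_mxK // rz_scalar mul1mx.
rewrite trmx_mul mulmxA -(mulmxA _ A) AA -scalemxAr -scalemxAl.
by rewrite -rz_tr -!rzM reflect_mx_gram.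
Qed.

End Presentations.

Section Soundness.
Context {R : realType} (d : nat) (M N : set 'rV[R]_d).
Local Notation rz := (@rz R _ _).
Local Notation presents := (presents M N).

Lemma square8_nth t i : square8 t -> (i < 8)%N -> size (nth [::] t i) = 8.
Proof. by move=> /andP[/eqP st wt] lti; apply: wide_nth wt _; rewrite st. Qed.

Lemma mul_delta_tr n (x : 'rV[int]_n) s : x *m (delta_mx 0 s)^T = (x 0 s)%:M.
Proof. by rewrite trmx_delta -colE; apply/matrixP => i j; rewrite !ord1 !mxE mulr1n. Qed.

Lemma mxZ_refl t (r : 'I_8) : square8 t ->
  mxZ 8 8 [seq refl r c | c <- t] = mxZ 8 8 t *m (reflect_mx (delta_mx 0 r))^T.
Proof.
move=> sq; apply/row_matrixP => i; have /andP[/eqP st _] := sq.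
rewrite row_mul !row_mxZ (nth_map [::]) ?st //.
rewrite rowZ_refl ?square8_nth // /reflect_mx linearB /= trmx1 !trmx_mul trmxK ecT.
by rewrite mulmxBr mulmx1 !mulmxA mul_delta_tr mul_scalar_mx -scalemxAl -rowE.
Qed.

Lemma root_delta s : root_row (delta_mx 0 s).
Proof. by rewrite /root_row -rowE mul_delta_tr mxE ec_diag. Qed.

Lemma square8_refl t r : (r < 8)%N -> square8 t -> square8 [seq refl r c | c <- t].
Proof.
move=> ltr /andP[st wt]; rewrite /square8 size_map st; apply/allP => _ /mapP[c ct ->].
by rewrite size_refl //; apply/eqP/(allP wt).
Qed.

Lemma presents_refl t r : (r < 8)%N -> presents t -> presents [seq refl r c | c <- t].
Proof.
move=> ltr [sq [A [B [[fA fB] BA]]]]; split; first exact: square8_refl.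
exists (rz (reflect_mx (delta_mx 0 (Ordinal ltr))) *m A), B; split.
  by split=> //; apply: reflect_frame => //; exact: root_delta.
by rewrite trmx_mul mulmxA BA -rz_tr -rzM -mxZ_refl.
Qed.

Lemma presents_rrefl t p : size p = 8 -> root_row (rowZ 8 p) -> presents t ->
  presents (rrefl p t).
Proof.
move=> sp pp [sq [A [B [[fA fB] BA]]]].
have /andP[/eqP st wt] := sq.
have sl : size (lcomb 8 p t) = 8 by rewrite size_lcomb.
have nthE i : (i < 8)%N -> let a := dotl (nth [::] cartan i) p in
    nth [::] (rrefl p t) i =
    if a is Z0 then nth [::] t i else axpy (Z.opp a) (lcomb 8 p t) (nth [::] t i).
  move=> lti a; rewrite /rrefl (nth_map (0%BZ, [::])) ?size_zip ?size_map ?st //.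
  by rewrite nth_zip ?size_map ?st // (nth_map [::]).
have sr : size (rrefl p t) = 8 by rewrite size_map size_zip size_map st.
split.
  rewrite /square8 sr eqxx; apply/(all_nthP [::]) => i; rewrite sr => lti.
  rewrite nthE //; case: (dotl _ _) => [|a|a]; rewrite ?size_axpy ?sl ?square8_nth //.
exists A, (rz (reflect_mx (rowZ 8 p)) *m B); split.
  by split=> //; exact: reflect_frame.
rewrite -mulmxA BA -rzM; congr rz; apply/row_matrixP => i.
rewrite row_mul !row_mxZ nthE //.
have -> : rowZ 8 (if dotl (nth [::] cartan i) p is Z0 then nth [::] t i
    else axpy (Z.opp (dotl (nth [::] cartan i) p)) (lcomb 8 p t) (nth [::] t i))
  = rowZ 8 (axpy (Z.opp (dotl (nth [::] cartan i) p)) (lcomb 8 p t) (nth [::] t i)).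
  have := @rowZ_axpy 8 (Z.opp (dotl (nth [::] cartan i) p)) _ _ sl (square8_nth sq (ltn_ord i)).
  by case: (dotl _ _) => // ->; rewrite scale0r add0r.
rewrite rowZ_axpy ?square8_nth // (@rowZ_lcomb 8) ?st //.
rewrite /reflect_mx linearB /= mulmxBl row1 -rowE row_mxZ addrC intZN scaleNr.
congr (- _ + _); rewrite !row_mul.
have -> : row i ec *m (rowZ 8 p)^T = (int_of_Z (dotl (nth [::] cartan i) p))%:M.
  rewrite (@dotlE _ _ 8) ?sp ?orbT // [LHS]mx11_scalar mxE; congr (_%:M).
  by apply: eq_bigr => l _; rewrite !mxE.
by rewrite mul_scalar_mx scalemxAl.
Qed.

Hypothesis integralL : integral (sumL M N).
Hypothesis rootlessL : rootless (sumL M N).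

Lemma sumL_int x y : M x -> N y -> M 0 -> N 0 -> dot x y \is a Num.int.
Proof.
move=> Mx Ny M0 N0; apply: integralL; first by exists x => //; exists 0; rewrite ?addr0.
by exists 0 => //; exists y; rewrite ?add0r.
Qed.

Lemma presents_ex : isometric M EE8 -> isometric N EE8 -> exists t, presents t.
Proof.
move=> /EE8_frameP[A [MA AA]] /EE8_frameP[B [NB BB]].
have [C CE] : exists C, B *m A^T = rz C.
  apply: rz_int => i j; rewrite -dot_row dotC; apply: sumL_int.
  - by rewrite MA; exact: zspan_row.
  - by rewrite NB; exact: zspan_row.
  - by rewrite MA; exact: zspan0.
  - by rewrite NB; exact: zspan0.
exists (mkseq (fun i => mkseq (fun j => Z_of_int (C (inord i) (inord j))) 8) 8).
split.
  by rewrite /square8 size_mkseq eqxx; apply/allP => _ /mapP[i _ ->]; rewrite size_mkseq.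
exists A, B; split=> //; rewrite CE; congr rz; apply/matrixP => i j.
by rewrite mxE !nth_mkseq // Z_of_intK !inord_val.
Qed.

Section Constraints.
Variables (t : seq (seq Z)) (p : 'rV[int]_8).
Hypotheses (pt : presents t) (pp : root_row p).

(** The vectors y + x and y - x of L have norms 8 + 2a and 8 - 2a, which are nonnegative and
    different from 2. *)
Lemma root_pairing (q : 'rV[int]_8) : root_row q ->
  let a := (p *m mxZ 8 8 t *m q^T) 0 0 in [/\ -4 <= a, a <= 4, a != 3 & a != -3].
Proof.
move=> qq; set a := (_ *m _) 0 0.
have [_ [A [B [[[MA AA] [NB BB]] BA]]]] := pt.
pose x := rz q *m A; pose y := rz p *m B.
have xx : dot x x = 4.
  rewrite dot_mul AA -scalemxAr -scalemxAl mxE -rz_tr -!rzM qq.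
  by rewrite rz_scalar mxE eqxx mulr1n; ring.
have yy : dot y y = 4.
  rewrite dot_mul BB -scalemxAr -scalemxAl mxE -rz_tr -!rzM pp.
  by rewrite rz_scalar mxE eqxx mulr1n; ring.
have yx : dot y x = a%:~R by rewrite dot_mul BA -rz_tr -!rzM mxE.
have pos e : 0 <= dot (e *: x + y) (e *: x + y) by exact: dot_ge0.
have nt e : e = 1 \/ e = -1 -> dot (e *: x + y) (e *: x + y) != 2.
  move=> ee; apply: rootlessL; exists (e *: x); last by exists y => //; rewrite NB; exact: zspan_mul.
  rewrite MA; case: ee => ->; rewrite ?scale1r ?scaleN1r; first exact: zspan_mul.
  exact/zspanN/zspan_mul.
have E e : dot (e *: x + y) (e *: x + y) = e ^+ 2 * 4 + 2 * e * a%:~R + 4.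
  by rewrite !dotE' xx yy (dotC x) yx; ring.
move: (pos 1) (pos (-1)) (nt 1 (or_introl erefl)) (nt (-1) (or_intror erefl)).
rewrite !E => p1 p2 n1 n2; split.
- by rewrite -(ler_int R); lra.
- by rewrite -(ler_int R); lra.
- by apply: contra n2 => /eqP ->; apply/eqP; ring.
- by apply: contra n1 => /eqP ->; apply/eqP; ring.
Qed.

(** The vector x is twice the projection of y to the span of M, whose Gram matrix is 2 [ec]. If n is
    the norm in question, the projection has norm n / 2, at most the norm 4 of y. *)
Lemma root_norm :
  (p *m mxZ 8 8 t *m eic *m (p *m mxZ 8 8 t)^T) 0 0 <= 8.
Proof.
have [_ [A [B [[[MA AA] [NB BB]] BA]]]] := pt.
set v := p *m mxZ 8 8 t; pose y := rz p *m B; pose x := rz (v *m eic) *m A.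
have yy : dot y y = 4.
  rewrite dot_mul BB -scalemxAr -scalemxAl mxE -rz_tr -!rzM pp.
  by rewrite rz_scalar mxE eqxx mulr1n; ring.
have yx : dot y x = ((v *m eic *m v^T) 0 0)%:~R.
  by rewrite dot_mul BA -rz_tr -!rzM mxE trmx_mul eicT mulmxA.
have xx : dot x x = 2 * ((v *m eic *m v^T) 0 0)%:~R.
  rewrite dot_mul AA -scalemxAr -scalemxAl mxE -rz_tr -!rzM trmx_mul eicT.
  by rewrite -(mulmxA v eic ec) eicK mulmx1 mulmxA [X in _ * X]mxE.
have := dot_ge0 (2 *: y - x); rewrite !dotE' (dotC x) xx yy yx => h.
by rewrite -(ler_int R); lra.
Qed.

End Constraints.
End Soundness.

(** * Soundness of the search *)

Lemma allbE (T : Type) (a : T -> bool) s : allb a s = all a s.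
Proof. by elim: s => //= x s ->; case: (a x). Qed.

Lemma zip_takeS (S T : Type) (s : seq S) (t : seq T) j : zip s (take j t) = take j (zip s t).
Proof. by elim: s t j => [|x s IH] [|y t] [|j] //=; rewrite IH. Qed.

Lemma lcomb_take n j p t : supported j p -> lcomb n p (take j t) = lcomb n p t.
Proof.
rewrite /supported /lcomb; elim: p t j => [|a p IH] [|c t] [|j] //=.
  case: a => //= pj; rewrite -(IH t 0%N) ?drop0 // take0.
  by case: (p).
by move=> h; rewrite IH.
Qed.

(** A root supported on the first j coordinates combines only the first j rows, so its reflection
    acts on prefixes. *)
Lemma rrefl_take j p t : supported j p -> rrefl p (take j t) = take j (rrefl p t).
Proof. by move=> pj; rewrite /rrefl lcomb_take // zip_takeS map_take. Qed.

Lemma posrootsP p : p \in posroots -> size p = 8 /\ root_row (rowZ 8 p).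
Proof.
move=> /(allP posroots_norm) /andP[/eqP sp /Z.eqb_eq pp]; split=> //.
rewrite /root_row [LHS]mx11_scalar -mulmxA mxE; congr (_%:M).
transitivity (int_of_Z 2); last by [].
rewrite -pp (@dotlE _ _ 8) ?sp ?orbT //; apply: eq_bigr => i _.
rewrite !mxE (nth_map [::]) // (@dotlE _ _ 8) ?sp //; congr (_ * _).
by apply: eq_bigr => j _; rewrite !mxE.
Qed.

Lemma highest_root : root_row (rowZ 8 highest).
Proof.
rewrite /root_row [LHS]mx11_scalar -mulmxA mxE; congr (_%:M).
transitivity (int_of_Z (dotl highest [seq dotl r highest | r <- cartan])); last by [].
rewrite (@dotlE _ _ 8) //; apply: eq_bigr => i _.
rewrite !mxE (nth_map [::]) // (@dotlE _ _ 8) //; congr (_ * _).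
by apply: eq_bigr => j _; rewrite !mxE.
Qed.

Lemma imagesP n v : (n, v) \in images -> inorm v = n /\ image_norm n v.
Proof. by move=> /(allP images_norm) /andP[/Z.eqb_eq]. Qed.

Definition unit_list (j : nat) : seq Z := mkseq (fun k => if k == j then 1%BZ else 0%BZ) 8.

Lemma rowZ_unit (j : 'I_8) : rowZ 8 (unit_list j) = delta_mx 0 j.
Proof. by apply/rowP => k; rewrite !mxE nth_mkseq //= -val_eqE /=; case: (_ == _). Qed.

Lemma root_unit (j : 'I_8) : root_row (rowZ 8 (unit_list j)).
Proof. by rewrite rowZ_unit; exact: root_delta. Qed.

Lemma lcomb_unit (j : 'I_8) t : square8 t -> lcomb 8 (unit_list j) t = nth [::] t j.
Proof.
move=> sq; have /andP[/eqP st wt] := sq.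
apply: (@rowZ_inj 8); rewrite ?size_lcomb ?square8_nth //.
by rewrite (@rowZ_lcomb 8) ?st // rowZ_unit -rowE row_mxZ.
Qed.

Lemma lcomb_refl (r : 'I_8) p t : square8 t ->
  lcomb 8 p [seq refl r c | c <- t] = refl r (lcomb 8 p t).
Proof.
move=> sq; have /andP[/eqP st wt] := sq; have /andP[/eqP st' wt'] := square8_refl (ltn_ord r) sq.
have sl : size (lcomb 8 p t) = 8 by rewrite size_lcomb.
apply: (@rowZ_inj 8); rewrite ?size_lcomb ?size_refl ?size_lcomb //.
rewrite rowZ_refl // !(@rowZ_lcomb 8) ?st ?st' // mxZ_refl // mulmxA.
rewrite /reflect_mx linearB /= trmx1 !trmx_mul trmxK ecT.
by rewrite mulmxBr mulmx1 !mulmxA mul_delta_tr mul_scalar_mx -scalemxAl -rowE.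
Qed.

Section Search.
Context {R : realType} (d : nat) (M N : set 'rV[R]_d).
Local Notation rz := (@rz R _ _).
Local Notation presents := (presents M N).
Hypothesis rootlessL : rootless (sumL M N).

(** The coordinates of p t lie between -4 and 4, and the coefficients of [heights] add up to 620. *)
Lemma height_bound t p : presents t -> root_row (rowZ 8 p) ->
  -2480 <= int_of_Z (dotl heights (lcomb 8 p t)) <= 2480.
Proof.
move=> pt pp; have [sq _] := pt; have /andP[/eqP st wt] := sq.
have b (l : 'I_8) : -4 <= int_of_Z (nth 0%BZ (lcomb 8 p t) l) <= 4.
  have [] := root_pairing rootlessL pt pp (root_delta l).
  rewrite mul_delta_tr -(@rowZ_lcomb 8) ?st // !mxE eqxx mulr1n => h1 h2 _ _.
  by rewrite h1 h2.
rewrite (@dotlE _ _ 8) ?size_lcomb //.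
apply/andP; split.
  apply: (@le_trans _ _ (\sum_(l < 8) int_of_Z (nth 0%BZ heights l) * -4)).
    by rewrite -mulr_suml !big_ord_recl big_ord0.
  apply: ler_sum => l _; apply: ler_wpM2l; last by case/andP: (b l).
  by case: l => -[|[|[|[|[|[|[|[|?]]]]]]]] ?.
apply: (@le_trans _ _ (\sum_(l < 8) int_of_Z (nth 0%BZ heights l) * 4)).
  apply: ler_sum => l _; apply: ler_wpM2l; last by case/andP: (b l).
  by case: l => -[|[|[|[|[|[|[|[|?]]]]]]]] ?.
by rewrite -mulr_suml !big_ord_recl big_ord0.
Qed.

Lemma height_refl (r : 'I_8) c : size c = 8 -> Z.ltb (nth 0%BZ c r) 0 ->
  int_of_Z (dotl heights c) + 1 <= int_of_Z (dotl heights (refl r c)).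
Proof.
move=> sc neg; rewrite dotl_refl //.
have -> : dotl heights (nth [::] cartan r) = 1%BZ.
  by apply/Z.eqb_eq/(allP heights_cartan)/mem_nth.
by rewrite (_ : int_of_Z 1 = 1) // mulr1; lia.
Qed.

(** The reflections act on all of t and not only on the vector p t. Each step thus yields a
    presented matrix, to which [height_bound] applies again, while the height grows by at least
    1. *)
Lemma climb k p t : presents t -> size p = 8 -> root_row (rowZ 8 p) ->
  2480 - int_of_Z (dotl heights (lcomb 8 p t)) <= k%:Z ->
  exists m t', [/\ (m <= k)%N, presents t', iter m up (lcomb 8 p t) = lcomb 8 p t' &
                   (8 <= fneg (lcomb 8 p t'))%N].
Proof.
move=> pt sp pp; elim: k t pt => [|k IH] t pt hk.
all: have [sq _] := pt; have /andP[/eqP st wt] := sq.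
all: have sl : size (lcomb 8 p t) = 8 by rewrite size_lcomb.
all: case: (ltnP (fneg (lcomb 8 p t)) 8) => [ltf|gef]; last by exists 0%N, t; split.
all: have neg : Z.ltb (nth 0%BZ (lcomb 8 p t) (Ordinal ltf)) 0 by apply: fnegP; rewrite sl.
all: have := height_refl sl neg; rewrite -lcomb_refl // => h.
all: have pt' := presents_refl (ltn_ord (Ordinal ltf)) pt.
all: have /andP[h1 h2] := height_bound pt' pp.
  by exfalso; lia.
have [|m [t' [lem p' it f']]] := IH _ pt'; first by lia.
exists m.+1, t'; split=> //.
by rewrite iterSr /up sl ltf -it lcomb_refl.
Qed.

Lemma image_mem t p : presents t -> size p = 8 -> root_row (rowZ 8 p) ->
  exists n, (n, lcomb 8 p t) \in images.
Proof.
move=> pt sp pp.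
have /andP[h1 h2] := height_bound pt pp.
(* The height ranges over an interval of length 4960; the fuel 5000 given to [desc] exceeds it. *)
have [|m [t' [lem pt' it f']]] := @climb 4960 p t pt sp pp; first by lia.
have [/andP[/eqP st wt] _] := pt; have [/andP[/eqP st' wt'] _] := pt'.
have sl : size (lcomb 8 p t) = 8 by rewrite size_lcomb.
have sl' : size (lcomb 8 p t') = 8 by rewrite size_lcomb.
have [|||nc ncd ncE] := dominantP sl' (fnegN _).
- by rewrite sl'.
- rewrite -intZ_le inormE // (@rowZ_lcomb 8) ?st' //.
  exact: (root_norm pt' pp).
- move=> h3; have [_ _ + _] := root_pairing rootlessL pt' pp highest_root.
  rewrite -(@rowZ_lcomb 8) ?st' // -[3]/(int_of_Z 3) -h3 (@dotlE _ _ 8) ?sl' //.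
  by rewrite mxE; under eq_bigr do rewrite !mxE mulrC; rewrite eqxx.
exists nc.1; apply/flattenP; exists [seq (nc.1, c) | c <- desc 5000 nc.2].
  by apply/mapP; exists nc.
by apply/map_f; rewrite ncE -it; apply: mem_desc sl _ _ => //; lia.
Qed.

Definition prefix (j : nat) (u : seq (seq Z)) : Prop :=
  exists2 t, presents t & take j t = u.

Lemma prefix_refl j u r : (r < 8)%N -> prefix j u -> prefix j [seq refl r c | c <- u].
Proof.
by move=> ltr [t pt <-]; exists [seq refl r c | c <- t]; [exact: presents_refl|rewrite map_take].
Qed.

Lemma badrefl_mem J u r : badrefl J u = Some r -> r \in J.
Proof.
elim: u J => [|c u IH] J //=.
case e: [seq _ <- J | _] => [|r' l].
  by case e': [seq _ <- J | _] => [|x l] //; rewrite -e' => /IH; rewrite mem_filter => /andP[].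
move=> [<-]; have : r' \in r' :: l by rewrite mem_head.
by rewrite -e mem_filter => /andP[].
Qed.

Lemma prefix_canon f j u : prefix j u -> prefix j (canon f u).
Proof.
elim: f u => [|f IH] u pu //.
rewrite -[canon _ _]/(if badrefl (iota 0 8) u is Some r then canon f [seq refl r c | c <- u] else u).
case e: (badrefl _ u) => [r|] //; apply/IH/prefix_refl => //.
by have := badrefl_mem e; rewrite mem_iota.
Qed.

Lemma prefix_rrefl j u p : p \in posroots -> supported j p ->
  prefix j u -> prefix j (rrefl p u).
Proof.
move=> /posrootsP[sp pp] pj [t pt <-]; exists (rrefl p t); last by rewrite rrefl_take.
exact: presents_rrefl.
Qed.

Lemma prefix_move j u w :
  all (fun i => (i < size posroots)%N && supported j (nth [::] posroots i)) w ->
  prefix j u -> prefix j (move posroots w u).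
Proof.
rewrite /move; elim: w u => [|i w IH] u // /andP[/andP[lti pj] hw] pu.
by apply: IH => //; apply/prefix_canon/prefix_rrefl => //; exact: mem_nth.
Qed.

(** Only simple reflections that fix the first j rows are applied, so the prefix stays while the
    height of row j grows until the row is dominant for them. *)
Lemma dominant_next k j t : (j < 8)%N -> presents t ->
  2480 - int_of_Z (dotl heights (nth [::] t j)) <= k%:Z ->
  exists t', [/\ presents t', take j t' = take j t & jdom (fixers (take j t)) (nth [::] t' j)].
Proof.
move=> ltj; elim: k t => [|k IH] t pt hk.
all: have [sq _] := pt; have /andP[/eqP st wt] := sq.
all: have sw : size (nth [::] t j) = 8 by exact: square8_nth.
all: case: (boolP (all (fun r => Z.leb 0 (nth 0%BZ (nth [::] t j) r)) (fixers (take j t)))).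
1,3: by exists t; split=> //; rewrite /jdom allbE.
all: move=> /allPn[r]; rewrite mem_filter mem_iota => /andP[/allP fx ltr].
all: rewrite Z.leb_antisym negbK => neg.
all: have h : int_of_Z (dotl heights (nth [::] t j)) + 1
    <= int_of_Z (dotl heights (nth [::] [seq refl r c | c <- t] j)).
1,3: by rewrite (nth_map [::]) ?st //; apply: (@height_refl (Ordinal ltr)).
all: have pt' := presents_refl ltr pt.
all: have /andP[h1 h2] : -2480 <= int_of_Z (dotl heights (nth [::] [seq refl r c | c <- t] j)) <= 2480.
1,3: by have := height_bound pt' (root_unit (Ordinal ltj)); rewrite lcomb_unit //; case: pt'.
  by exfalso; lia.
have [|t' [p' e1 e2]] := IH _ pt'; first by lia.
have fxE : take j [seq refl r c | c <- t] = take j t.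
  rewrite -map_take map_id_in // => c /fx /Z.eqb_eq c0.
  by rewrite /refl c0.
by rewrite fxE in e1 e2; exists t'.
Qed.

Lemma lcomb_rcons j p t : square8 t -> size p = 8 -> (j < 8)%N ->
  all (Z.eqb 0) (drop j.+1 p) ->
  lcomb 8 p t = axpy (nth 0%BZ p j) (nth [::] t j) (lcomb 8 (take j p) (take j t)).
Proof.
move=> sq sp ltj dz; have /andP[/eqP st wt] := sq.
have wt' : wide 8 (take j t) by apply/allP => c /mem_take; exact: (allP wt).
have s1 : size (nth [::] t j) = size (lcomb 8 (take j p) (take j t)).
  by rewrite size_lcomb // square8_nth.
apply: (@eq_from_nth _ 0%BZ); first by rewrite size_axpy -s1 minnn size_lcomb // square8_nth.
move=> i _; apply: intZ_inj; rewrite nth_axpy //.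
rewrite !(@nth_lcomb 8 _ _ _ 8) ?st // ?size_take ?st ?ltj; last exact: ltnW.
rewrite (bigD1 (Ordinal ltj)) //=; congr (_ + _).
rewrite [RHS](bigD1 (Ordinal ltj)) //= nth_default ?size_take ?sp ?ltj // mul0r add0r.
apply: eq_bigr => l; rewrite -val_eqE /= => lj.
case: (ltnP l j) => [lt|ge]; first by rewrite !nth_take.
rewrite [nth 0%BZ (take _ _) _]nth_default ?size_take ?sp ?ltj // mul0r.
have ltl : (j < l)%N by rewrite ltn_neqAle eq_sym lj.
have -> : nth 0%BZ p l = 0%BZ; last by rewrite mul0r.
have := allP dz (nth 0%BZ p l); rewrite -[l in nth _ _ l](subnKC ltl) -nth_drop.
rewrite mem_nth ?size_drop ?sp ?ltn_sub2r ?(leq_ltn_trans ltl (ltn_ord l)) //.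
by move=> /(_ isT)/Z.eqb_eq <-.
Qed.

Lemma eic_sym (x y : 'rV[int]_8) : x *m eic *m y^T = y *m eic *m x^T.
Proof.
rewrite [LHS]mx11_scalar [RHS]mx11_scalar; congr (_%:M).
by rewrite -(trmxK (x *m eic *m y^T)) mxE !trmx_mul trmxK eicT mulmxA.
Qed.

Lemma inorm_axpy m w u : size w = 8 -> size u = 8 ->
  inorm (axpy m w u) =
  Z.add (dotl u [seq dotl r u | r <- icartan])
    (Z.mul m (Z.add (Z.mul 2 (dotl [seq dotl r u | r <- icartan] w)) (Z.mul m (inorm w)))).
Proof.
move=> sw su; apply: intZ_inj.
have sa : size (axpy m w u) = 8 by rewrite size_axpy sw su.
rewrite inormE // !(intZD, intZM) -/(inorm u) !inormE // rowZ_axpy //.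
have -> : int_of_Z (dotl [seq dotl r u | r <- icartan] w) =
    (rowZ 8 u *m eic *m (rowZ 8 w)^T) 0 0.
  rewrite (@dotlE _ _ 8) ?sw // mxE; apply: eq_bigr => i _; rewrite !mxE.
  congr (_ * _); rewrite (nth_map [::]) // (@dotlE _ _ 8) ?su //.
  rewrite -[eic]eicT; apply: eq_bigr => l _; by rewrite !mxE mulrC.
rewrite (_ : int_of_Z 2%BZ = 2) //.
move: (rowZ 8 u) (rowZ 8 w) (int_of_Z m) => x y a.
rewrite linearD linearZ /= !(mulmxDl, mulmxDr) -!scalemxAl -!scalemxAr.
rewrite (eic_sym y x).
move: (x *m _ *m _) (x *m _ *m _) (y *m _ *m _) => X Y Z.
by rewrite !mxE; ring.
Qed.

(** Pruning loses no pair: after reflections on the side of M the next row is dominant for [fixers],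
    it is the image of a simple root and so belongs to [images], and the images of all other roots
    have norms allowed by [image_norm]. *)
Lemma prefix_children j u : (j < 8)%N -> prefix j u ->
  exists2 u', u' \in children images posroots j u & prefix j.+1 u'.
Proof.
move=> ltj [t pt tu]; have [sq _] := pt.
have := height_bound pt (root_unit (Ordinal ltj)); rewrite lcomb_unit // => /andP[h1 _].
have [|t' [pt' tu' dom]] := @dominant_next 4960 j t ltj pt; first by move: h1 => /=; lia.
rewrite tu in tu' dom; have [sq' _] := pt'; have /andP[/eqP st' wt'] := sq'.
have [n] := image_mem pt' (size_mkseq _ _) (root_unit (Ordinal ltj)).
rewrite lcomb_unit //= => nw; have [nE _] := imagesP nw.
exists (rcons u (nth [::] t' j)); last by exists t'; rewrite // (take_nth [::]) ?st' // tu'.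
apply/mapP; exists (n, nth [::] t' j) => //; rewrite mem_filter nw andbT /= dom.
rewrite allbE; apply/allP => _ /mapP[p + ->]; rewrite mem_filter => /andP[/andP[_ dz] pr].
have [sp pp] := posrootsP pr.
rewrite /pass /=.
have [n'] := image_mem pt' sp pp; rewrite (@lcomb_rcons j) // tu' => /imagesP[].
rewrite inorm_axpy ?size_lcomb ?square8_nth //; last first.
  by rewrite -tu'; apply/allP => c /mem_take; exact: (allP wt').
by move=> <-; rewrite nE.
Qed.

(** A candidate is carried by its word to a member of [news]; the roots of the word are supported on
    the first j + 1 coordinates, so the word acts on presented prefixes. The empty word is the case
    where the candidate itself is kept. *)
Lemma prefix_level j ts ws ts' : (j < 8)%N ->
  level images posroots j ts ws = Some ts' ->
  (exists2 u, u \in ts & prefix j u) -> exists2 u, u \in ts' & prefix j.+1 u.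
Proof.
move=> ltj; rewrite /level; set ks := flatten _; set news := [seq _ | _ <- _ & _].
case: ifP => // /andP[/eqP sk /allP hk] [<-] [u ut pu].
have [u' u'c pu'] := prefix_children ltj pu.
have u'k : u' \in ks by apply/flattenP; exists (children images posroots j u) => //; exact: map_f.
have iu : (index u' ks < size ks)%N by rewrite index_mem.
have : (u', nth [::] ws (index u' ks)) \in zip ks ws.
  rewrite -{1}(nth_index [::] u'k) -nth_zip // mem_nth // size_zip -sk minnn //.
move=> /hk /andP[h1 h2].
exists (move posroots (nth [::] ws (index u' ks)) u') => //.
exact: prefix_move.
Qed.

Lemma prefix_search j ts cert fin : (j + size cert <= 8)%N ->
  search images posroots j ts cert = Some fin ->
  (exists2 u, u \in ts & prefix j u) -> exists2 u, u \in fin & prefix (j + size cert) u.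
Proof.
elim: cert j ts => [|ws cert IH] j ts /=; first by move=> _ [<-]; rewrite addn0.
case e: (level _ _ _ _ _) => [ts'|] //; rewrite addnS => le8 sE h.
have le8' : (j.+1 + size cert <= 8)%N by rewrite addSn.
rewrite -addSn; apply: (IH _ ts' le8' sE).
by apply: prefix_level e h; apply: leq_trans le8; rewrite ltnS leq_addr.
Qed.

End Search.

Lemma presents_finals (R : realType) d (M N : set 'rV[R]_d) : EE8_pair M N ->
  exists2 t, t \in finals & presents M N t.
Proof.
move=> [ME NE iL rL]; have [t pt] := presents_ex iL ME NE.
have p0 : exists2 u, u \in [:: [::]] & prefix M N 0 u.
  by exists [::]; rewrite ?mem_head //; exists t; rewrite ?take0.
have [u uf [t' pt' tu]] := prefix_search rL (isT : (0 + size certificate <= 8)%N) search_finals p0.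
exists u => //; rewrite -tu take_oversize //.
by case: pt' => /andP[/eqP -> _].
Qed.

(** * Discriminant groups *)

Definition gramZ (t : seq (seq Z)) : seq (seq Z) :=
  mkseq (fun i => mkseq (fun j =>
    if (i < 8)%N then
      if (j < 8)%N then Z.mul 2 (nth 0%BZ (nth [::] cartan i) j)
      else nth 0%BZ (nth [::] t (j - 8)) i
    else
      if (j < 8)%N then nth 0%BZ (nth [::] t (i - 8)) j
      else Z.mul 2 (nth 0%BZ (nth [::] cartan (i - 8)) (j - 8))) 16) 16.

Definition zeroZ (a : seq (seq Z)) : bool := all (all (Z.eqb 0)) a.

Lemma mxZ_zero m n a : zeroZ a -> mxZ m n a = 0.
Proof.
move=> /allP h; apply/matrixP => i j; rewrite !mxE.
case: (ltnP i (size a)) => lti; last by rewrite [nth [::] a i]nth_default // nth_nil.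
have /allP hi := h _ (mem_nth [::] lti).
case: (ltnP j (size (nth [::] a i))) => ltj; last by rewrite nth_default.
by have /Z.eqb_eq <- := hi _ (mem_nth 0%BZ ltj).
Qed.

Definition eqZ (m n : nat) (a b : seq (seq Z)) : bool :=
  all (fun i => all (fun j =>
    Z.eqb (nth 0%BZ (nth [::] a i) j) (nth 0%BZ (nth [::] b i) j)) (iota 0 n)) (iota 0 m).

Lemma eqZP m n a b : reflect (mxZ m n a = mxZ m n b) (eqZ m n a b).
Proof.
apply: (iffP allP) => [h|e i].
  apply/matrixP => i j; rewrite !mxE; congr int_of_Z; apply/Z.eqb_eq.
  by apply: (allP (h i _)); rewrite mem_iota ltn_ord.
rewrite mem_iota /= => lti; apply/allP => j; rewrite mem_iota /= => ltj.
apply/Z.eqb_eq/intZ_inj.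
by have /matrixP/(_ (Ordinal lti) (Ordinal ltj)) := e; rewrite !mxE.
Qed.

Definition compatible (n : nat) (a : seq (seq Z)) : bool := wide n a && (size a == n).

Lemma wide_mul n a b : wide n b -> wide n (mulZ n a b).
Proof. by move=> wb; apply/allP => _ /mapP[r _ ->]; rewrite size_lcomb. Qed.

Lemma mxZ_mul3 m k l n a b c : wide l b -> (size b <= k)%N -> wide n c -> (size c <= l)%N ->
  mxZ m n (mulZ n (mulZ l a b) c) = mxZ m k a *m mxZ k l b *m mxZ l n c.
Proof. by move=> *; rewrite (@mxZ_mul m l n) // (@mxZ_mul m k l). Qed.

Section PairGram.
Context {R : realType} (d : nat) (M N : set 'rV[R]_d).
Local Notation rz := (@rz R _ _).

Lemma sumL_span m n (A : 'M[R]_(m, d)) (B : 'M[R]_(n, d)) :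
  sumL (zspan A) (zspan B) = zspan (col_mx A B).
Proof.
rewrite eqEsubset; split=> x.
  move=> [_ [a _ <-] [_ [b _ <-] <-]]; exists (row_mx a b) => //.
  by rewrite /rz map_row_mx mul_row_col.
move=> [c _ <-]; exists (rz (lsubmx c) *m A); first exact: zspan_mul.
exists (rz (rsubmx c) *m B); first exact: zspan_mul.
by rewrite -mul_row_col /rz -map_row_mx hsubmxK.
Qed.

Lemma pair_gram t (A B : 'M[R]_(8, d)) : framed M N A B -> B *m A^T = rz (mxZ 8 8 t) ->
  (col_mx A B : 'M_(16, d)) *m (col_mx A B)^T = rz (mxZ 16 16 (gramZ t)).
Proof.
move=> [[_ AA] [_ BB]] BA.
have e2 (C : 'M[R]_(8, d)) i j : C *m C^T = 2 *: rz ec -> (C *m C^T) i j =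
    (int_of_Z (Z.mul 2 (nth 0%BZ (nth [::] cartan i) j)))%:~R.
  by move=> ->; rewrite !mxE intZM rmorphM.
apply/matrixP => i j; rewrite [RHS]mxE [mxZ _ _ _ _ _]mxE !nth_mkseq //.
rewrite -(@dot_row _ (8 + 8) (8 + 8)).
case: (@split_ordP 8 8 i) => i' ->; case: (@split_ordP 8 8 j) => j' ->.
- by rewrite !rowKu dot_row e2.
- rewrite rowKu rowKd dotC dot_row BA !mxE -[nat_of_ord (rshift 8 j')]/(8 + j')%N addKn.
  by [].
- rewrite rowKu rowKd dot_row BA !mxE -[nat_of_ord (rshift 8 i')]/(8 + i')%N addKn.
  by [].
- rewrite !rowKd dot_row e2 // -[nat_of_ord (rshift 8 i')]/(8 + i')%N addKn.
  by rewrite -[nat_of_ord (rshift 8 j')]/(8 + j')%N addKn.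
Qed.

End PairGram.

Section Discriminant.
Context {R : realType} (d : nat).
Local Notation rz := (@rz R _ _).

Lemma real_span_zspan m (Y : 'M[R]_(m, d)) x :
  real_span (zspan Y) x -> exists w, x = w *m Y.
Proof.
move=> [n [B [BY /submxP[w ->]]]]; have [U ->] := zspan_rows BY.
by exists (w *m rz U); rewrite mulmxA.
Qed.

(** Pairing with the basis Y identifies the dual lattice with integer row vectors and the lattice
    with the row space of G. Multiplication by the unimodular Q turns the latter into the row space
    of D, because G Q = Pi D with Pi unimodular. The map f is this pairing followed by Q; the floor
    is exact on dual vectors. *)
Lemma smith_discr (s : seq nat) (Y : 'M[R]_(size s, d)) (G P Pi Q Qi : 'M[int]_(size s)) :
  let D : 'M[int]_(size s) := diag_mx (\row_i (nth 0%N s i)%:Z) in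
  all (ltn 0) s -> sorted dvdn s -> Y *m Y^T = rz G ->
  G *m Q = Pi *m D -> P *m Pi = 1%:M -> Q *m Qi = 1%:M ->
  row_free Y /\ discr_invariants (zspan Y) s.
Proof.
move=> D s0 ss YY GQ PPi QQi.
pose Dr : 'M[R]_(size s) := diag_mx (\row_i ((nth 0%N s i)%:R)^-1).
have s0' (i : 'I_(size s)) : (nth 0%N s i)%:R != 0 :> R.
  by rewrite pnatr_eq0 -lt0n; apply: (allP s0); rewrite mem_nth.
have DDr : rz D *m Dr = 1%:M.
  apply/matrixP => i j; rewrite /D /Dr mul_mx_diag !mxE.
  by case: eqP => [->|_]; rewrite ?mulr1n ?mulr0n ?rmorph0 ?mul0r // -pmulrn mulfV.
have PiP := mulmx1C PPi.
pose Gi : 'M[R]_(size s) := rz Q *m Dr *m rz P.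
have GGi : rz G *m Gi = 1%:M.
  by rewrite /Gi !mulmxA -rzM GQ rzM -(mulmxA (rz Pi)) DDr mulmx1 -rzM PiP rz_scalar.
have GiG := mulmx1C GGi.
have free : row_free Y.
  by apply/row_freeP; exists (Y^T *m Gi); rewrite mulmxA YY.
split=> //; split=> //; first by exists Y.
pose f (x : 'rV[R]_d) (i : 'I_(size s)) := Num.floor ((x *m Y^T *m rz Q) 0 i).
have dualP x : dual (zspan Y) x -> exists c, x *m Y^T = rz c.
  move=> [_ hx]; apply: rz_int => i j; rewrite (ord1 i).
  by have := hx _ (zspan_row Y j); rewrite -{1}[x](row_id 0) dot_row.
have fE x c i : x *m Y^T = rz c -> f x i = (c *m Q) 0 i.
  by move=> xc; rewrite /f xc -rzM mxE intrKfloor.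
exists f; split.
- move=> x y /dualP[a xa] /dualP[b yb] i.
  rewrite (fE _ _ _ xa) (fE _ _ _ yb) (fE _ (a + b)) ?mulmxDl ?xa ?yb ?rzD //.
  by rewrite [(_ + _ : 'rV_ _) 0 i]mxE.
- move=> v; pose c := (\row_i v i) *m Qi.
  have xY : (rz c *m Gi *m Y) *m Y^T = rz c by rewrite -[LHS]mulmxA YY -(mulmxA _ Gi) GiG mulmx1.
  exists (rz c *m Gi *m Y).
    split; first by exists (size s), Y; split; [exact: zspan_row|exact: submxMl].
    move=> _ [e _ <-]; rewrite /dot trmx_mul mulmxA xY -rz_tr -rzM mxE.
    exact: intr_int.
  by move=> i; rewrite (fE _ _ _ xY) /c -mulmxA (mulmx1C QQi) mulmx1 mxE.
- move=> x dx; have [c xc] := dualP x dx.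
  have fx i := fE x c i xc.
  split=> [[a _ xa] i|h].
    rewrite fx; have -> : c = a *m G.
      by apply: (@rz_inj R); rewrite -xc -xa -mulmxA YY rzM.
    by rewrite -mulmxA GQ mulmxA mul_mx_diag !mxE dvdz_mull.
  have /choice[b bE] : forall i, exists b, (c *m Q) 0 i = b * (nth 0%N s i)%:Z.
    by move=> i; have /dvdzP[b] := h i; rewrite fx => ->; exists b.
  have cQ : c *m Q = (\row_i b i) *m D.
    by apply/rowP => i; rewrite bE mul_mx_diag !mxE.
  pose a := (\row_i b i) *m P.
  have ca : c = a *m G.
    rewrite -[c]mulmx1 -QQi mulmxA cQ -[a *m G]mulmx1 -QQi mulmxA; congr (_ *m _).
    by rewrite /a -!mulmxA GQ (mulmxA P) PPi mul1mx.
  exists a => //; have [w xw] := real_span_zspan dx.1.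
  apply/esym/subr0_eq/dot_eq0.
  rewrite {2}xw -mulmxBl /dot trmx_mul mulmxA mulmxBl xc -(mulmxA _ Y) YY ca rzM subrr.
  by rewrite mul0mx mxE.
Qed.

(** U extracts a basis from n possibly dependent generators and V recovers the generators from it: V
    U X = X is tested in the form V U G = G. The other matrices give a Smith form of the Gram matrix
    [Gr] of the basis. *)
Definition smith_check (n : nat) (G U V P Pi Q Qi : seq (seq Z)) (s : seq nat) : bool :=
  let r := size s in
  let Gr := mulZ r (mulZ n U G) (trZ r n U) in
  [&& (r <= n)%N, all (wide n) [:: G; U], all (wide r) [:: V; P; Pi; Q; Qi],
      all (fun a => size a <= n)%N [:: G; V], all (fun a => size a == r) [:: U; P; Pi; Q; Qi],
      all (ltn 0) s && sorted dvdn s,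
      eqZ n n (mulZ n (mulZ n V U) G) G,
      eqZ r r (mulZ r Gr Q) (mulZ r Pi (diagZ [seq Z.of_nat a | a <- s])),
      eqZ r r (mulZ r P Pi) (scalZ r 1) & eqZ r r (mulZ r Q Qi) (scalZ r 1)].

Lemma mxZ_diag s : mxZ (size s) (size s) (diagZ [seq Z.of_nat a | a <- s])
  = diag_mx (\row_i (nth 0%N s i)%:Z).
Proof.
apply/matrixP => i j; rewrite !mxE !nth_mkseq ?size_map // val_eqE.
rewrite (nth_map 0%N) //; case: eqP => _ //.
by rewrite mulr1n; lia.
Qed.

Lemma wide_tr m n a : wide m (trZ m n a).
Proof. by apply/allP => _ /mapP[j _ ->]; rewrite size_mkseq. Qed.

Lemma size_tr m n a : size (trZ m n a) = n.
Proof. exact: size_mkseq. Qed.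

Lemma smith_checkP n G U V P Pi Q Qi s (X : 'M[R]_(n, d)) :
  smith_check n G U V P Pi Q Qi s -> X *m X^T = rz (mxZ n n G) ->
  exists Y : 'M[R]_(size s, d), [/\ Y = rz (mxZ (size s) n U) *m X,
    X = rz (mxZ n (size s) V) *m Y, int_basis Y (zspan X) &
    discr_invariants (zspan X) s].
Proof.
move=> /and4P[len /and3P[wG wU _] /and5P[wV wP wPi wQ /andP[wQi _]] H] XX.
move: H => /and4P[/and3P[sG sV _] /and5P[/eqP sU /eqP sP /eqP sPi /eqP sQ /andP[/eqP sQi _]]].
move=> /andP[s0 ss] /and4P[/eqZP e1 /eqZP e2 /eqZP e3 /eqZP e4].
have wD : wide (size s) (diagZ [seq Z.of_nat a | a <- s]).
  by apply/allP => _ /mapP[j _ ->]; rewrite size_mkseq size_map.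
have sD : size (diagZ [seq Z.of_nat a | a <- s]) = size s by rewrite size_mkseq size_map.
pose Y : 'M[R]_(size s, d) := rz (mxZ (size s) n U) *m X.
have XV : X = rz (mxZ n (size s) V) *m Y.
  apply/esym/eqP; rewrite -subr_eq0 /Y mulmxA -rzM -{2}[X]mul1mx -mulmxBl; apply/eqP.
  apply: gram_ker; rewrite XX mulmxBl mul1mx -!rzM -rzN -?rzD.
  by rewrite -(@mxZ_mul n (size s) n) ?sU // -(@mxZ_mul n n n) // e1 addrN rz0.
exists Y; rewrite -(@zspan_eq _ _ _ _ Y X _ _ erefl XV).
pose Gr := mxZ (size s) n U *m mxZ n n G *m (mxZ (size s) n U)^T.
have YY : Y *m Y^T = rz Gr.
  by rewrite /Y /Gr trmx_mul mulmxA -(mulmxA _ X) XX !rzM rz_tr.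
have := @smith_discr s Y Gr (mxZ _ _ P) (mxZ _ _ Pi) (mxZ _ _ Q) (mxZ _ _ Qi) s0 ss YY.
rewrite -mxZ_diag -(@mxZ_mul (size s) (size s) (size s) Pi) ?sD // -e2.
rewrite (@mxZ_mul (size s) (size s) (size s)) ?sQ //.
rewrite (@mxZ_mul (size s) n (size s)) ?wide_tr ?size_tr //.
rewrite (@mxZ_mul (size s) n n) // mxZ_tr => /(_ erefl).
rewrite -!(@mxZ_mul (size s) (size s) (size s)) ?sPi ?sQi // e3 e4 mxZ_scal.
by move=> /(_ erefl erefl)[free di]; split.
Qed.

End Discriminant.

(** * The order of the dihedral group *)

Section Dihedral.
Context {R : realType} (d : nat).
Implicit Types s t g : 'M[R]_d.

Definition dihedral_elements k g s : seq 'M[R]_d :=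
  [seq g ^+ i | i <- iota 0 k] ++ [seq g ^+ i * s | i <- iota 0 k].

(** Since s g = g^(-1) s with g^(-1) = g^(k-1), every product of generators reduces to the form g^a
    s^b. *)
Lemma dihedral_group k s t : (0 < k)%N -> s * s = 1 -> t * t = 1 -> (s * t) ^+ k = 1 ->
  smallest (@linear_group R d) [set s; t] = [set x | x \in dihedral_elements k (s * t) s].
Proof.
move=> k0 ss tt; set g := s * t => gk; pose S := [set x | x \in dihedral_elements k g s].
have SP a (b : bool) : S (g ^+ a * s ^+ b).
  rewrite /S /= mem_cat -(expr_mod a gk); apply/orP.
  by case: b; [right|left]; rewrite ?expr1 ?expr0 ?mulr1;
    apply: (map_f (fun i => _)); rewrite mem_iota ltn_mod.
have PS x : S x -> exists a, exists b : bool, x = g ^+ a * s ^+ b.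
  rewrite /S /= mem_cat => /orP[] /mapP[i _ ->]; first by exists i, false; rewrite mulr1.
  by exists i, true; rewrite expr1.
have gg : g ^+ k.-1 * g = 1 by rewrite -exprSr prednK.
have gts : g * (t * s) = 1 by rewrite /g mulrA -(mulrA s t t) tt mulr1.
have hE : g ^+ k.-1 = t * s by rewrite -[LHS]mulr1 -gts mulrA gg mul1r.
have sg : s * g = g ^+ k.-1 * s by rewrite hE /g mulrA ss mul1r -mulrA ss mulr1.
have sgX c : s * g ^+ c = g ^+ (k.-1 * c) * s.
  elim: c => [|c IH]; first by rewrite muln0 !expr0 mulr1 mul1r.
  by rewrite exprSr mulrA IH -mulrA sg mulrA -exprD mulnSr.
have SM x y : S x -> S y -> S (x * y).
  move=> /PS[a [b ->]] /PS[c [e ->]]; case: b; last first.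
    by rewrite expr0 mulr1 mulrA -exprD; exact: SP.
  rewrite expr1 mulrA -(mulrA _ s) sgX mulrA -exprD -mulrA; case: e.
    by rewrite expr1 ss; exact: (SP _ false).
  by rewrite mulr1; exact: (SP _ true).
have inv1 (x y : 'M[R]_d) : x * y = 1 -> x \in unitmx /\ invmx x = y.
  move=> xy; have [ux _] := mulmx1_unit xy; split=> //.
  by rewrite -[invmx x]mulmx1 -[1%:M]xy mulmxA mulVmx // mul1mx.
have SV x : S x -> exists2 y, S y & x * y = 1.
  move=> /PS[a [[|] ->]].
    exists (g ^+ a * s ^+ true); first exact: SP.
    rewrite !expr1 mulrA -(mulrA _ s) sgX mulrA -exprD -mulrA ss mulr1.
    by rewrite -mulSn prednK // exprM gk expr1n.
  exists (g ^+ (k.-1 * a) * s ^+ false); first exact: SP.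
  by rewrite !mulr1 -exprD -mulSn prednK // exprM gk expr1n.
have sS : S s by rewrite -[s]mul1r; exact: (SP 0%N true).
have tS : S t.
  have -> : t = g ^+ k.-1 * s ^+ true by rewrite hE expr1 -mulrA ss mulr1.
  exact: SP.
rewrite eqEsubset; split.
  apply: smallest_sub; last by move=> x [->|->].
  split=> //.
  - by rewrite -[1%:M](mulr1 1); exact: (SP 0%N false).
  - by move=> x /SV[y Sy xy]; have [_ ->] := inv1 x y xy.
  - by move=> x /SV[y _ xy]; have [] := inv1 x y xy.
move=> x /PS[a [b ->]] C [[C1 CM _ _] Cst].
have Cs : C s by apply: Cst; left.
have Ct : C t by apply: Cst; right.
apply: (CM); last by case: b; rewrite ?expr1.
elim: a => [|a IH]; first by rewrite expr0.
by rewrite exprSr; apply: (CM _ _ IH); apply: (CM).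
Qed.

Lemma card_uniq_seq (T : eqType) (x0 : T) (l : seq T) : uniq l -> [set x | x \in l] #= `I_(size l).
Proof.
move=> ul; rewrite -[X in X #= _](_ : nth x0 l @` `I_(size l) = _).
  apply: inj_card_eq => i j /set_mem /= ltI /set_mem /= ltj e.
  by apply/eqP; rewrite -(nth_uniq x0 ltI ltj ul); apply/eqP.
rewrite eqEsubset; split=> [_ [i lti <-]|x /= xl]; first exact: mem_nth.
by exists (index x l); rewrite /= ?index_mem ?nth_index.
Qed.

End Dihedral.

Definition zeros : seq (seq Z) := nseq 16 (nseq 16 0%BZ).

Definition unit_rows (o : nat) : seq (seq Z) :=
  mkseq (fun i => mkseq (fun j => if j == (o + i)%N then 1%BZ else 0%BZ) 16) 8.

(** Operators are encoded by integer matrices K as 1 + X^T K X. The projection to the span of A is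
    A^T (2 [ec])^(-1) A, and the involution is 1 minus twice that projection, which leaves the
    integral coefficient -[eic] in the block at offset o. *)
Definition halfZ (o : nat) : seq (seq Z) :=
  addZ 16 16 (-1) zeros (mulZ 16 (mulZ 8 (trZ 8 16 (unit_rows o)) icartan) (unit_rows o)).

(** The code of the product of the operators with codes K and L, as X X^T = G. *)
Definition compZ (G K L : seq (seq Z)) : seq (seq Z) :=
  addZ 16 16 1 (addZ 16 16 1 K L) (mulZ 16 (mulZ 16 K G) L).

(** When the rows of X are dependent, an operator E has several codes K. The matrix G K G depends on
    E alone, being X (E - 1) X^T, and it vanishes only for E = 1. *)
Definition sandwich (G K : seq (seq Z)) : seq (seq Z) := mulZ 16 (mulZ 16 G K) G.

Definition order_check (t : seq (seq Z)) (k : nat) : bool :=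
  let G := gramZ t in
  let KM := halfZ 0 in let g := compZ G KM (halfZ 8) in
  let ps := traject (fun K => compZ G K g) zeros k in
  [&& (0 < k)%N, zeroZ (sandwich G (iter k (fun K => compZ G K g) zeros)) &
      uniq [seq sandwich G K | K <- ps ++ [seq compZ G K KM | K <- ps]]].

Lemma mxZ_inj m n a b : compatible n a -> compatible n b -> n = m ->
  mxZ m n a = mxZ m n b -> a = b.
Proof.
move=> /andP[wa /eqP sa] /andP[wb /eqP sb] nm e; subst m.
apply: (@eq_from_nth _ [::]); rewrite ?sa ?sb // => i lti.
apply: (@rowZ_inj n); rewrite ?(wide_nth wa) ?(wide_nth wb) ?sa ?sb //.
by rewrite -!(row_mxZ _ _ (Ordinal lti)) e.
Qed.

Lemma compatible_add c a b : compatible 16 (addZ 16 16 c a b).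
Proof.
rewrite /compatible size_mkseq eqxx andbT.
by apply/allP => _ /mapP[i _ ->]; rewrite size_mkseq.
Qed.

Lemma compatible_gram t : compatible 16 (gramZ t).
Proof.
rewrite /compatible size_mkseq eqxx andbT.
by apply/allP => _ /mapP[i _ ->]; rewrite size_mkseq.
Qed.

Lemma compatible_sandwich t K : compatible 16 (sandwich (gramZ t) K).
Proof.
have /andP[wG /eqP sG] := compatible_gram t.
by rewrite /compatible /sandwich wide_mul // !size_map sG.
Qed.

Section Order.
Context {R : realType} (d : nat) (M N : set 'rV[R]_d).
Local Notation rz := (@rz R _ _).

Lemma invol_frame (A : 'M[R]_(8, d)) (K : set 'rV[R]_d) : EE8_frame A K ->
  invol K = 1%:M - A^T *m rz eic *m A.
Proof.
move=> [-> AA]; apply: invol_spec_uniq (invol_specP _) _; split=> [x|y oy].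
  move=> /real_span_zspan[w ->].
  rewrite mulmxBr mulmx1 !mulmxA -(mulmxA w A) AA -scalemxAr -!scalemxAl.
  rewrite -(mulmxA w) -rzM ecK rz_scalar mulmx1 scaler_nat mulr2n opprD addrA subrr.
  by rewrite add0r.
have yA : y *m A^T = 0.
  apply/rowP => j; rewrite [RHS]mxE.
  by have := oy _ (zspan_row A j); rewrite -{1}[y](row_id 0) dot_row.
by rewrite mulmxBr mulmx1 !mulmxA yA !mul0mx subr0.
Qed.

Variables (t : seq (seq Z)) (A B : 'M[R]_(8, d)).
Hypotheses (fAB : framed M N A B) (BA : B *m A^T = rz (mxZ 8 8 t)).
Let X : 'M[R]_(16, d) := col_mx A B.
Let G := mxZ 16 16 (gramZ t).

Definition elt (K : 'M[int]_16) : 'M[R]_d := 1%:M + X^T *m rz K *m X.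

Lemma eltM K L : elt K *m elt L = elt (K + L + K *m G *m L).
Proof.
rewrite /elt mulmxDl mul1mx mulmxDr mulmx1 !rzD !mulmxDr !mulmxDl.
rewrite !mulmxA -(mulmxA _ X X^T) (pair_gram fAB BA) -/G -!(mulmxA X^T) -!rzM !mulmxA.
by rewrite addrA -!addrA; congr (_ + _); rewrite addrCA.
Qed.

Lemma elt_comp K L : elt (mxZ 16 16 (compZ (gramZ t) K L)) =
  elt (mxZ 16 16 K) *m elt (mxZ 16 16 L) \/ ~~ compatible 16 L.
Proof.
case: (boolP (compatible 16 L)) => [/andP[wL /eqP sL]|]; last by right.
have /andP[wG /eqP sG] := compatible_gram t.
by left; rewrite eltM !mxZ_add (@mxZ_mul3 16 16 16 16) ?sG ?sL // !scale1r.
Qed.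

Lemma elt_zeros : elt (mxZ 16 16 zeros) = 1%:M.
Proof. by rewrite mxZ_zero // /elt rz0 mulmx0 mul0mx addr0. Qed.

Lemma unit_rowsE o (C : 'M[R]_(8, d)) : (o <= 8)%N ->
  (forall (i : 'I_8) (j : 'I_16), j = (o + i)%N :> nat -> row j X = row i C) ->
  rz (mxZ 8 16 (unit_rows o)) *m X = C.
Proof.
move=> leo XC; apply/row_matrixP => i.
have lti : (o + i < 16)%N by have := ltn_ord i; lia.
rewrite row_mul -rz_row -(XC i (Ordinal lti)) // [RHS]rowE; congr (_ *m _).
apply/rowP => j; rewrite !mxE !nth_mkseq // eqxx -val_eqE /=.
by case: eqP.
Qed.

Lemma elt_half o (C : 'M[R]_(8, d)) : (o <= 8)%N ->
  (forall (i : 'I_8) (j : 'I_16), j = (o + i)%N :> nat -> row j X = row i C) ->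
  elt (mxZ 16 16 (halfZ o)) = 1%:M - C^T *m rz eic *m C.
Proof.
move=> leo XC; rewrite -(unit_rowsE leo XC) /elt; congr (_ + _).
have wu : wide 16 (unit_rows o) by apply/allP => _ /mapP[i _ ->]; rewrite size_mkseq.
rewrite mxZ_add mxZ_zero // add0r (@mxZ_mul3 16 8 8 16) ?size_mkseq // mxZ_tr.
rewrite (_ : int_of_Z (-1)%BZ = -1) // scaleN1r rzN mulmxN mulNmx; congr (- _).
by rewrite !rzM trmx_mul rz_tr !mulmxA.
Qed.

Lemma elt_M : elt (mxZ 16 16 (halfZ 0)) = invol M.
Proof.
have [fA _] := fAB; rewrite (invol_frame fA); apply: elt_half => // i j ji.
rewrite /X -(rowKu i A B); congr row; exact: val_inj.
Qed.

Lemma elt_N : elt (mxZ 16 16 (halfZ 8)) = invol N.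
Proof.
have [_ fB] := fAB; rewrite (invol_frame fB); apply: elt_half => // i j ji.
rewrite /X -(rowKd i A B); congr row; exact: val_inj.
Qed.

Lemma elt_sandwich K : X *m (elt (mxZ 16 16 K) - 1%:M) *m X^T =
  rz (mxZ 16 16 (sandwich (gramZ t) K)) \/ ~~ compatible 16 K.
Proof.
case: (boolP (compatible 16 K)) => [/andP[wK /eqP sK]|]; last by right.
have /andP[wG /eqP sG] := compatible_gram t; left.
rewrite /elt addrAC subrr add0r (@mxZ_mul3 16 16 16 16) ?sG ?sK // !rzM.
by rewrite -!(pair_gram fAB BA) !mulmxA.
Qed.

(** Positive definiteness is used once on each side: X W = G K G = 0 makes the Gram matrix of W^T
    vanish, and W = 0 makes that of X^T K X vanish. *)
Lemma sandwich_eq0 (K : 'M[int]_16) : G *m K *m G = 0 -> elt K = 1%:M.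
Proof.
move=> GKG; pose W := X^T *m rz K *m X *m X^T.
have XW : X *m W = 0.
  by rewrite /W !mulmxA (pair_gram fAB BA) -/G -(mulmxA _ X) (pair_gram fAB BA) -!rzM GKG rz0.
have W0 : W = 0.
  rewrite -[W]trmxK; apply/eqP; rewrite trmx_eq0; apply/eqP/gram_eq0.
  by rewrite trmxK {1}/W !trmx_mul !trmxK -!mulmxA XW !mulmx0.
rewrite /elt; suff -> : X^T *m rz K *m X = 0 by rewrite addr0.
apply: gram_eq0; rewrite !trmx_mul trmxK !mulmxA.
by rewrite -[X^T *m rz K *m X *m X^T]/W W0 !mul0mx.
Qed.

Lemma involK (K : set 'rV[R]_d) (C : 'M[R]_(8, d)) : EE8_frame C K -> invol K *m invol K = 1%:M.
Proof.
move=> fC; rewrite (invol_frame fC) mulmxBl mul1mx mulmxBr mulmx1.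
have [_ CC] := fC; set Y := C^T *m _ *m C.
have -> : Y *m Y = 2 *: Y.
  rewrite /Y !mulmxA -(mulmxA _ C C^T) CC -scalemxAr -!scalemxAl; congr (_ *: _).
  by rewrite -!(mulmxA C^T) -!rzM eicK mul1mx.
by rewrite scaler_nat mulr2n [- (Y + Y)]opprD addrA subrr add0r opprK subrK.
Qed.

Lemma invol_group_card k : order_check t k -> invol_group M N #= `I_(2 * k).
Proof.
move=> /and3P[k0 z0 un].
have [fA fB] := fAB.
set g := compZ (gramZ t) (halfZ 0) (halfZ 8) in z0 un.
have cg : compatible 16 g by exact: compatible_add.
have gE : elt (mxZ 16 16 g) = invol M * invol N.
  by rewrite -elt_M -elt_N; case: (elt_comp (halfZ 0) (halfZ 8)) => //; rewrite compatible_add.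
pose P i := iter i (fun K => compZ (gramZ t) K g) zeros.
have PE i : elt (mxZ 16 16 (P i)) = (invol M * invol N) ^+ i.
  elim: i => [|i IH]; first by rewrite elt_zeros.
  rewrite exprSr -IH -gE -[P i.+1]/(compZ (gramZ t) (P i) g).
  by case: (elt_comp (P i) g) => //; rewrite cg.
have cP i : compatible 16 (P i) by case: i => [//|i]; exact: compatible_add.
have gk : (invol M * invol N) ^+ k = 1.
  rewrite -PE; apply: sandwich_eq0.
  have /andP[wG /eqP sG] := compatible_gram t; have /andP[wK /eqP sK] := cP k.
  by rewrite -(@mxZ_mul3 16 16 16 16) ?sG ?sK // mxZ_zero.
rewrite /invol_group (dihedral_group k0 (involK fA) (involK fB) gk).
have tE : traject (fun K => compZ (gramZ t) K g) zeros k = [seq P i | i <- iota 0 k].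
  by rewrite -(mkseq_nth zeros (traject _ _ _)) size_traject; apply/eq_in_map => i;
    rewrite mem_iota => lti; rewrite nth_traject.
pose els := [seq P i | i <- iota 0 k] ++ [seq compZ (gramZ t) K (halfZ 0) | K <- [seq P i | i <- iota 0 k]].
have cels K : K \in els -> compatible 16 K.
  rewrite mem_cat => /orP[] /mapP[i _ ->]; [exact: cP|exact: compatible_add].
have elsE : dihedral_elements k (invol M * invol N) (invol M) = [seq elt (mxZ 16 16 K) | K <- els].
  rewrite /dihedral_elements map_cat -!map_comp; congr (_ ++ _); apply: eq_map => i /=.
    by rewrite PE.
  rewrite -PE -elt_M; case: (elt_comp (P i) (halfZ 0)) => [->//|].
  by rewrite compatible_add.
rewrite elsE -[(2 * k)%N](_ : size [seq elt (mxZ 16 16 K) | K <- els] = _).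
  apply: (card_uniq_seq 1); apply: (@map_uniq _ _ (fun E => X *m (E - 1%:M) *m X^T)).
  rewrite -map_comp; have -> : [seq ((fun E => X *m (E - 1%:M) *m X^T) \o (fun K => elt (mxZ 16 16 K))) K | K <- els]
      = [seq rz (mxZ 16 16 (sandwich (gramZ t) K)) | K <- els].
    by apply/eq_in_map => K /cels cK /=; case: (elt_sandwich K) => //; rewrite cK.
  move: un; rewrite tE -/els => un.
  rewrite (map_comp (fun K => rz (mxZ 16 16 K)) (sandwich (gramZ t))) map_inj_in_uniq //.
  move=> _ _ /mapP[K _ ->] /mapP[L _ ->] /rz_inj.
  by apply: mxZ_inj; rewrite ?compatible_sandwich.
by rewrite size_map size_cat !size_map size_iota mul2n addnn.
Qed.

End Order.

(** * Smith normal forms *)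

Definition final_index (ty : dih) : nat :=
  match ty with
  | DIH4_12 => 5
  | DIH4_14 => 3
  | DIH4_15 => 1
  | DIH4_16 => 0
  | DIH6_14 => 10
  | DIH6_16 => 9
  | DIH8_15 => 7
  | DIH8_16_DD4 => 4
  | DIH8_16_0 => 11
  | DIH10_16 => 8
  | DIH12_16 => 6
  end.

Definition pairing (ty : dih) : seq (seq Z) := nth [::] finals (final_index ty).

Definition transposeZ (w : nat) (M : seq (seq Z)) : seq (seq Z) :=
  foldr (fun r T => [seq p.1 :: p.2 | p <- zip r T]) (nseq w [::]) M.

Definition entryZ (M : seq (seq Z)) (i j : nat) : Z := nth 0%BZ (nth [::] M i) j.

Definition swap_rows (i j : nat) (M : seq (seq Z)) : seq (seq Z) :=
  set_nth [::] (set_nth [::] M i (nth [::] M j)) j (nth [::] M i).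

Definition reduce_rows (n k : nat) (M : seq (seq Z)) : seq (seq Z) :=
  let r := nth [::] M k in let a := nth 0%BZ r k in
  [seq (if (k < p.1 < n)%N then axpy (Z.opp (Z.div (nth 0%BZ p.2 k) a)) r p.2 else p.2)
     | p <- zip (iota 0 (size M)) M].

Definition pivot (n k : nat) (M : seq (seq Z)) : option (nat * nat * Z) :=
  foldr (fun q best => if Z.eqb q.2 0 then best else
      if best is Some b then if Z.ltb (Z.abs q.2) (Z.abs b.2) then Some q else best else Some q)
    None [seq (i, j, entryZ M i j) | i <- iota k (n - k), j <- iota k (n - k)].

Definition tail_zero (n k : nat) (M : seq (seq Z)) : bool :=
  all (Z.eqb 0) (drop k.+1 (take n (nth [::] M k))).

(* On the block matrix [A, 1; 1, 0] row operations record themselves in the   *)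
(* upper right block and column operations in the lower left one. Nothing is  *)
(* proved about this program: [smith_check] verifies its results.             *)
Fixpoint smith_loop (f n k : nat) (M : seq (seq Z)) : seq (seq Z) :=
  if f is f'.+1 then
    if pivot n k M is Some (i, j, a) then
      let w := n.*2 in
      let M1 := transposeZ w (swap_rows k j (transposeZ w (swap_rows k i M))) in
      let T := reduce_rows n k (transposeZ w (reduce_rows n k M1)) in
      let M2 := transposeZ w T in
      if tail_zero n k M2 && tail_zero n k T then
        if [seq r <- drop k.+1 (take n M2) | ~~ all (fun x => Z.eqb (Z.modulo x a) 0) (take n r)]
          is r :: _ then smith_loop f' n k (set_nth [::] M2 k (axpy 1 r (nth [::] M2 k)))
        else smith_loop f' n k.+1 M2
      else smith_loop f' n k M2
    else M
  else M.

Definition smith (n : nat) (A : seq (seq Z)) : seq (seq Z) * seq (seq Z) :=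
  let one := scalZ n 1 in
  let M := smith_loop 1000 n 0
    ([seq p.1 ++ p.2 | p <- zip A one] ++ [seq r ++ nseq n 0%BZ | r <- one]) in
  ([seq [seq Z.mul (Z.sgn (Z.add (Z.mul 2 (entryZ M i i)) 1)) x | x <- drop n (nth [::] M i)]
      | i <- iota 0 n],
   [seq take n r | r <- drop n M]).

Definition div_cols (s : seq nat) (M : seq (seq Z)) : seq (seq Z) :=
  [seq [seq Z.div p.1 (Z.of_nat p.2) | p <- zip r s] | r <- M].

Definition div_rows (s : seq nat) (M : seq (seq Z)) : seq (seq Z) :=
  [seq [seq Z.div x (Z.of_nat p.2) | x <- p.1] | p <- zip M s].

(** In rank below 16, a Smith form P G Q = D of the degenerate Gram matrix gives the basis: U is the
    top r rows of P, and V, the first r columns of the inverse of P, is G Q with its columns divided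
    by the invariants. The inverses needed for the second Smith form are obtained by the same
    division. *)
Definition smith_ok (ty : dih) : bool :=
  let G := gramZ (pairing ty) in let s := dih_discr ty in let r := size s in
  let UV := if r == 16 then (scalZ 16 1, scalZ 16 1) else
    let PQ := smith 16 G in (take r PQ.1, div_cols s (mulZ 16 G PQ.2)) in
  let Gr := mulZ r (mulZ 16 UV.1 G) (trZ r 16 UV.1) in
  let PQ := smith r Gr in
  smith_check 16 G UV.1 UV.2
    PQ.1 (div_cols s (mulZ r Gr PQ.2)) PQ.2 (div_rows s (mulZ r PQ.1 Gr)) s.

Definition order_ok (ty : dih) : bool := order_check (pairing ty) (dih_order ty)./2.

Lemma smith_okP ty : smith_ok ty.
Proof. by case: ty; vm_cast_no_check (erefl true). Qed.

Lemma order_okP ty : order_ok ty.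
Proof. by case: ty; vm_cast_no_check (erefl true). Qed.

(** * Sublattices with prescribed Gram matrices *)

Section GramModels.
Context {R : realType}.
Local Notation rz := (@rz R _ _).

(** Arbitrary finite index types let orthogonal sums, copies and tensor products be indexed by sum
    and product types. *)
Definition fspan e (I : finType) (b : I -> 'rV[R]_e) : set 'rV[R]_e :=
  [set \sum_i (c i)%:~R *: b i | c in [set: I -> int]].

Definition entry (H : seq (seq Z)) i j : R := (int_of_Z (nth 0%BZ (nth [::] H i) j))%:~R.

(* [K] lies in the span of vectors, indexed through [ix] by [0, ..., n-1],    *)
(* whose Gram matrix is [H]; it equals their span if [ex] holds.              *)
Definition gram_model (ex : bool) e (K : set 'rV[R]_e) (n : nat) (H : seq (seq Z)) : Prop :=
  exists (I : finType) (b : I -> 'rV[R]_e) (ix : I -> nat),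
    [/\ K `<=` fspan b, forall i, (ix i < n)%N,
        forall i j, dot (b i) (b j) = entry H (ix i) (ix j) &
        ex -> fspan b `<=` K /\ forall k, (k < n)%N -> exists i, ix i = k].

Lemma fspanE e (I : finType) (b : I -> 'rV[R]_e) :
  fspan b = zspan (\matrix_(p < #|I|) b (enum_val p)).
Proof.
rewrite eqEsubset; split=> x [c _ <-].
  exists (\row_p c (enum_val p)) => //; rewrite mulmx_sum_row.
  rewrite [RHS](reindex _ (onW_bij _ (enum_val_bij I))) /=.
  by apply: eq_bigr => p _; rewrite !mxE rowK.
exists (fun i => c 0 (enum_rank i)) => //; rewrite mulmx_sum_row.
rewrite (reindex _ (onW_bij _ (enum_val_bij I))) /=.
by apply: eq_bigr => p _; rewrite !mxE rowK enum_valK.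
Qed.

Lemma fspan_mem e (I : finType) (b : I -> 'rV[R]_e) i : fspan b (b i).
Proof.
exists (fun j => (j == i)%:Z) => //; rewrite (bigD1 i) //= eqxx scale1r big1 ?addr0 // => j ji.
by rewrite (negPf ji) scale0r.
Qed.

Lemma gram_model_zspan (ex : bool) e n (K : set 'rV[R]_e) (B : 'M[R]_(n, e)) H :
  K `<=` zspan B -> (ex -> zspan B `<=` K) -> B *m B^T = rz (mxZ n n H) ->
  gram_model ex K n H.
Proof.
move=> KB BK BB.
have fE : fspan (fun i => row i B) = zspan B.
  rewrite eqEsubset; split=> x [c _ <-].
    exists (\row_i c i) => //; rewrite mulmx_sum_row.
    by apply: eq_bigr => i _; rewrite !mxE.
  exists (fun i => c 0 i) => //; rewrite mulmx_sum_row.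
  by apply: eq_bigr => i _; rewrite !mxE.
exists 'I_n, (fun i => row i B), (@nat_of_ord n); rewrite fE; split=> //.
  by move=> i j; rewrite dot_row BB !mxE.
by move=> /BK ?; split=> // k ltk; exists (Ordinal ltk).
Qed.

Definition mulcZ (n : nat) (a : Z) (H : seq (seq Z)) : seq (seq Z) := addZ n n a [::] H.

Lemma gram_model_scale (ex : bool) e n (K : set 'rV[R]_e) H (m : nat) :
  gram_model ex K n H -> gram_model ex (scaleL (Num.sqrt m%:R) K) n (mulcZ n (Z.of_nat m) H).
Proof.
move=> [I [b [ix [KB ixn bb exK]]]].
exists I, (fun i => Num.sqrt m%:R *: b i), ix; split=> //.
- move=> _ [x /KB[c _ <-] <-]; exists c => //; rewrite scaler_sumr.
  by apply: eq_bigr => i _; rewrite !scalerA mulrC.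
- move=> i j; rewrite !dotE' mulrA -expr2 sqr_sqrtr ?ler0n // bb.
  rewrite /entry !nth_mkseq // !nth_nil Z.add_0_l intZM rmorphM; congr (_ * _).
  by rewrite pmulrn; congr (_ %:~R); lia.
- move=> /exK[Kb su]; split=> // x [c _ <-].
  exists (\sum_i (c i)%:~R *: b i); first by apply: Kb; exists c.
  by rewrite scaler_sumr; apply: eq_bigr => i _; rewrite !scalerA mulrC.
Qed.

Definition dsumZ (m n : nat) (G H : seq (seq Z)) : seq (seq Z) :=
  mkseq (fun i => mkseq (fun j =>
    if (i < m)%N then if (j < m)%N then nth 0%BZ (nth [::] G i) j else 0%BZ
    else if (j < m)%N then 0%BZ else nth 0%BZ (nth [::] H (i - m)) (j - m)) (m + n)) (m + n).

Lemma dot_row_mx m n (x x' : 'rV[R]_m) (y y' : 'rV[R]_n) :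
  dot (row_mx x y) (row_mx x' y') = dot x x' + dot y y'.
Proof. by rewrite /dot tr_row_mx mul_row_col mxE. Qed.

Lemma dot0l m (x : 'rV[R]_m) : dot 0 x = 0.
Proof. by rewrite /dot mul0mx mxE. Qed.

Lemma dot0r m (x : 'rV[R]_m) : dot x 0 = 0.
Proof. by rewrite dotC dot0l. Qed.

Lemma gram_model_osum (ex : bool) d e (K : set 'rV[R]_d) (L : set 'rV[R]_e) m n G H :
  gram_model ex K m G -> gram_model ex L n H ->
  gram_model ex (osum K L) (m + n) (dsumZ m n G H).
Proof.
move=> [I [b [ix [Kb ixn bb exK]]]] [J [c [jx [Lc jxn cc exL]]]].
pose bc (k : I + J) := match k with inl i => row_mx (b i) 0 | inr j => row_mx 0 (c j) end.
pose kx (k : I + J) := match k with inl i => ix i | inr j => (m + jx j)%N end.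
have sumE u v : \sum_i (u i)%:~R *: b i = lsubmx (\sum_i (u i)%:~R *: row_mx (b i) (0 : 'rV_e))
   -> row_mx (\sum_i (u i)%:~R *: b i) (\sum_j (v j)%:~R *: c j)
  = \sum_k (match k with inl i => u i | inr j => v j end)%:~R *: bc k.
  move=> _; rewrite big_sumType /=.
  have -> : \sum_i (u i)%:~R *: row_mx (b i) (0 : 'rV_e) = row_mx (\sum_i (u i)%:~R *: b i) 0.
    elim/big_rec2: _ => [|i x y _ ->]; first by rewrite row_mx0.
    by rewrite scale_row_mx scaler0 add_row_mx addr0.
  have -> : \sum_j (v j)%:~R *: row_mx (0 : 'rV_d) (c j) = row_mx 0 (\sum_j (v j)%:~R *: c j).
    elim/big_rec2: _ => [|i x y _ ->]; first by rewrite row_mx0.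
    by rewrite scale_row_mx scaler0 add_row_mx addr0.
  by rewrite add_row_mx addr0 add0r.
have {}sumE u v : row_mx (\sum_i (u i)%:~R *: b i) (\sum_j (v j)%:~R *: c j)
  = \sum_k (match k with inl i => u i | inr j => v j end)%:~R *: bc k.
  apply: sumE; rewrite linear_sum /=; apply: eq_bigr => i _.
  by rewrite linearZ /= row_mxKl.
exists (I + J)%type, bc, kx; split.
- move=> _ [x /Kb[u _ <-] [y /Lc[v _ <-] <-]]; rewrite sumE.
  by exists (fun k => match k with inl i => u i | inr j => v j end).
- by move=> [i|j] /=; rewrite ?ltn_add2l ?jxn // ltn_addr // ixn.
- move=> [i|i] [j|j] /=; rewrite /entry !nth_mkseq ?ltn_add2l ?jxn ?ltn_addr ?ixn //.
  + by rewrite dot_row_mx dot0l addr0 bb.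
  + by rewrite dot_row_mx dot0l dot0r addr0 ltnNge leq_addr.
  + by rewrite dot_row_mx dot0l dot0r addr0 ltnNge leq_addr.
  + by rewrite dot_row_mx dot0l add0r cc !ltnNge !leq_addr /= !addKn.
- move=> xx; have [bK suI] := exK xx; have [cL suJ] := exL xx; split.
    move=> _ [w _ <-].
    exists (\sum_i (w (inl i))%:~R *: b i); first by apply: bK; exists (w \o inl).
    exists (\sum_j (w (inr j))%:~R *: c j); first by apply: cL; exists (w \o inr).
    by rewrite (sumE (w \o inl) (w \o inr)); apply: eq_bigr => -[].
  move=> k ltk; case: (ltnP k m) => [/suI[i <-]|lek]; first by exists (inl i).
  have [|j jE] := suJ (k - m)%N; first by lia.
  by exists (inr j) => /=; rewrite jE subnKC.
Qed.

Definition kronZ (m n : nat) (G H : seq (seq Z)) : seq (seq Z) :=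
  mkseq (fun i => mkseq (fun j =>
    Z.mul (nth 0%BZ (nth [::] G (i %/ n)) (j %/ n)) (nth 0%BZ (nth [::] H (i %% n)) (j %% n)))
    (m * n)) (m * n).

Lemma pure_tensor_sum m n (I J : finType) (u : I -> R) (v : J -> R)
    (b : I -> 'rV[R]_m) (c : J -> 'rV[R]_n) :
  pure_tensor (\sum_i u i *: b i) (\sum_j v j *: c j) =
  \sum_(k : I * J) (u k.1 * v k.2) *: pure_tensor (b k.1) (c k.2).
Proof.
rewrite /pure_tensor [(\sum_i _)^T]linear_sum mulmx_suml linear_sum.
rewrite -(pair_bigA _ (fun i j => (u i * v j) *: mxvec ((b i)^T *m c j))) /=.
apply: eq_bigr => i _; rewrite mulmx_sumr linear_sum; apply: eq_bigr => j _.
by rewrite [(_ *: _)^T]linearZ /= -scalemxAl -scalemxAr scalerA linearZ.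
Qed.

Lemma gram_model_tensor (ex : bool) d e (K : set 'rV[R]_d) (L : set 'rV[R]_e) m n G H :
  gram_model ex K m G -> gram_model ex L n H ->
  gram_model ex (tensorL K L) (m * n) (kronZ m n G H).
Proof.
move=> [I [b [ix [Kb ixn bb exK]]]] [J [c [jx [Lc jxn cc exL]]]].
have n0 (j : J) : (0 < n)%N by apply: leq_ltn_trans (jxn j).
have ltij k : (ix k.1 * n + jx k.2 < m * n)%N.
  have := ixn k.1; have := jxn k.2; move: (ix _) (jx _) => a a'; nia.
exists (I * J)%type, (fun k => pure_tensor (b k.1) (c k.2)), (fun k => ix k.1 * n + jx k.2)%N.
split=> //.
- apply: smallest_sub; first by rewrite fspanE; exact: zspan_int_submod.
  move=> _ [x /Kb[u _ <-] [y /Lc[v _ <-] <-]].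
  exists (fun k => u k.1 * v k.2) => //; rewrite pure_tensor_sum.
  by apply: eq_bigr => k _; rewrite rmorphM.
- move=> [i j] [i' j']; rewrite dot_pure_tensor bb cc /entry !nth_mkseq ?(ltij (_, _)) //=.
  rewrite !divnMDl ?(n0 j) // !modnMDl !(modn_small (jxn _)) !(divn_small (jxn _)) !addn0.
  by rewrite intZM rmorphM.
- move=> xx; have [bK suI] := exK xx; have [cL suJ] := exL xx; split.
    rewrite fspanE; apply: zspan_subset.
      split=> [S [[S0 _] _] //|x y hx hy S SC].
      by have [[_ SB] _] := SC; apply: SB; [exact: hx|exact: hy].
    move=> p; rewrite rowK => S [_ Sp]; apply: Sp.
    exists (b (enum_val p).1); first by apply: bK; exact: fspan_mem.
    by exists (c (enum_val p).2) => //; apply: cL; exact: fspan_mem.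
  move=> k ltk; have n1 : (0 < n)%N by case: (n) ltk => //; rewrite muln0.
  have [|i iE] := suI (k %/ n)%N; first by rewrite ltn_divLR.
  have [|j jE] := suJ (k %% n)%N; first by rewrite ltn_mod.
  by exists (i, j) => /=; rewrite iE jE -divn_eq.
Qed.

Definition copiesZ (k n : nat) (H : seq (seq Z)) : seq (seq Z) :=
  mkseq (fun i => mkseq (fun j =>
    if (i %/ n == j %/ n)%N then nth 0%BZ (nth [::] H (i %% n)) (j %% n) else 0%BZ)
    (k * n)) (k * n).

Lemma gram_model_opow k e (K : set 'rV[R]_e) n H :
  gram_model false K n H -> gram_model false (opow k K) (k * n) (copiesZ k n H).
Proof.
move=> [I [b [ix [Kb ixn bb _]]]].
have ltij (p : 'I_k * I) : (p.1 * n + ix p.2 < k * n)%N.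
  have := ixn p.2; have := ltn_ord p.1; move: (nat_of_ord _) (ix _) => a a'; nia.
exists ('I_k * I)%type, (fun p => pure_tensor (delta_mx 0 p.1) (b p.2)),
  (fun p : 'I_k * I => p.1 * n + ix p.2)%N.
split=> //.
- move=> _ [Y hY <-].
  have /choice[c cP] : forall i, exists c : I -> int, \sum_j (c j)%:~R *: b j = row i Y.
    by move=> i; have [c _ <-] := Kb _ (hY i); exists c.
  exists (fun p => c p.1 p.2) => //.
  have -> : Y = \sum_i (delta_mx 0 i : 'rV[R]_k)^T *m row i Y.
    apply/matrixP => i j; rewrite summxE (bigD1 i) //= big1 => [|l li].
      by rewrite mxE big_ord1 !mxE !eqxx mul1r addr0.
    by rewrite mxE big_ord1 !mxE eqxx [i == l]eq_sym (negPf li) mul0r.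
  rewrite linear_sum -(pair_bigA _ (fun i j => (c i j)%:~R *: pure_tensor (delta_mx 0 i) (b j))) /=.
  apply: eq_bigr => i _; rewrite -cP mulmx_sumr linear_sum; apply: eq_bigr => j _.
  by rewrite -scalemxAr linearZ.
- move=> [i j] [i' j']; rewrite dot_pure_tensor bb /entry !nth_mkseq ?(ltij (_, _)) //=.
  have n0 : (0 < n)%N by apply: leq_ltn_trans (ixn j).
  rewrite !divnMDl // !modnMDl !(modn_small (ixn _)) !(divn_small (ixn _)) !addn0.
  rewrite /dot trmx_delta mul_delta_mx_cond; case: (eqVneq i i') => [->|ne].
    by rewrite eqxx mxE mul1r.
  by rewrite (negPf (ne : nat_of_ord i != i')) mulr0n mxE mul0r.
Qed.

Section Use.
Context (d e n m : nat) (G H W V : seq (seq Z)) (K : set 'rV[R]_e) (X : 'M[R]_(n, d)).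
Hypothesis XX : X *m X^T = rz (mxZ n n G).

Definition sub_check : bool :=
  [&& wide n G, (size G <= n)%N, wide n W, size W == m &
      eqZ m m (mulZ m (mulZ n W G) (trZ m n W)) H].

Let WX : 'M[R]_(m, d) := rz (mxZ m n W) *m X.

Lemma sub_check_gram : sub_check -> forall i j : 'I_m, dot (row i WX) (row j WX) = entry H i j.
Proof.
move=> /and5P[wG sG wW /eqP sW /eqZP e1] i j.
rewrite dot_row /WX trmx_mul mulmxA -(mulmxA _ X) XX -rz_tr -mxZ_tr -!rzM.
rewrite -(@mxZ_mul3 m n n m) ?wide_tr ?size_tr // e1.
by rewrite !mxE.
Qed.

Lemma WX_span i : zspan X (row i WX).
Proof. by rewrite /WX row_mul -rz_row; exact: zspan_mul. Qed.

Lemma gram_model_contains (ex : bool) : gram_model ex K m H -> sub_check -> contains (zspan X) K.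
Proof.
move=> [I [b [ix [Kb ixn bb _]]]] ck.
apply: (@contains_gram _ _ _ _ _ _ (\matrix_(p < #|I|) b (enum_val p))
   (\matrix_(p < #|I|) row (Ordinal (ixn (enum_val p))) WX)).
- by rewrite -fspanE.
- apply: zspan_subset; first exact: zspan_int_submod.
  by move=> p; rewrite rowK; exact: WX_span.
- apply/matrixP => p q; rewrite -!dot_row !rowK bb.
  by rewrite (sub_check_gram ck).
Qed.

(** The rows of W X have Gram matrix H, and V W G = G says that they generate all of the span of
    X. *)
Lemma gram_model_isometric : gram_model true K m H -> sub_check ->
  [&& wide n V, wide n W & size W == m] && eqZ n n (mulZ n (mulZ n V W) G) G ->
  isometric (zspan X) K.
Proof.
move=> [I [b [ix [Kb ixn bb /(_ isT)[bK su]]]]] ck /andP[/and3P[wV wW /eqP sW] /eqZP e1].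
have /and5P[wG sG _ _ _] := ck.
have -> : K = zspan (\matrix_(p < #|I|) b (enum_val p)).
  by rewrite -fspanE eqEsubset.
have -> : zspan X = zspan (\matrix_(p < #|I|) row (Ordinal (ixn (enum_val p))) WX).
  have XV : X = rz (mxZ n m V) *m WX.
    apply/esym/eqP; rewrite -subr_eq0 /WX mulmxA -rzM -{2}[X]mul1mx -mulmxBl; apply/eqP.
    apply: gram_ker; rewrite XX mulmxBl mul1mx -!rzM -rzN -?rzD.
    by rewrite -(@mxZ_mul n m n) ?sW // -(@mxZ_mul n n n) // e1 addrN rz0.
  rewrite eqEsubset; split; last first.
    apply: zspan_subset; first exact: zspan_int_submod.
    by move=> p; rewrite rowK; exact: WX_span.
  apply: subset_trans (zspan_le XV) _; apply: zspan_subset; first exact: zspan_int_submod.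
  move=> i; have [p pi] := su i (ltn_ord i).
  set Y := \matrix_p _; have -> : row i WX = row (enum_rank p) Y; last exact: zspan_row.
  by rewrite rowK; congr row; apply: val_inj; rewrite /= enum_rankK.
apply: isometric_gram; apply/matrixP => p q; rewrite -!dot_row !rowK bb.
by rewrite (sub_check_gram ck).
Qed.

End Use.
End GramModels.

(** * Bases and dual vectors of the root lattices *)

Definition cartanA (n : nat) : seq (seq Z) :=
  mkseq (fun i => mkseq (fun j =>
    if i == j then 2%BZ else if (i == j.+1) || (j == i.+1) then (-1)%BZ else 0%BZ) n) n.

Definition simpleA2 (n : nat) : seq (seq Z) :=
  mkseq (fun i => mkseq (fun j =>
    if j == i then 2%BZ else if j == i.+1 then (-2)%BZ else 0%BZ) n.+1) n.

(** Halved, row i pairs with x to x_0 + ... + x_i, which is the coefficient of the i-th simple root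
    when the coordinates of x add up to 0. *)
Definition weightA2 (n : nat) : seq (seq Z) :=
  mkseq (fun i => mkseq (fun j => if (j <= i)%N then 2%BZ else 0%BZ) n.+1) n.

Definition cartanD (n : nat) : seq (seq Z) :=
  mkseq (fun i => mkseq (fun j =>
    if i == j then 2%BZ
    else if [|| (i == j.+1) && (i < n.-1)%N, (j == i.+1) && (j < n.-1)%N,
                (i == j.+2) && (i == n.-1) | (j == i.+2) && (j == n.-1)]
         then (-1)%BZ else 0%BZ) n) n.

Definition simpleD2 (n : nat) : seq (seq Z) :=
  mkseq (fun i => mkseq (fun j =>
    if (i < n.-1)%N then if j == i then 2%BZ else if j == i.+1 then (-2)%BZ else 0%BZ
    else if (n.-2 <= j)%N then 2%BZ else 0%BZ) n) n.

Definition weightD2 (n : nat) : seq (seq Z) :=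
  mkseq (fun i => mkseq (fun j =>
    if (i < n.-2)%N then if (j <= i)%N then 2%BZ else 0%BZ
    else if (i == n.-2) && (j == n.-1) then (-1)%BZ else 1%BZ) n) n.

(** Given in the simple roots of E_8 and ordered so that the Gram matrix is the leading block of
    [cartan]; likewise for E_6. *)
Definition rootsE7 : seq (seq Z) := (
  [:: [:: 0;0;0;0;0;0;0;1]; [:: 0;0;0;0;0;0;1;0]; [:: 0;0;0;0;0;1;0;0];
      [:: 0;0;0;0;1;0;0;0]; [:: 1;1;2;1;1;0;0;0]; [:: 0;1;0;0;0;0;0;0];
      [:: -2;-4;-5;-2;-4;-3;-2;-1]])%BZ.

Definition weightsE7 : seq (seq Z) := (
  [:: [:: 0;-2;-4;-2;-3;-2;-1;0]; [:: 1;-1;-3;-1;-2;-1;0;0]; [:: 2;0;-2;0;-1;0;0;0];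
      [:: 1;0;-1;0;0;0;0;0]; [:: 2;1;0;1;0;0;0;0]; [:: 1;1;0;1;0;0;0;0];
      [:: 0;0;0;1;0;0;0;0]])%BZ.

Definition rootsE6 : seq (seq Z) := (
  [:: [:: 0;0;0;0;0;0;0;1]; [:: 0;0;0;0;0;0;1;0]; [:: 0;0;0;0;0;1;0;0];
      [:: 0;0;0;0;1;0;0;0]; [:: 1;2;2;1;1;0;0;0]; [:: -2;-4;-5;-2;-4;-3;-2;-1]])%BZ.

Definition weightsE6 : seq (seq Z) := (
  [:: [:: 0;-2;-4;-2;-3;-2;-1;0]; [:: 0;-1;-3;-1;-2;-1;0;0]; [:: 0;0;-2;0;-1;0;0;0];
      [:: 0;0;-1;0;0;0;0;0]; [:: 0;1;0;1;0;0;0;0]; [:: 0;0;0;1;0;0;0;0]])%BZ.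

Definition subcartan (n : nat) : seq (seq Z) := [seq take n r | r <- take n cartan].

(* The vectors of [B2] and [W2] are doubled; the projection onto the common   *)
(* kernel of [P] is [x |-> x W^T B].                                          *)
Definition base_check (m e r : nat) (B2 W2 P H4 H : seq (seq Z)) : bool :=
  [&& all (wide e) [:: B2; W2; P; H4], all (fun a => size a == m) [:: B2; W2],
      all (fun a => size a == r) [:: P; H4],
      eqZ e e (addZ e e 1 (mulZ e (trZ m e W2) B2) (mulZ e (trZ r e P) H4)) (scalZ e 4) &
      eqZ m m (mulZ m B2 (trZ m e B2)) (mulcZ m 4 H)].

Section BaseModels.
Context {R : realType}.
Local Notation rz := (@rz R _ _).

Lemma mulcZE n a H : mxZ n n (mulcZ n a H) = int_of_Z a *: mxZ n n H.
Proof. by rewrite mxZ_add mxZ_zero // add0r. Qed.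

Lemma gram_model_base (ex : bool) m e r (B2 W2 P H4 H : seq (seq Z)) (K : set 'rV[R]_e) :
  base_check m e r B2 W2 P H4 H ->
  (forall x j, K x -> (x *m (2^-1 *: rz (mxZ m e W2))^T) 0 j \is a Num.int) ->
  (forall x, K x -> x *m (rz (mxZ r e P))^T = 0) ->
  (ex -> zspan (2^-1 *: rz (mxZ m e B2)) `<=` K) ->
  gram_model ex K m H.
Proof.
move=> /and5P[/and4P[wB wW wP /andP[wH _]] /and3P[/eqP sB /eqP sW _] /and3P[/eqP sP /eqP sH _]
  /eqZP e1 /eqZP e2] KW KP exK.
apply: (gram_model_zspan _ exK).
  apply: (zspan_dual KW KP (H := 4^-1 *: rz (mxZ r e H4))).
  rewrite [(_ *: _)^T]linearZ /= -scalemxAl -!scalemxAr scalerA -!rz_tr -!rzM -!mxZ_tr.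
  have -> : 2^-1 * 2^-1 = 4^-1 :> R by field.
  rewrite -scalerDr -rzD -(@mxZ_mul e m e) ?sB // -(@mxZ_mul e r e) ?sH //.
  move: e1; rewrite mxZ_add (_ : int_of_Z 1%BZ = 1) // scale1r => ->.
  rewrite mxZ_scal rz_scalar scale_scalar_mx; congr (_%:M).
  by rewrite (_ : int_of_Z 4%BZ = 4) //; field.
rewrite [(_ *: _)^T]linearZ /= -scalemxAl -!scalemxAr scalerA -!rz_tr -!rzM -!mxZ_tr.
rewrite -(@mxZ_mul m e m) ?wide_tr ?size_tr // e2 mulcZE rzZ scalerA.
rewrite [X in X *: _](_ : _ = 1) ?scale1r //.
by rewrite (_ : int_of_Z 4%BZ = 4) //; field.
Qed.

Definition same_parity (w : seq Z) : bool := all (fun a => Z.odd a == Z.odd (head 0%BZ w)) w.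

Lemma oddZ_dvd x : (2 %| int_of_Z x)%Z = ~~ Z.odd x.
Proof.
rewrite Z.negb_odd; apply/idP/idP.
  move=> /dvdzP[q e]; apply/Z.even_spec; exists (Z_of_int q).
  by apply: intZ_inj; rewrite intZM Z_of_intK e mulrC.
by move=> /Z.even_spec[q ->]; rewrite intZM dvdz_mulr.
Qed.

(** Up to even entries w is a constant vector, and a constant vector pairs evenly with z because the
    coordinates of z have an even sum. Thus w / 2 lies in the dual of D_n. *)
Lemma even_pairing n (z : 'rV[int]_n) w : size w = n -> same_parity w ->
  (2 %| \sum_i z 0 i)%Z -> (2 %| \sum_i z 0 i * int_of_Z (nth 0%BZ w i))%Z.
Proof.
move=> sw /allP pw z2.
have -> : \sum_i z 0 i * int_of_Z (nth 0%BZ w i) =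
    \sum_i z 0 i * (int_of_Z (nth 0%BZ w i) - int_of_Z (head 0%BZ w)) +
    (\sum_i z 0 i) * int_of_Z (head 0%BZ w).
  by rewrite mulr_suml -big_split /=; apply: eq_bigr => i _; ring.
rewrite rpredD //; last exact: dvdz_mulr.
apply: rpred_sum => i _; apply: dvdz_mull.
rewrite -intZN -intZD oddZ_dvd Z.odd_add Z.odd_opp.
by rewrite (eqP (pw _ (mem_nth 0%BZ _))) ?sw //; case: (Z.odd _).
Qed.

Lemma half_pairing n m (W2 : seq (seq Z)) (x : 'rV[R]_n) (j : 'I_m) : rootD n x ->
  wide n W2 -> size W2 = m -> all same_parity W2 ->
  (x *m (2^-1 *: rz (mxZ m n W2))^T) 0 j \is a Num.int.
Proof.
move=> /rootDE[z z2 ->] wW sW /allP pW.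
have := @even_pairing n z (nth [::] W2 j) (wide_nth wW _) (pW _ (mem_nth [::] _)) z2.
rewrite sW => /(_ (ltn_ord j) (ltn_ord j)) /dvdzP[q qE].
rewrite linearZ /= -scalemxAr mxE -rz_tr -rzM.
rewrite [X in _ * X](_ : _ = (q * 2)%:~R).
  by rewrite rmorphM /= mulrCA mulVf ?pnatr_eq0 // mulr1 intr_int.
by rewrite mxE -qE; congr (_%:~R); rewrite mxE; apply: eq_bigr => i _; rewrite !mxE.
Qed.

Lemma rootA_D n (x : 'rV[R]_n.+1) : rootA n x -> rootD n.+1 x.
Proof. by move=> [z z0 <-]; exists z => //; rewrite /= z0. Qed.

Lemma rootA_sum n (x : 'rV[R]_n.+1) :
  rootA n x -> x *m (rz (mxZ 1 n.+1 [:: nseq n.+1 1%BZ]))^T = 0.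
Proof.
move=> [z z0 <-]; rewrite -[map_mx intr z]/(rz z) -rz_tr -rzM -[RHS](@rz0 R).
congr rz; apply/matrixP => i j; rewrite !ord1 !mxE -[RHS]z0.
by apply: eq_bigr => k _; rewrite !mxE nth_nseq ltn_ord mulr1.
Qed.

Lemma rootA_model (n : nat) : (n \in [:: 1; 2; 4])%N ->
  gram_model false (rootA n : set 'rV[R]_n.+1) n (cartanA n).
Proof.
move=> hn.
have ck : base_check n n.+1 1 (simpleA2 n) (weightA2 n) [:: nseq n.+1 1%BZ]
    [:: mkseq (fun j => if j == n then 4%BZ else 0%BZ) n.+1] (cartanA n)
  && all same_parity (weightA2 n).
  by move: hn; rewrite !inE => /or3P[] /eqP ->; vm_compute.
have /andP[ck1 pW] := ck.
apply: (gram_model_base ck1) => // [x j /rootA_D Kx|x]; last exact: rootA_sum.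
have /and5P[/and3P[_ wW _] /and3P[_ /eqP sW _] _ _ _] := ck1.
exact: half_pairing.
Qed.

Lemma rootA2_model : gram_model true (rootA 2 : set 'rV[R]_3) 2 (cartanA 2).
Proof.
have ck : base_check 2 3 1 (simpleA2 2) (weightA2 2) [:: nseq 3 1%BZ]
    [:: mkseq (fun j => if j == 2 then 4%BZ else 0%BZ) 3] (cartanA 2).
  by vm_compute.
apply: (gram_model_base ck) => [x j /rootA_D Kx|x|_]; [exact: half_pairing|exact: rootA_sum|].
apply: zspan_subset.
  split=> [|x y [z z0 <-] [w w0 <-]].
    by exists 0; rewrite /= ?map_mx0 //; apply: big1 => i _; rewrite mxE.
  exists (z - w); last by rewrite map_mxB.
  by rewrite /=; under eq_bigr do rewrite !mxE; rewrite big_split /= sumrN z0 w0 subrr.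
move=> i; exists (rowZ 3 (nth [::] [:: [:: 1; -1; 0]; [:: 0; 1; -1]]%BZ i)).
  by rewrite /= !big_ord_recl big_ord0 !mxE; case: i => -[|[|?]] ?.
apply/rowP => j; rewrite !mxE.
rewrite [int_of_Z (nth 0%BZ (nth _ (simpleA2 2) i) j)](_ : _ =
  2 * int_of_Z (nth 0%BZ (nth [::] [:: [:: 1; -1; 0]; [:: 0; 1; -1]]%BZ i) j)).
  by rewrite rmorphM /= mulrA mulVf ?pnatr_eq0 // mul1r.
by case: i => -[|[|?]] ? //; case: j => -[|[|[|?]]] ?.
Qed.

Lemma rootD_model (ex : bool) (n : nat) : (n \in [:: 4; 6])%N ->
  gram_model ex (rootD n : set 'rV[R]_n) n (cartanD n).
Proof.
move=> hn; pose h := [seq [seq Z.div x 2 | x <- r] | r <- simpleD2 n].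
have ck : base_check n n 0 (simpleD2 n) (weightD2 n) [::] [::] (cartanD n)
  && all same_parity (weightD2 n) && (eqZ n n (mulcZ n 2 h) (simpleD2 n)
  && all (fun i => Z.even (dotl (nseq n 1%BZ) (nth [::] h i))) (iota 0 n)).
  by move: hn; rewrite /h !inE => /orP[] /eqP ->; vm_compute.
have /andP[/andP[ck1 pW] /andP[/eqZP eh /allP ev]] := ck.
apply: (gram_model_base ck1) => // [x j Kx|x _|_].
- have /and5P[/and3P[_ wW _] /and3P[_ /eqP sW _] _ _ _] := ck1.
  exact: half_pairing.
- by apply/rowP => -[].
apply: zspan_subset => [|i]; first exact: rootD_submod.
apply/rootDE; exists (row i (mxZ n n h)).
  have := ev i; rewrite mem_iota ltn_ord => /(_ isT); rewrite -Z.negb_odd -oddZ_dvd.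
  rewrite (@dotlE _ _ n) ?size_nseq ?leqnn ?orbT //; congr (_ %| _)%Z.
  by apply: eq_bigr => k _; rewrite !mxE nth_nseq ltn_ord mul1r.
rewrite -eh mulcZE rzZ scalerA (_ : int_of_Z 2 = 2) // mulVf ?pnatr_eq0 // scale1r.
by rewrite rz_row.
Qed.

Lemma rootE8_model : gram_model true (rootE8 : set 'rV[R]_8) 8 cartan.
Proof.
by apply: (gram_model_zspan (B := basisE8)) => [x|_ x|]; rewrite ?rootE8_span ?basisE8_gram.
Qed.

Lemma rootE8_pairing m (Wc : seq (seq Z)) (x : 'rV[R]_8) (j : 'I_m) : rootE8 x ->
  (x *m (2^-1 *: rz (mxZ m 8 (mulZ 8 Wc simple2)))^T) 0 j \is a Num.int.
Proof.
move=> Ex; rewrite (@mxZ_mul m 8 8) // rzM scalemxAr -/basisE8.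
rewrite -dot_row row_id; apply: rootE8_int => //.
by rewrite rootE8_span row_mul -rz_row; exact: zspan_mul.
Qed.

Lemma sum_one8 (x : 'rV[R]_8) : \sum_i x 0 i = 0 ->
  (x *m (rz (mxZ 1 8 [:: nseq 8 1%BZ]))^T) 0 0 = 0.
Proof.
by move=> <-; rewrite mxE; apply: eq_bigr => i _; rewrite !mxE nth_nseq ltn_ord mulr1.
Qed.

Lemma rootE7_model : gram_model false (rootE7 : set 'rV[R]_8) 7 (subcartan 7).
Proof.
have ck : base_check 7 8 1 (mulZ 8 rootsE7 simple2) (mulZ 8 weightsE7 simple2)
    [:: nseq 8 1%BZ] [:: [:: 0;0;0;0;0;0;2;2]%BZ] (subcartan 7) by vm_compute.
apply: (gram_model_base ck) => // [x j [Ex _]|x [_ x0]]; first exact: rootE8_pairing.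
by apply/matrixP => i j; rewrite !ord1 sum_one8 // mxE.
Qed.

Lemma rootE6_model : gram_model false (rootE6 : set 'rV[R]_8) 6 (subcartan 6).
Proof.
have ck : base_check 6 8 2 (mulZ 8 rootsE6 simple2) (mulZ 8 weightsE6 simple2)
    [:: nseq 8 1; [:: 1;0;0;0;0;0;0;1]]%BZ [:: [:: 0;0;0;0;0;0;4;0]; [:: 0;0;0;0;0;0;-4;4]]%BZ
    (subcartan 6) by vm_compute.
apply: (gram_model_base ck) => // [x j [[Ex _] _]|x [[_ x0] x1]]; first exact: rootE8_pairing.
apply/rowP => j; rewrite [RHS]mxE; case: j => -[|[|?]] // lt2.
  rewrite -(sum_one8 x0) !mxE; apply: eq_bigr => i _; by rewrite !mxE.
rewrite mxE !big_ord_recl big_ord0 !mxE /= -[RHS]x1.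
rewrite !mulr0 !mulr1 !add0r !addr0; congr (_ + x _ _); exact: val_inj.
Qed.

End BaseModels.

(** Coefficients, on the 16 generators of L, of vectors with the Gram matrix [sub_gram]. *)
Definition sub_rows (ty : dih) : seq (seq Z) := (
  match ty with
| DIH4_12 => [:: [:: 4;2;-1;-1;-3;-6;-2;2;0;0;0;-1;1;0;-6;0]; [::
-8;-4;2;1;6;10;3;-4;0;0;0;2;-2;0;11;0]; [:: 5;2;-2;-1;-5;-7;-2;2;0;0;0;-1;1;0;-7;0]; [::
0;0;-1;0;0;0;0;0;0;0;0;0;0;0;0;0]; [:: -2;-2;-2;-1;-1;0;-1;-1;0;0;0;1;-1;0;1;0]; [::
-4;-4;-4;-2;-2;0;-1;-2;0;-1;-1;0;-2;-1;3;0]; [:: 10;10;10;5;5;0;2;4;0;2;3;-1;5;2;-6;0]; [::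
0;0;0;0;0;0;0;0;0;0;-1;0;0;0;0;0]; [:: 0;0;0;0;0;0;0;0;0;0;0;0;0;-1;-1;0]; [::
-4;-4;-4;-2;-2;0;-1;-2;0;0;-1;0;-2;0;3;0]; [:: -2;-2;-2;-1;-1;0;0;0;0;0;0;1;-1;-1;1;0]; [::
7;6;5;3;1;-3;0;3;0;0;1;-1;3;1;-6;0]]
| DIH4_14 => [:: [:: 0;-1;-2;-1;-2;-2;-2;-2;-3;-7;-11;-6;-9;-8;-6;-3]; [::
0;0;0;0;0;0;0;0;0;0;1;0;0;0;0;0]; [:: 2;-3;-9;-5;-10;-11;-12;-12;-14;-28;-42;-21;-35;-34;-27;-14];
[:: -2;3;8;4;10;11;12;12;14;28;42;21;35;34;27;14]; [::
2;-4;-10;-5;-12;-14;-15;-16;-18;-36;-54;-27;-45;-44;-35;-18]; [:: 0;0;0;0;0;1;0;0;0;0;0;0;0;0;0;0];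
[:: -2;4;11;5;12;13;15;16;18;36;54;27;45;44;35;18]; [::
2;-3;-9;-4;-10;-11;-11;-12;-14;-28;-42;-21;-35;-34;-27;-14]; [:: 0;0;0;0;0;0;0;0;0;0;0;0;0;0;0;1];
[:: 0;-1;-2;-1;-2;-2;-2;-2;-2;-5;-7;-3;-6;-6;-5;-3]; [:: 0;1;2;1;2;2;2;2;3;6;9;4;8;8;6;3]; [::
0;0;0;0;0;0;0;0;-1;-1;-2;-1;-2;-2;-2;-1]; [:: 0;1;2;1;2;2;2;2;1;2;4;2;4;4;4;2]; [::
0;-2;-4;-2;-4;-4;-4;-4;-2;-5;-8;-4;-7;-8;-6;-3]]
| DIH4_15 => [:: [:: -2;-4;-6;-3;-4;-3;-2;-1;0;0;0;0;0;0;0;0]; [::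
2;3;5;3;4;4;3;2;-2;-4;-6;-3;-5;-4;-3;-1]; [:: -4;-7;-10;-5;-8;-7;-5;-3;4;8;12;6;10;8;6;2]; [::
3;5;7;3;6;5;3;2;-2;-4;-6;-3;-5;-4;-3;-1]; [:: 1;2;3;2;2;1;1;1;-2;-4;-6;-3;-5;-4;-3;-1]; [::
0;0;0;0;0;0;1;0;0;0;0;0;0;0;0;0]; [:: -2;-3;-5;-2;-4;-3;-3;-2;2;4;6;3;5;4;3;1]; [::
1;2;3;1;2;2;2;2;-2;-4;-6;-3;-5;-4;-3;-1]; [:: 0;0;0;0;0;0;0;0;0;0;0;0;0;0;1;1]; [::
0;0;0;0;0;0;0;0;0;1;2;1;2;1;0;0]; [:: 0;0;0;0;0;0;0;0;1;1;1;0;0;0;0;0]; [::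
0;0;0;0;0;0;0;0;0;-1;-1;0;0;0;0;0]; [:: 0;0;0;0;0;0;0;0;-1;-1;-1;0;-1;0;0;0]; [::
0;0;0;0;0;0;0;0;0;0;-1;-1;0;0;0;0]; [:: 0;0;0;0;0;0;0;0;-1;-2;-2;-1;-2;-2;-1;-1]]
| DIH6_14 => [:: [:: 0;0;0;0;0;0;0;0;-1;-2;-3;-2;-2;-2;-1;0]; [:: 0;0;0;0;0;0;0;0;0;0;0;0;-1;0;0;0];
[:: 1;2;0;0;-2;-3;-1;0;4;8;11;7;9;6;3;0]; [:: -1;-1;0;0;1;1;0;0;-3;-6;-9;-5;-7;-5;-3;-1]; [::
1;1;0;0;-1;-1;-1;-1;1;2;3;2;3;2;1;0]; [:: -1;-2;0;0;2;4;3;2;-3;-6;-9;-6;-9;-6;-3;0]; [::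
0;0;0;0;0;-1;0;0;1;2;4;2;3;2;1;0]; [:: 0;0;0;0;0;0;0;0;1;2;2;1;2;2;2;1]; [::
-1;-2;0;0;2;3;1;0;-3;-6;-9;-6;-8;-6;-3;0]; [:: 0;0;0;1;0;0;0;0;1;2;3;1;3;2;1;1]; [::
0;0;0;0;0;0;0;0;0;-1;-1;0;-1;-1;0;0]; [:: 0;0;0;0;0;0;0;0;-1;0;0;0;0;0;0;0]; [::
0;0;0;0;0;0;-1;0;0;0;-1;-1;0;0;0;0]; [:: 0;1;0;-1;-1;-1;1;0;1;2;4;3;2;2;0;-1]]
| DIH6_16 => [:: [:: 0;0;0;0;0;0;0;0;1;2;2;1;1;1;0;0]; [:: 0;0;0;0;0;0;0;0;-1;-2;-2;-1;-1;-1;-1;0];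
[:: 0;0;0;0;0;0;0;0;1;3;4;2;3;2;2;1]; [:: 0;0;0;0;0;0;0;0;-1;-2;-3;-1;-2;-1;-1;-1]; [::
0;0;0;0;0;0;0;0;0;-1;-1;-1;-1;-1;-1;-1]; [:: 0;0;0;0;0;0;0;0;1;1;1;1;1;1;1;1]; [::
0;0;0;0;0;0;0;0;-2;-3;-4;-2;-4;-3;-2;-1]; [:: 0;0;0;0;0;0;0;0;1;2;3;1;3;3;2;1]; [::
1;3;4;2;3;2;1;0;-1;-2;-2;-1;-1;-1;0;0]; [:: -1;-2;-4;-2;-3;-2;-1;0;1;2;2;1;1;1;1;0]; [::
0;-1;-1;0;-1;-1;-1;-1;-1;-3;-4;-2;-3;-2;-2;-1]; [:: -1;-1;-1;-1;-1;-1;0;0;1;2;3;1;2;1;1;1]; [::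
1;2;3;1;2;2;1;1;0;1;1;1;1;1;1;1]; [:: 1;2;3;2;3;2;2;1;-1;-1;-1;-1;-1;-1;-1;-1]; [::
-1;-2;-3;-2;-2;-2;-2;-1;2;3;4;2;4;3;2;1]; [:: -1;-1;-1;0;-1;0;0;0;-1;-2;-3;-1;-3;-3;-2;-1]]
| DIH8_15 => [:: [:: 0;0;0;0;0;0;0;0;0;1;2;1;1;1;1;0]; [:: 0;0;0;0;0;0;0;0;0;1;1;1;1;1;1;1]; [::
-1;-2;-4;-2;-2;-1;0;0;1;2;3;2;2;2;2;1]; [:: 1;4;6;4;4;2;0;0;-2;-4;-6;-4;-4;-4;-4;-2]; [::
0;0;0;0;0;0;0;0;-1;-1;-2;-1;-1;-1;-1;-1]; [:: 0;0;0;0;0;0;0;0;-1;-1;-1;-1;-1;-1;-1;0]; [::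
0;0;0;0;0;1;0;0;0;0;0;0;0;0;0;0]; [:: 1;2;3;3;1;-1;-3;-1;-2;-4;-6;-4;-4;-5;-6;-3]; [::
0;0;0;0;0;0;0;0;-1;-2;-4;-2;-4;-3;-2;-1]; [:: -1;-2;-3;-3;-1;1;3;2;4;8;13;8;10;9;8;4]; [::
0;0;0;0;0;0;0;-1;0;0;0;0;0;0;0;0]; [:: 1;2;4;4;2;0;-2;-1;-3;-6;-9;-6;-6;-6;-6;-3]; [::
0;0;-1;-1;-1;-1;-1;-1;0;0;-1;-1;-1;0;0;0]; [:: 0;0;-1;-1;-1;0;1;1;-1;-2;-2;0;-2;-2;0;0]; [::
-1;-2;-2;-2;0;0;0;0;1;2;3;2;2;3;2;1]]
| DIH8_16_DD4 => [:: [:: -2;-4;-6;-3;-5;-4;-3;-2;0;0;0;0;0;0;0;0]; [::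
2;4;6;3;5;4;2;1;0;0;0;0;0;0;0;0]; [:: 0;-1;-2;-1;-2;-2;-1;0;0;0;0;0;0;0;0;0]; [::
0;0;0;0;0;0;1;0;0;0;0;0;0;0;0;0]; [:: 0;0;0;0;0;0;0;0;1;1;0;0;0;0;0;0]; [::
0;0;0;0;0;0;0;0;-1;-1;-1;0;0;0;0;0]; [:: 0;0;0;0;0;0;0;0;0;-1;-1;-1;-1;0;0;0]; [::
0;0;0;0;0;0;0;0;1;1;2;1;1;0;0;0]; [:: 1;2;3;1;2;1;1;1;1;2;3;1;3;2;1;1]; [::
-2;-4;-5;-2;-4;-3;-2;-1;1;2;3;2;2;2;1;0]; [:: 0;1;1;0;1;1;0;0;-2;-4;-6;-3;-5;-4;-3;-2]; [::
1;0;0;0;0;0;0;0;0;0;0;0;0;0;0;1]; [:: 0;0;-1;0;-1;-1;0;0;2;4;6;3;5;4;3;2]; [::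
0;0;1;0;1;1;1;0;0;0;0;0;0;0;1;0]; [:: 1;2;3;2;2;2;1;1;-1;-2;-3;-2;-2;-2;-2;-1]; [::
0;0;0;0;0;-1;-1;-1;-1;-2;-3;-1;-3;-2;-1;0]]
| DIH10_16 => [:: [:: 0;0;0;0;0;-1;-1;0;0;0;-1;-1;-1;0;0;0]; [::
-1;-1;-2;-1;-1;0;0;0;-1;-1;-1;0;-1;-1;-1;-1]; [:: 0;-1;-1;-1;-1;-1;-1;-1;2;3;4;2;4;3;2;1]; [::
2;4;5;3;4;3;2;1;-2;-4;-5;-3;-4;-3;-2;-1]; [:: 0;-1;-2;-1;-1;0;1;0;1;2;4;2;3;1;0;0]; [::
2;4;7;3;5;3;2;1;1;2;3;1;3;3;3;2]; [:: 0;0;-1;0;-1;0;0;1;-3;-5;-8;-4;-7;-6;-4;-2]; [::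
-3;-5;-7;-4;-6;-5;-3;-2;3;5;7;4;5;4;3;1]; [:: 0;1;2;1;1;0;-1;0;-1;-2;-3;-1;-2;-1;0;0]; [::
-2;-4;-7;-3;-5;-3;-2;-1;0;-1;-2;-1;-2;-2;-2;-1]; [:: 0;0;1;0;1;0;0;-1;1;2;4;2;3;3;2;1]; [::
3;5;7;4;6;5;3;2;-1;-1;-2;-1;-1;-1;-1;0]; [:: 0;0;0;0;0;1;1;0;1;2;3;1;2;1;0;0]; [::
1;1;2;1;1;0;0;0;0;1;2;1;2;2;2;1]; [:: 0;1;1;1;1;1;1;1;-1;-2;-4;-2;-3;-3;-2;-1]; [::
-2;-4;-5;-3;-4;-3;-2;-1;1;1;2;1;1;1;1;0]]
| DIH12_16 => [:: [:: 0;0;0;1;0;0;0;0;0;0;0;0;0;0;0;0]; [:: 0;0;1;0;0;0;0;0;0;0;0;0;0;0;0;0]; [::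
0;0;0;0;0;0;0;0;1;1;0;0;0;0;0;0]; [:: 0;0;0;0;0;0;0;0;0;-1;0;0;0;0;0;0]; [::
-2;-3;-4;-2;-3;-3;-3;-2;1;2;3;1;2;2;2;1]; [:: 3;4;6;3;5;4;3;2;0;0;0;0;1;0;0;0]; [::
-1;0;0;0;0;0;0;0;-1;-2;-3;-1;-3;-2;-1;0]; [:: 0;-2;-4;-2;-4;-3;-2;-1;1;2;3;1;3;2;0;0]; [::
0;0;0;0;0;0;0;0;0;0;0;0;0;0;0;-1]; [:: 0;0;0;0;0;0;0;0;1;2;3;1;2;2;1;1]; [::
0;0;0;0;0;0;0;0;-2;-4;-6;-3;-5;-3;-2;-1]; [:: 0;0;0;0;0;0;0;0;1;2;3;2;2;1;0;0]; [::
0;-1;-2;-1;-2;-1;-1;-1;0;0;0;-1;0;0;0;0]; [:: 0;2;4;2;4;3;2;1;-1;-2;-3;-1;-2;-1;0;0]; [::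
0;0;0;0;0;-1;0;0;0;0;0;0;0;0;0;0]; [:: -1;-2;-2;-1;-1;0;0;1;0;0;0;1;0;-1;0;0]]
  | _ => scalZ 16 1
  end)%BZ.

Definition sub_gram (ty : dih) : nat * seq (seq Z) :=
  let A1 := mulcZ 1 2 (cartanA 1) in
  let A2 := mulcZ 2 2 (cartanA 2) in
  let D4 := mulcZ 4 2 (cartanD 4) in
  let D6 := mulcZ 6 2 (cartanD 6) in
  let E7 := mulcZ 7 2 (subcartan 7) in
  let E8 := mulcZ 8 2 cartan in
  let A2E6 := kronZ 2 6 (cartanA 2) (subcartan 6) in
  match ty with
  | DIH4_12 => (3 * 4, copiesZ 3 4 D4)
  | DIH4_14 => (2 * 1 + 2 * 6, dsumZ (2 * 1) (2 * 6) (copiesZ 2 1 A1) (copiesZ 2 6 D6))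
  | DIH4_15 => (1 + 2 * 7, dsumZ 1 (2 * 7) A1 (copiesZ 2 7 E7))
  | DIH4_16 => (8 + 8, dsumZ 8 8 E8 E8)
  | DIH6_14 => (2 + 2 * 6, dsumZ 2 (2 * 6) A2 A2E6)
  | DIH6_16 => (2 * 8, kronZ 2 8 (cartanA 2) cartan)
  | DIH8_15 => (7 * 1 + 8, dsumZ (7 * 1) 8 (copiesZ 7 1 A1) E8)
  | DIH8_16_DD4 => (2 * 4 + 8, dsumZ (2 * 4) 8 (copiesZ 2 4 D4) E8)
  | DIH8_16_0 => (16, gramZ (pairing DIH8_16_0))
  | DIH10_16 => (4 * 4, kronZ 4 4 (cartanA 4) (cartanA 4))
  | DIH12_16 => (2 + (2 + 2 * 6), dsumZ 2 (2 + 2 * 6) A2 (dsumZ 2 (2 * 6) A2 A2E6))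
  end%N.

Lemma sub_okP ty : sub_check 16 (sub_gram ty).1 (gramZ (pairing ty)) (sub_gram ty).2 (sub_rows ty).
Proof. by case: ty; vm_cast_no_check (erefl true). Qed.

Definition A2E8_coords : seq (seq Z) := (
[:: [:: -1;-1;-1;-1;-1;-1;-1;-1;-1;-1;-1;-1;-1;-1;-1;-1]; [:: 1;1;0;0;0;0;0;0;1;1;0;0;0;0;0;0]; [::
0;0;1;1;1;0;0;0;0;0;1;1;1;0;0;0]; [:: 1;2;3;1;2;2;1;1;1;2;3;1;2;2;1;1]; [::
0;0;0;0;0;1;1;0;0;0;0;0;0;1;1;0]; [:: -1;-2;-3;-2;-2;-2;-1;0;-1;-2;-3;-2;-2;-2;-1;0]; [::
-1;-2;-3;-1;-3;-2;-2;-1;-1;-2;-3;-1;-3;-2;-2;-1]; [:: 1;3;4;2;4;3;2;1;1;3;4;2;4;3;2;1]; [::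
0;0;0;0;1;1;0;0;0;0;0;0;0;0;0;0]; [:: -1;-3;-4;-2;-4;-3;-2;-1;0;0;0;0;0;0;0;0]; [::
1;2;3;1;3;2;2;1;0;0;0;0;0;0;0;0]; [:: 1;2;3;2;2;2;1;0;0;0;0;0;0;0;0;0]; [::
-1;-1;-2;-1;-2;-2;-2;-1;0;0;0;0;0;0;0;0]; [:: 1;1;1;1;1;1;1;1;0;0;0;0;0;0;0;0]; [::
-1;-1;0;0;0;0;0;0;0;0;0;0;0;0;0;0]; [:: 0;0;-1;-1;-1;0;0;0;0;0;0;0;0;0;0;0]])%BZ.

(** The square root of 2 times a basis of the Barnes-Wall lattice, chosen so that this basis has
    exactly the Gram matrix of the generators of the pair. *)
Definition BW_rows : seq (seq Z) := (
[:: [:: 0;0;0;0;0;0;0;0;2;0;0;0;-2;0;0;0]; [:: 0;0;0;0;0;0;0;0;-2;0;0;0;0;0;2;0]; [::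
-1;0;-1;0;-1;0;1;0;1;0;1;0;1;0;-1;0]; [:: 0;0;2;0;2;0;0;0;0;0;0;0;0;0;0;0]; [::
2;0;0;0;0;0;-2;0;0;0;0;0;0;0;0;0]; [:: -2;0;0;0;0;0;0;0;0;0;-2;0;0;0;0;0]; [::
2;0;0;0;0;0;2;0;0;0;0;0;0;0;0;0]; [:: -1;0;1;0;-1;0;-1;0;-1;0;1;0;-1;0;-1;0]; [::
0;-1;1;0;-1;0;0;-1;1;0;0;-1;0;1;1;0]; [:: 0;0;0;0;0;0;0;0;-1;-1;-1;1;1;-1;-1;-1]; [::
0;0;0;0;0;0;0;0;0;2;2;0;0;0;0;0]; [:: 1;0;0;1;1;0;0;1;0;-1;-1;0;0;1;1;0]; [::
-1;0;0;-1;0;-1;1;0;0;-1;-1;0;-1;0;0;1]; [:: 1;0;0;1;0;1;-1;0;1;0;0;-1;0;-1;-1;0]; [::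
0;1;-1;0;-1;0;0;-1;-1;0;0;1;0;1;1;0]; [:: -1;-1;1;-1;1;1;-1;1;0;0;0;0;0;0;0;0]])%BZ.

(* Four times the transposed inverse of [BW_rows]. *)
Definition BW_inv4 : seq (seq Z) := (
[:: [:: 0;2;2;0;-2;0;0;2;2;0;0;2;0;-2;2;0]; [:: 0;4;4;0;-4;0;0;4;2;0;0;2;2;-4;4;2]; [::
0;6;6;0;-6;0;0;6;4;0;0;4;4;-4;4;4]; [:: 0;4;4;0;-2;0;0;2;2;0;0;2;2;-2;2;2]; [::
1;5;5;-1;-5;-1;-1;5;3;1;-1;3;3;-3;3;3]; [:: 0;4;4;0;-4;0;0;4;2;2;-2;2;2;-2;2;2]; [::
1;3;3;-1;-3;1;1;3;1;1;-1;1;1;-1;1;1]; [:: 0;2;2;0;-2;0;0;2;0;0;0;0;0;0;0;0]; [::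
0;-4;0;2;0;0;0;-2;0;0;0;2;0;0;0;2]; [:: 0;-6;0;4;0;0;0;-2;0;0;0;6;0;-2;0;4]; [::
0;-8;0;6;0;0;0;-2;0;2;0;8;0;-2;0;8]; [:: 0;-4;0;4;0;0;0;0;0;0;0;4;0;0;0;4]; [::
0;-6;0;4;0;0;0;-2;0;0;0;6;0;-2;0;8]; [:: 0;-4;0;4;0;2;0;-2;0;0;0;4;0;-2;0;6]; [::
0;-2;0;2;0;2;0;-2;0;0;0;4;0;0;0;4]; [:: 0;-2;0;0;0;2;0;0;0;0;0;2;0;0;0;2]])%BZ.

(** Coordinates of the rows of [BW_rows] modulo 2 in the generators [BW_bits] of the Reed-Muller
    code. *)
Definition BW_codes : seq (seq Z) := (
[:: [:: 0;0;0;0;0]; [:: 0;0;0;0;0]; [:: 1;1;0;0;0]; [:: 0;0;0;0;0]; [:: 0;0;0;0;0]; [:: 0;0;0;0;0];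
[:: 0;0;0;0;0]; [:: 1;1;0;0;0]; [:: 0;1;1;1;1]; [:: 0;0;0;0;1]; [:: 0;0;0;0;0]; [:: 1;1;1;0;1]; [::
1;1;1;1;1]; [:: 1;1;1;1;0]; [:: 0;1;1;1;1]; [:: 1;0;0;0;1]])%BZ.

(** * The Barnes-Wall lattice *)

Definition BW_bits : seq (seq Z) :=
  nseq 16 1%BZ :: mkseq (fun j => mkseq (fun i => if odd (i %/ 2 ^ j) then 1%BZ else 0%BZ) 16) 4.

Definition BW_check : bool :=
  [&& [&& wide 16 BW_rows, wide 16 BW_inv4, wide 16 BW_bits & wide 5 BW_codes],
      [&& size BW_rows == 16, size BW_inv4 == 16, size BW_codes == 16 & all same_parity BW_inv4],
      [&& eqZ 16 16 (mulZ 16 (trZ 16 16 BW_inv4) BW_rows) (scalZ 16 4),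
          eqZ 16 16 (mulZ 16 BW_rows (trZ 16 16 BW_rows)) (mulcZ 16 2 (gramZ (pairing DIH8_16_0))) &
          all (fun w => all (fun g => Z.eqb (Z.modulo (dotl g w) 4%BZ) 0%BZ) BW_bits) BW_inv4],
      all (fun w => Z.eqb (Z.modulo (dotl (nseq 16 1%BZ) w) 4%BZ) 0%BZ) BW_rows &
      all (fun i => all (fun j => Z.even (Z.sub (nth 0%BZ (nth [::] BW_rows i) j)
         (nth 0%BZ (lcomb 16 (nth [::] BW_codes i) BW_bits) j))) (iota 0 16)) (iota 0 16)].

Lemma BW_ok : BW_check.
Proof. by vm_cast_no_check (erefl true). Qed.

Lemma F2_intr (x : int) : (x%:~R == 0 :> 'F_2) = (2 %| x)%Z.
Proof. by rewrite (dvdz_pcharf (pchar_Fp (isT : prime 2))). Qed.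

Section BarnesWall.
Context {R : realType}.
Local Notation rz := (@rz R _ _).

Definition BW_basis : 'M[R]_16 := (Num.sqrt 2)^-1 *: rz (mxZ 16 16 BW_rows).

Lemma BW_bit (k : 'I_4) (i : 'I_16) :
  int_of_Z (nth 0%BZ (nth [::] BW_bits k.+1) i) = odd (i %/ 2 ^ k) :> int.
Proof. by rewrite /= nth_mkseq // nth_mkseq //; case: odd. Qed.

Lemma BW_bit0 (i : 'I_16) : int_of_Z (nth 0%BZ (nth [::] BW_bits 0) i) = 1.
Proof. by rewrite -[nth [::] BW_bits 0]/(nseq 16 1%BZ) nth_nseq ltn_ord. Qed.

Definition BW_ints : set 'rV[int]_16 :=
  [set z | RM14 (map_mx intr z) /\ (4 %| \sum_i z 0 i)%Z].

Lemma RM14_lift (z : 'rV[int]_16) : RM14 (map_mx intr z) ->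
  exists (c : 'rV[int]_5) (w : 'rV[int]_16), z = c *m mxZ 5 16 BW_bits + 2 *: w.
Proof.
move=> [b _ [a _ /rowP e]].
pose c : 'rV[int]_5 := \row_k (if k == 0 :> nat then (b : nat)%:Z else (a 0 (inord k.-1) : nat)%:Z).
have c0 : c 0 ord0 = (b : nat)%:Z by rewrite mxE.
have cS (k : 'I_4) : c 0 (lift ord0 k) = (a 0 k : nat)%:Z.
  rewrite mxE /=; congr (Posz (nat_of_ord (a _ _))); apply: val_inj => /=.
  by rewrite add0n inordK.
clearbody c.
have : forall i, exists w, z 0 i = (c *m mxZ 5 16 BW_bits) 0 i + 2 * w.
  move=> i; have : (2 %| (z 0 i - (c *m mxZ 5 16 BW_bits) 0 i)%R)%Z.
    have zi : (z 0 i)%:~R = b + \sum_(j < 4) a 0 j * (odd (i %/ 2 ^ j))%:R :> 'F_2.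
      by have := e i; rewrite !mxE.
    rewrite -F2_intr rmorphB /= subr_eq0 zi mxE [X in _ == X%:~R]big_ord_recl c0 [mxZ _ _ _ _ _]mxE.
    rewrite [nat_of_ord ord0]/= BW_bit0 mulr1 rmorphD rmorph_sum /=; apply/eqP; congr (_ + _).
      by rewrite -pmulrn natr_Zp.
    apply: eq_bigr => k _; rewrite cS [mxZ _ _ _ _ _]mxE lift0 BW_bit.
    by rewrite rmorphM /= -!pmulrn natr_Zp.
  by move=> /dvdzP[q /eqP]; rewrite subr_eq => /eqP ->; exists q; ring.
move=> /choice[w wE]; exists c, (\row_i w i).
by apply/rowP => i; rewrite wE [RHS]mxE; congr (_ + _); rewrite !mxE.
Qed.

Lemma modZ_dvd x : Z.eqb (Z.modulo x 4%BZ) 0%BZ -> (4 %| int_of_Z x)%Z.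
Proof.
move=> /Z.eqb_eq h; apply/dvdzP; exists (int_of_Z (Z.div x 4%BZ)).
rewrite (_ : 4 = int_of_Z 4%BZ) // -intZM; congr int_of_Z.
by rewrite Z.mul_comm -(Z_div_exact_full_2 x 4%BZ).
Qed.

(** The coordinates of z = c [BW_bits] + 2 w are its pairings with [BW_inv4], divided by 4. The
    first summand pairs to multiples of 4 by computation. The generators of the code have weights
    divisible by 4, so the sum condition on z forces the coordinate sum of w to be even, and w then
    pairs evenly with the rows of [BW_inv4], each of constant parity. *)
Lemma BW16_sub : BW16 `<=` zspan BW_basis.
Proof.
have /and5P[/and4P[wB wI wb _] /and4P[/eqP sB /eqP sI _ /allP pI] /and3P[/eqZP e1 _ /allP h] _ _] := BW_ok.
move=> _ [_ [z [zRM z4] <-] <-].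
have [c [w zE]] := RM14_lift zRM.
have mod4 k g : (g < 5)%N -> (4 %| \sum_(i < 16) int_of_Z (nth 0%BZ (nth [::] BW_bits g) i) *
      int_of_Z (nth 0%BZ (nth [::] BW_inv4 k) i))%Z.
  move=> ltg; case: (ltnP k 16) => ltk; last first.
    rewrite big1 ?dvdz0 // => i _.
    by rewrite [nth [::] BW_inv4 k]nth_default ?sI // nth_nil mulr0.
  have := h (nth [::] BW_inv4 k); rewrite mem_nth ?sI // => /(_ isT)/allP.
  move=> /(_ (nth [::] BW_bits g)); rewrite mem_nth // => /(_ isT)/modZ_dvd.
  by rewrite (@dotlE _ _ 16) // (wide_nth wI) ?sI.
have w2 : (2 %| \sum_i w 0 i)%Z.
  have zs : \sum_i z 0 i = \sum_i (c *m mxZ 5 16 BW_bits) 0 i + 2 * \sum_i w 0 i.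
    rewrite mulr_sumr -big_split /=; apply: eq_bigr => i _.
    by rewrite zE [LHS]mxE; congr (_ + _); rewrite mxE.
  move: z4; rewrite zs rpredDl => [|]; last first.
    under eq_bigr do rewrite mxE.
    rewrite exchange_big rpred_sum //= => g _.
    rewrite -mulr_sumr; apply: dvdz_mull.
    have /allP/(_ (nth [::] BW_bits g)) :
        all (fun g => Z.eqb (Z.modulo (dotl (nseq 16 1%BZ) g) 4%BZ) 0%BZ) BW_bits by vm_compute.
    rewrite mem_nth // => /(_ isT)/modZ_dvd.
    rewrite (@dotlE _ _ 16) ?size_nseq ?orbT //.
    congr (_ %| _)%Z; apply: eq_bigr => i _.
    by rewrite nth_nseq ltn_ord mul1r mxE.
  rewrite (_ : 4 = 2 * 2) // => /dvdzP[q qE]; apply/dvdzP; exists q.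
  by apply: (@mulfI _ 2) => //; rewrite qE; ring.
have /choice[q qE] : forall k : 'I_16, exists q, (z *m (mxZ 16 16 BW_inv4)^T) 0 k = q * 4.
  move=> k; apply/dvdzP; rewrite zE mulmxDl mxE -scalemxAl [(_ *: _ : 'rV_16) _ _]mxE rpredD //.
    rewrite -mulmxA mxE rpred_sum // => g _; rewrite dvdz_mull // mxE.
    under eq_bigr do rewrite !mxE.
    exact: mod4.
  have := @even_pairing 16 w (nth [::] BW_inv4 k) (wide_nth wI _) (pI _ (mem_nth [::] _)) w2.
  rewrite sI => /(_ (ltn_ord k) (ltn_ord k)) /dvdzP[q qE].
  apply/dvdzP; exists q; rewrite mxE; under eq_bigr do rewrite !mxE.
  by rewrite qE; ring.
exists (\row_k q k) => //; rewrite /BW_basis -scalemxAr; congr (_ *: _).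
rewrite -[map_mx intr z]/(rz z) -rzM; congr rz.
have e4 : 4 *: ((\row_k q k) *m mxZ 16 16 BW_rows) = 4 *: z.
  have e : 4 *: (\row_k q k) = z *m (mxZ 16 16 BW_inv4)^T.
    by apply/rowP => k; rewrite qE !mxE mulrC.
  rewrite scalemxAl e -mulmxA -mxZ_tr -(@mxZ_mul 16 16 16) ?sB // e1 mxZ_scal mul_mx_scalar.
  by [].
apply/rowP => i; apply: (@mulfI _ 4) => //.
by move/rowP: e4 => /(_ i); rewrite ![(_ *: _ : 'rV_16) _ _]mxE.
Qed.

Lemma BW16_span : BW16 = zspan BW_basis.
Proof.
rewrite eqEsubset; split; first exact: BW16_sub.
have /and5P[/and4P[wB _ wb wc] /and4P[/eqP sB _ /eqP sc _] _ /allP h4 /allP h2] := BW_ok.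
have {1}-> : BW_basis = (Num.sqrt 2)^-1 *: rz (mxZ 16 16 BW_rows) by [].
rewrite -scaleL_span => _ [x xB <-]; exists x => //.
suff : zspan (rz (mxZ 16 16 BW_rows)) `<=` [set map_mx intr z | z in BW_ints] by apply.
apply: zspan_subset.
  split=> [|_ _ [z [[b _ [a _ zE]] z4] <-] [w [[b' _ [a' _ wE]] w4] <-]].
    exists 0; last by rewrite map_mx0.
    split; last by rewrite big1 // => i _; rewrite mxE.
    exists 0 => //; exists 0 => //; apply/rowP => i; rewrite !mxE add0r big1 // => j _.
    by rewrite mxE mul0r.
  exists (z - w); last by rewrite map_mxB.
  split; last first.
    by under eq_bigr do rewrite !mxE; rewrite big_split /= sumrN rpredB.
  exists (b - b') => //; exists (a - a') => //; rewrite map_mxB -zE -wE.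
  apply/rowP => i; rewrite !mxE opprD addrACA; congr (_ + _); rewrite -sumrB.
  by apply: eq_bigr => j _; rewrite !mxE mulrBl.
move=> i; rewrite -rz_row row_mxZ; exists (rowZ 16 (nth [::] BW_rows i)) => //.
split; last first.
  have := h4 (nth [::] BW_rows i); rewrite mem_nth ?sB // => /(_ isT)/modZ_dvd.
  rewrite (@dotlE _ _ 16) ?size_nseq ?orbT //; congr (_ %| _)%Z.
  by apply: eq_bigr => j _; rewrite nth_nseq ltn_ord mul1r mxE.
pose cd := nth [::] BW_codes i.
exists ((int_of_Z (nth 0%BZ cd 0))%:~R) => //.
exists (\row_j (int_of_Z (nth 0%BZ cd j.+1))%:~R) => //.
apply/rowP => j; rewrite !mxE; apply/eqP; rewrite eq_sym -subr_eq0.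
have := h2 i; rewrite mem_iota ltn_ord => /(_ isT)/allP/(_ j).
rewrite mem_iota ltn_ord => /(_ isT).
rewrite Z.even_sub -Z.negb_odd -Z.negb_odd => ev.
have : (2 %| int_of_Z (nth 0%BZ (nth [::] BW_rows i) j)
          - int_of_Z (nth 0%BZ (lcomb 16 cd BW_bits) j))%Z.
  rewrite -intZN -intZD oddZ_dvd Z.odd_add Z.odd_opp.
  by move: ev; case: (Z.odd _); case: (Z.odd _).
rewrite -F2_intr rmorphB /= (@nth_lcomb 16 _ _ _ 5) // big_ord_recl.
rewrite [nat_of_ord ord0]/= BW_bit0 mulr1 rmorphD rmorph_sum.
congr (_ - (_ + _) == 0); apply: eq_bigr => k _.
by rewrite lift0 BW_bit rmorphM /= !mxE -!pmulrn.
Qed.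

Lemma BW_gram : BW_basis *m BW_basis^T = rz (mxZ 16 16 (gramZ (pairing DIH8_16_0))).
Proof.
have /and5P[/and4P[wB _ _ _] /and4P[/eqP sB _ _ _] /and3P[_ /eqZP e2 _] _ _] := BW_ok.
rewrite /BW_basis scale_gram -rz_tr -rzM -mxZ_tr -(@mxZ_mul 16 16 16) ?wide_tr ?size_tr //.
rewrite e2 mulcZE rzZ scalerA exprVn sqr_sqrtr ?ler0n // (_ : int_of_Z 2 = 2) //.
by rewrite mulVf ?pnatr_eq0 // scale1r.
Qed.

Lemma dih_subP ty d (X : 'M[R]_(16, d)) :
  X *m X^T = rz (mxZ 16 16 (gramZ (pairing ty))) -> dih_sub ty (zspan X).
Proof.
move=> XX.
have A1 := gram_model_scale 2 (@rootA_model R 1 isT).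
have A2 := gram_model_scale 2 (@rootA_model R 2 isT).
have D4 := gram_model_scale 2 (@rootD_model R false 4 isT).
have D6 := gram_model_scale 2 (@rootD_model R false 6 isT).
have E7 := gram_model_scale 2 (@rootE7_model R).
have E8 := gram_model_scale 2 (@rootE8_model R).
have E8f : gram_model false (EE8 : set 'rV[R]_8) 8 (mulcZ 8 2 cartan).
  by apply: (gram_model_zspan (B := basisEE8)); rewrite ?EE8_span // basisEE8_gram mulcZE rzZ.
have A2E6 := gram_model_tensor (@rootA_model R 2 isT) (@rootE6_model R).
have A2E8 := gram_model_tensor (@rootA2_model R) (@rootE8_model R).
case: ty XX => XX.
- exact: (gram_model_contains XX (gram_model_opow 3 D4) (sub_okP DIH4_12)).
- exact: (gram_model_contains XX (gram_model_osum (gram_model_opow 2 A1) (gram_model_opow 2 D6))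
    (sub_okP DIH4_14)).
- exact: (gram_model_contains XX (gram_model_osum A1 (gram_model_opow 2 E7)) (sub_okP DIH4_15)).
- apply: (gram_model_isometric (V := scalZ 16 1) XX (gram_model_osum E8 E8) (sub_okP DIH4_16)).
  by vm_cast_no_check (erefl true).
- exact: (gram_model_contains XX (gram_model_osum A2 A2E6) (sub_okP DIH6_14)).
- apply: (gram_model_isometric (V := A2E8_coords) XX A2E8 (sub_okP DIH6_16)).
  by vm_cast_no_check (erefl true).
- exact: (gram_model_contains XX (gram_model_osum (gram_model_opow 7 A1) E8f) (sub_okP DIH8_15)).
- exact: (gram_model_contains XX (gram_model_osum (gram_model_opow 2 D4) E8f) (sub_okP DIH8_16_DD4)).
- by rewrite /dih_sub BW16_span; apply: isometric_gram; rewrite XX BW_gram.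
- exact: (gram_model_contains XX (gram_model_tensor (@rootA_model R 4 isT) (@rootA_model R 4 isT))
    (sub_okP DIH10_16)).
- exact: (gram_model_contains XX (gram_model_osum A2 (gram_model_osum A2 A2E6)) (sub_okP DIH12_16)).
Qed.

End BarnesWall.

(** * The Leech lattice *)

(* Rows 1 to 11, halved, span the extended Golay code together with the all   *)
(* one vector.                                                                *)
Definition leech_rows : seq (seq Z) := (
[:: [:: -3;1;1;1;1;1;1;1;1;1;1;1;1;1;1;1;1;1;1;1;1;1;1;1]; [::
2;0;0;0;0;0;0;0;0;0;0;0;2;0;2;0;2;2;2;0;0;0;2;2]; [::
0;2;0;0;0;0;0;0;0;0;0;0;2;2;2;2;2;0;0;2;0;0;2;0]; [::
0;0;2;0;0;0;0;0;0;0;0;0;2;2;0;2;0;0;2;0;2;0;2;2]; [::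
0;0;0;2;0;0;0;0;0;0;0;0;2;2;0;0;0;2;2;2;0;2;2;0]; [::
0;0;0;0;2;0;0;0;0;0;0;0;2;2;0;0;2;2;0;2;2;0;0;2]; [::
0;0;0;0;0;2;0;0;0;0;0;0;0;2;2;0;0;2;2;0;2;2;0;2]; [::
0;0;0;0;0;0;2;0;0;0;0;0;0;0;2;2;0;0;2;2;0;2;2;2]; [::
0;0;0;0;0;0;0;2;0;0;0;0;2;0;2;2;0;2;2;2;2;0;0;0]; [::
0;0;0;0;0;0;0;0;2;0;0;0;0;2;0;2;2;0;2;2;2;2;0;0]; [::
0;0;0;0;0;0;0;0;0;2;0;0;0;0;2;0;2;2;0;2;2;2;2;0]; [::
0;0;0;0;0;0;0;0;0;0;2;0;2;0;2;2;2;0;0;0;2;2;0;2]; [::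
0;0;0;0;0;0;0;0;0;0;0;0;4;0;0;0;0;0;0;0;0;0;0;4]; [::
0;0;0;0;0;0;0;0;0;0;0;0;0;4;0;0;0;0;0;0;0;0;0;4]; [::
0;0;0;0;0;0;0;0;0;0;0;0;0;0;4;0;0;0;0;0;0;0;0;4]; [::
0;0;0;0;0;0;0;0;0;0;0;0;0;0;0;4;0;0;0;0;0;0;0;4]; [::
0;0;0;0;0;0;0;0;0;0;0;0;0;0;0;0;4;0;0;0;0;0;0;4]; [::
0;0;0;0;0;0;0;0;0;0;0;0;0;0;0;0;0;4;0;0;0;0;0;4]; [::
0;0;0;0;0;0;0;0;0;0;0;0;0;0;0;0;0;0;4;0;0;0;0;4]; [::
0;0;0;0;0;0;0;0;0;0;0;0;0;0;0;0;0;0;0;4;0;0;0;4]; [::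
0;0;0;0;0;0;0;0;0;0;0;0;0;0;0;0;0;0;0;0;4;0;0;4]; [::
0;0;0;0;0;0;0;0;0;0;0;0;0;0;0;0;0;0;0;0;0;4;0;4]; [::
0;0;0;0;0;0;0;0;0;0;0;0;0;0;0;0;0;0;0;0;0;0;4;4]; [::
0;0;0;0;0;0;0;0;0;0;0;0;0;0;0;0;0;0;0;0;0;0;0;8]])%BZ.

(* Eight times the inverse of [leech_rows]. *)
Definition leech_inv8 : seq (seq Z) := (
[:: [:: 0;4;0;0;0;0;0;0;0;0;0;0;-2;0;-2;0;-2;-2;-2;0;0;0;-2;5]; [::
0;0;4;0;0;0;0;0;0;0;0;0;-2;-2;-2;-2;-2;0;0;-2;0;0;-2;7]; [::
0;0;0;4;0;0;0;0;0;0;0;0;-2;-2;0;-2;0;0;-2;0;-2;0;-2;5]; [::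
0;0;0;0;4;0;0;0;0;0;0;0;-2;-2;0;0;0;-2;-2;-2;0;-2;-2;7]; [::
0;0;0;0;0;4;0;0;0;0;0;0;-2;-2;0;0;-2;-2;0;-2;-2;0;0;5]; [::
0;0;0;0;0;0;4;0;0;0;0;0;0;-2;-2;0;0;-2;-2;0;-2;-2;0;5]; [::
0;0;0;0;0;0;0;4;0;0;0;0;0;0;-2;-2;0;0;-2;-2;0;-2;-2;5]; [::
0;0;0;0;0;0;0;0;4;0;0;0;-2;0;-2;-2;0;-2;-2;-2;-2;0;0;7]; [::
0;0;0;0;0;0;0;0;0;4;0;0;0;-2;0;-2;-2;0;-2;-2;-2;-2;0;7]; [::
0;0;0;0;0;0;0;0;0;0;4;0;0;0;-2;0;-2;-2;0;-2;-2;-2;-2;7]; [::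
0;0;0;0;0;0;0;0;0;0;0;4;-2;0;-2;-2;-2;0;0;0;-2;-2;0;5]; [::
8;12;-4;-4;-4;-4;-4;-4;-4;-4;-4;-4;4;10;4;10;2;2;4;12;12;10;2;-35]; [::
0;0;0;0;0;0;0;0;0;0;0;0;2;0;0;0;0;0;0;0;0;0;0;-1]; [::
0;0;0;0;0;0;0;0;0;0;0;0;0;2;0;0;0;0;0;0;0;0;0;-1]; [::
0;0;0;0;0;0;0;0;0;0;0;0;0;0;2;0;0;0;0;0;0;0;0;-1]; [::
0;0;0;0;0;0;0;0;0;0;0;0;0;0;0;2;0;0;0;0;0;0;0;-1]; [::
0;0;0;0;0;0;0;0;0;0;0;0;0;0;0;0;2;0;0;0;0;0;0;-1]; [::
0;0;0;0;0;0;0;0;0;0;0;0;0;0;0;0;0;2;0;0;0;0;0;-1]; [::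
0;0;0;0;0;0;0;0;0;0;0;0;0;0;0;0;0;0;2;0;0;0;0;-1]; [::
0;0;0;0;0;0;0;0;0;0;0;0;0;0;0;0;0;0;0;2;0;0;0;-1]; [::
0;0;0;0;0;0;0;0;0;0;0;0;0;0;0;0;0;0;0;0;2;0;0;-1]; [::
0;0;0;0;0;0;0;0;0;0;0;0;0;0;0;0;0;0;0;0;0;2;0;-1]; [::
0;0;0;0;0;0;0;0;0;0;0;0;0;0;0;0;0;0;0;0;0;0;2;-1]; [::
0;0;0;0;0;0;0;0;0;0;0;0;0;0;0;0;0;0;0;0;0;0;0;1]])%BZ.

Definition divZ (a : Z) (M : seq (seq Z)) : seq (seq Z) := [seq [seq Z.div x a | x <- r] | r <- M].

Definition leech_gram : seq (seq Z) := divZ 8%BZ (mulZ 24 leech_rows (trZ 24 24 leech_rows)).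

Definition leech_igram : seq (seq Z) := divZ 8%BZ (mulZ 24 (trZ 24 24 leech_inv8) leech_inv8).

(** If this matrix and its transpose add up to G, the quadratic form of G is twice that of the
    triangular matrix, hence even. *)
Definition lower_half (n : nat) (G : seq (seq Z)) : seq (seq Z) :=
  mkseq (fun i => mkseq (fun j => let x := nth 0%BZ (nth [::] G i) j in
    if (j < i)%N then x else if j == i then Z.div x 2%BZ else 0%BZ) n) n.

(** The first row has odd entries and is not halved; modulo 2 it is the all one word. *)
Definition half_rows : seq (seq Z) := head [::] leech_rows :: divZ 2%BZ (behead leech_rows).

Fixpoint all_bits (n : nat) (P : seq Z -> bool) : bool :=
  if n is n'.+1 then all_bits n' (fun l => P (0%BZ :: l)) && all_bits n' (fun l => P (1%BZ :: l))
  else P [::].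

Definition codeword (l : seq Z) : seq bool := [seq Z.odd x | x <- lcomb 24 l (take 12 half_rows)].

Definition golay_check : bool :=
  all_bits 12 (fun l => let n := count id (codeword l) in (n == 0)%N || (8 <= n)%N).

Definition leech_check : bool :=
  [&& [&& wide 24 leech_rows, wide 24 leech_inv8, size leech_rows == 24 & size leech_inv8 == 24],
      eqZ 24 24 (mulZ 24 leech_rows leech_inv8) (scalZ 24 8),
      eqZ 24 24 (mulZ 24 leech_rows (trZ 24 24 leech_rows)) (mulcZ 24 8 leech_gram),
      eqZ 24 24 (mulZ 24 leech_gram leech_igram) (scalZ 24 1) &
      eqZ 24 24 (addZ 24 24 1 (lower_half 24 leech_gram) (trZ 24 24 (lower_half 24 leech_gram)))
        leech_gram] &&
  [&& wide 24 half_rows, size half_rows == 24,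
      all (all Z.even) (drop 12 half_rows),
      eqZ 23 24 (behead leech_rows) (mulZ 24 (scalZ 23 2) (behead half_rows)),
      all (fun r => Z.eqb (Z.modulo (dotl (nseq 24 1%BZ) r) 8%BZ) 0%BZ) (behead leech_rows) &
      all Z.odd (head [::] leech_rows) &&
      Z.eqb (Z.modulo (dotl (nseq 24 1%BZ) (head [::] leech_rows)) 4%BZ) 0%BZ].

Lemma golay_ok : golay_check.
Proof. by vm_cast_no_check (erefl true). Qed.

Lemma leech_ok : leech_check.
Proof. by vm_cast_no_check (erefl true). Qed.

(* Scaled by 1/sqrt 8 these are bases of [M] and [N], inside the Leech        *)
(* lattice spanned by [leech_rows] for all types but [DIH4_15].               *)
Definition model_rows (ty : dih) : seq (seq Z) := (
  match ty with
| DIH4_12 => [:: [:: -2;-2;0;0;0;0;0;0;0;0;0;0;0;-2;0;-2;0;-2;-2;-2;0;0;0;-2]; [::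
0;4;0;0;0;0;0;0;0;0;0;0;0;0;0;0;0;0;4;0;0;0;0;0]; [::
0;0;0;0;0;0;0;0;0;0;0;0;0;0;0;0;0;0;-4;4;0;0;0;0]; [::
0;-4;0;0;0;0;0;0;0;0;0;0;0;0;0;0;0;0;4;0;0;0;0;0]; [::
0;0;0;0;0;0;0;0;0;0;0;0;0;0;0;0;0;0;0;-4;0;0;0;4]; [::
0;0;0;0;0;0;0;0;0;0;0;0;0;0;0;4;0;0;0;0;0;0;0;-4]; [::
0;0;0;0;0;0;0;0;0;0;0;0;0;4;0;-4;0;0;0;0;0;0;0;0]; [::
4;0;0;0;0;0;0;0;0;0;0;0;0;-4;0;0;0;0;0;0;0;0;0;0]; [::
0;0;0;0;0;0;0;0;0;0;0;0;0;0;0;0;4;0;0;0;-4;0;0;0]; [::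
0;0;4;0;0;0;0;0;0;0;0;0;0;0;0;0;-4;0;0;0;0;0;0;0]; [::
0;0;-4;0;0;0;0;0;0;0;0;0;0;0;-4;0;0;0;0;0;0;0;0;0]; [::
0;0;0;0;0;0;0;0;0;0;0;0;0;0;4;0;0;-4;0;0;0;0;0;0]; [::
0;0;0;0;0;0;0;0;0;0;0;0;0;0;4;0;0;4;0;0;0;0;0;0]; [::
2;0;2;0;0;0;0;0;0;0;0;0;0;2;-2;2;2;-2;0;0;2;0;0;0]; [::
0;0;0;0;0;0;0;0;0;0;0;0;0;-4;0;-4;0;0;0;0;0;0;0;0]; [::
-4;0;0;0;0;0;0;0;0;0;0;0;0;4;0;0;0;0;0;0;0;0;0;0]]
| DIH4_14 => [:: [:: 2;-2;0;0;0;0;0;0;0;0;0;0;0;-2;0;-2;0;-2;-2;-2;0;0;0;2]; [::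
-4;4;0;0;0;0;0;0;0;0;0;0;0;0;0;0;0;0;0;0;0;0;0;0]; [::
0;-4;0;0;0;0;0;0;0;0;0;0;0;4;0;0;0;0;0;0;0;0;0;0]; [::
4;4;0;0;0;0;0;0;0;0;0;0;0;0;0;0;0;0;0;0;0;0;0;0]; [::
0;0;0;0;0;0;0;0;0;0;0;0;0;-4;0;4;0;0;0;0;0;0;0;0]; [::
0;0;0;0;0;0;0;0;0;0;0;0;0;0;0;-4;0;4;0;0;0;0;0;0]; [::
0;0;0;0;0;0;0;0;0;0;0;0;0;0;0;0;0;-4;0;4;0;0;0;0]; [::
0;0;0;0;0;0;0;0;0;0;0;0;0;0;0;0;0;0;0;-4;0;0;0;-4]; [::
0;0;0;4;-4;0;0;0;0;0;0;0;0;0;0;0;0;0;0;0;0;0;0;0]; [::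
0;0;0;-4;0;0;0;0;0;0;0;0;0;0;0;0;4;0;0;0;0;0;0;0]; [::
0;0;0;0;0;0;0;0;0;0;0;0;0;0;0;0;-4;0;0;0;-4;0;0;0]; [::
0;0;0;0;0;0;0;0;0;0;0;0;0;0;0;0;0;0;0;0;4;4;0;0]; [::
0;0;0;2;2;0;0;0;0;0;0;0;0;0;0;0;2;0;-2;0;2;-2;-2;-2]; [::
0;0;0;-2;-2;0;0;0;0;0;0;0;0;0;0;0;-2;0;2;0;2;-2;2;2]; [::
0;0;0;2;2;0;0;0;0;0;0;0;0;0;0;0;2;0;2;0;-2;2;-2;2]; [::
0;0;0;0;0;0;0;0;0;0;0;0;0;0;0;0;0;0;-4;0;0;0;4;0]]
| DIH4_15 => [:: [:: 0;0;0;-4;4;0;0;0;0;0;0;0;0;0;0;0;0;0;0;0;0;0;0;0]; [::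
0;0;-4;4;0;0;0;0;0;0;0;0;0;0;0;0;0;0;0;0;0;0;0;0]; [::
0;-4;4;0;0;0;0;0;0;0;0;0;0;0;0;0;0;0;0;0;0;0;0;0]; [::
4;4;0;0;0;0;0;0;0;0;0;0;0;0;0;0;0;0;0;0;0;0;0;0]; [::
-4;4;0;0;0;0;0;0;0;0;0;0;0;0;0;0;0;0;0;0;0;0;0;0]; [::
2;-2;-2;-2;-2;-2;-2;2;0;0;0;0;0;0;0;0;0;0;0;0;0;0;0;0]; [::
0;0;0;0;0;4;4;0;0;0;0;0;0;0;0;0;0;0;0;0;0;0;0;0]; [::
0;0;0;0;0;0;-4;-4;0;0;0;0;0;0;0;0;0;0;0;0;0;0;0;0]; [::
0;0;0;0;0;0;0;0;2;-2;-2;-2;-2;-2;-2;2;0;0;0;0;0;0;0;0]; [::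
0;0;0;0;0;0;0;0;-4;4;0;0;0;0;0;0;0;0;0;0;0;0;0;0]; [::
0;0;0;0;0;0;0;0;0;-4;4;0;0;0;0;0;0;0;0;0;0;0;0;0]; [::
0;0;0;0;0;0;0;0;4;4;0;0;0;0;0;0;0;0;0;0;0;0;0;0]; [::
0;0;0;0;0;0;0;0;0;0;-4;4;0;0;0;0;0;0;0;0;0;0;0;0]; [::
0;0;0;0;0;0;0;0;0;0;0;-4;4;0;0;0;0;0;0;0;0;0;0;0]; [::
0;0;0;0;0;2;-2;0;0;0;0;0;-4;2;2;0;0;0;0;0;0;0;0;0]; [::
0;0;0;0;0;-2;2;0;0;0;0;0;0;-2;-2;-4;0;0;0;0;0;0;0;0]]
| DIH4_16 => [:: [:: 2;-2;0;0;0;0;0;0;0;0;0;0;0;-2;0;-2;0;-2;-2;-2;0;0;0;2]; [::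
-4;4;0;0;0;0;0;0;0;0;0;0;0;0;0;0;0;0;0;0;0;0;0;0]; [::
0;-4;0;0;0;0;0;0;0;0;0;0;0;4;0;0;0;0;0;0;0;0;0;0]; [::
4;4;0;0;0;0;0;0;0;0;0;0;0;0;0;0;0;0;0;0;0;0;0;0]; [::
0;0;0;0;0;0;0;0;0;0;0;0;0;-4;0;4;0;0;0;0;0;0;0;0]; [::
0;0;0;0;0;0;0;0;0;0;0;0;0;0;0;-4;0;4;0;0;0;0;0;0]; [::
0;0;0;0;0;0;0;0;0;0;0;0;0;0;0;0;0;-4;4;0;0;0;0;0]; [::
0;0;0;0;0;0;0;0;0;0;0;0;0;0;0;0;0;0;-4;4;0;0;0;0]; [::
0;0;2;-2;0;-2;0;0;-2;0;0;0;0;0;-2;0;-2;0;0;0;-2;2;0;0]; [::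
0;0;-4;4;0;0;0;0;0;0;0;0;0;0;0;0;0;0;0;0;0;0;0;0]; [::
0;0;0;-4;0;4;0;0;0;0;0;0;0;0;0;0;0;0;0;0;0;0;0;0]; [::
0;0;4;4;0;0;0;0;0;0;0;0;0;0;0;0;0;0;0;0;0;0;0;0]; [::
0;0;0;0;0;-4;0;0;4;0;0;0;0;0;0;0;0;0;0;0;0;0;0;0]; [::
0;0;0;0;0;0;0;0;-4;0;0;0;0;0;4;0;0;0;0;0;0;0;0;0]; [::
0;0;0;0;0;0;0;0;0;0;0;0;0;0;-4;0;4;0;0;0;0;0;0;0]; [::
0;0;0;0;0;0;0;0;0;0;0;0;0;0;0;0;-4;0;0;0;4;0;0;0]]
| DIH6_14 => [:: [:: 0;0;0;0;0;0;0;0;0;0;0;0;0;0;0;-4;0;0;0;-4;0;0;0;0]; [::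
2;2;0;0;0;0;0;0;0;0;0;0;0;-2;0;2;0;2;-2;2;0;0;0;2]; [::
-2;2;0;0;0;0;0;0;0;0;0;0;0;2;0;-2;0;-2;2;2;0;0;0;-2]; [::
2;-2;0;0;0;0;0;0;0;0;0;0;0;-2;0;2;0;-2;-2;-2;0;0;0;-2]; [::
-2;-2;0;0;0;0;0;0;0;0;0;0;0;-2;0;2;0;2;2;-2;0;0;0;2]; [::
0;0;0;0;0;0;0;0;0;0;0;0;0;4;0;0;0;0;-4;0;0;0;0;0]; [::
2;-2;0;0;0;0;0;0;0;0;0;0;0;-2;0;-2;0;2;2;2;0;0;0;-2]; [::
2;2;0;0;0;0;0;0;0;0;0;0;0;2;0;2;0;-2;2;-2;0;0;0;2]; [::
1;1;-1;-1;1;-1;3;-1;-1;-1;1;1;-1;1;1;1;1;1;1;-1;-1;-1;1;-1]; [::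
-1;-1;1;1;-1;-1;-1;1;1;-1;-1;-3;1;-1;1;-1;-1;1;-1;1;1;1;1;-1]; [::
-1;3;-1;-1;-1;1;-1;1;-1;1;1;1;-1;-1;-1;1;1;-1;-1;-1;-1;-1;-1;1]; [::
-1;-3;1;-1;1;-1;1;-1;1;-1;-1;1;1;1;-1;1;-1;-1;1;-1;1;1;-1;-1]; [::
2;-2;0;0;0;0;0;0;0;0;0;0;0;2;0;-2;0;2;2;2;0;0;0;2]; [::
0;0;0;2;2;0;0;0;0;2;0;0;0;0;2;0;0;-2;-2;-2;0;0;0;-2]; [::
0;0;0;0;-2;2;0;-2;0;-2;0;0;0;0;-2;2;0;0;0;2;0;0;2;0]; [::
0;2;0;0;2;-2;0;0;0;0;0;0;0;-2;0;-2;0;0;2;0;0;2;-2;0]]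
| DIH6_16 => [:: [:: -4;0;0;0;0;0;0;0;0;0;0;0;0;4;0;0;0;0;0;0;0;0;0;0]; [::
2;2;0;0;0;0;0;0;0;0;0;0;0;-2;0;-2;0;-2;2;-2;0;0;0;2]; [::
0;0;0;0;0;0;0;0;0;0;0;0;0;0;0;0;0;0;-4;4;0;0;0;0]; [::
0;0;0;0;0;0;0;0;0;0;0;0;0;0;0;0;0;0;0;-4;0;0;0;-4]; [::
0;-4;0;0;0;0;0;0;0;0;0;0;0;0;0;0;0;0;4;0;0;0;0;0]; [::
0;4;0;0;0;0;0;0;0;0;0;0;0;0;0;0;0;4;0;0;0;0;0;0]; [::
2;-2;0;0;0;0;0;0;0;0;0;0;0;2;0;2;0;-2;-2;-2;0;0;0;2]; [::
-2;2;0;0;0;0;0;0;0;0;0;0;0;-2;0;2;0;-2;2;2;0;0;0;-2]; [::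
1;1;-1;-1;1;-3;-1;-1;1;-1;-1;1;1;1;1;1;1;-1;1;1;1;1;1;-1]; [::
1;-1;1;1;-1;1;1;-1;-3;1;-1;1;1;1;-1;-1;-1;1;-1;-1;-1;-1;-1;1]; [::
-1;1;-1;-1;1;1;1;3;1;1;1;-1;1;-1;1;-1;1;1;1;1;1;1;1;-1]; [::
0;-2;0;2;0;0;0;-2;0;-2;0;0;-2;0;-2;0;0;-2;0;0;0;0;2;0]; [::
-1;1;1;-1;-1;-1;-1;-1;1;-1;-1;-1;-1;1;1;1;-1;-1;-1;-1;-1;-3;-1;1]; [::
2;0;0;2;2;0;0;0;0;0;2;2;0;-2;0;0;0;0;0;0;0;2;-2;0]; [::
-1;-1;-1;-1;-3;1;-1;-1;1;1;-1;-1;1;1;-1;1;1;1;-1;1;-1;1;1;-1]; [::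
0;0;2;-2;2;0;0;0;-2;0;0;0;-2;0;0;0;0;0;2;-2;2;0;0;0]]
| DIH8_15 => [:: [:: 2;-2;0;0;0;0;0;0;0;0;0;0;0;2;0;2;0;-2;2;2;0;0;0;2]; [::
2;2;0;0;0;0;0;0;0;0;0;0;0;-2;0;-2;0;-2;-2;-2;0;0;0;-2]; [::
-2;-2;0;0;0;0;0;0;0;0;0;0;0;2;0;2;0;2;-2;-2;0;0;0;2]; [::
-2;2;0;0;0;0;0;0;0;0;0;0;0;2;0;-2;0;-2;2;2;0;0;0;-2]; [::
2;-2;0;0;0;0;0;0;0;0;0;0;0;-2;0;-2;0;2;2;2;0;0;0;-2]; [::
-2;2;0;0;0;0;0;0;0;0;0;0;0;-2;0;2;0;-2;2;-2;0;0;0;2]; [::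
0;0;0;0;0;0;0;0;0;0;0;0;0;0;0;0;0;0;-4;4;0;0;0;0]; [::
2;2;0;0;0;0;0;0;0;0;0;0;0;2;0;2;0;2;2;-2;0;0;0;-2]; [::
0;0;0;4;0;4;0;0;0;0;0;0;0;0;0;0;0;0;0;0;0;0;0;0]; [::
0;0;0;-2;2;-2;0;0;0;0;0;2;0;0;2;2;0;0;0;0;0;-2;0;-2]; [::
0;0;2;0;-2;0;0;0;2;0;-2;-2;2;0;-2;0;0;0;0;0;0;2;0;0]; [::
-2;-2;0;0;0;0;0;0;-2;0;2;0;-2;0;2;-2;0;-2;0;0;0;0;0;0]; [::
2;0;-2;0;0;0;0;0;0;0;2;0;-2;-2;0;0;0;2;0;0;0;-2;0;2]; [::
0;2;0;0;0;0;0;0;-2;0;-2;2;0;2;0;0;0;-2;-2;0;0;2;0;0]; [::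
-1;-1;-1;1;1;-1;-1;-1;1;1;1;-1;1;1;-1;-1;-1;1;3;-1;-1;-1;-1;-1]; [::
0;0;0;-2;0;2;2;2;0;-2;0;0;0;0;0;0;2;0;0;0;2;0;2;0]]
| DIH8_16_DD4 => [:: [:: 2;-2;0;0;0;0;0;0;0;0;0;0;0;2;0;-2;0;-2;-2;-2;0;0;0;-2]; [::
0;4;0;0;0;0;0;0;0;0;0;0;0;0;0;0;0;4;0;0;0;0;0;0]; [::
0;-4;0;0;0;0;0;0;0;0;0;0;0;0;0;0;0;0;0;4;0;0;0;0]; [::
2;2;0;0;0;0;0;0;0;0;0;0;0;-2;0;-2;0;-2;2;-2;0;0;0;2]; [::
-2;2;0;0;0;0;0;0;0;0;0;0;0;2;0;2;0;-2;-2;-2;0;0;0;2]; [::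
-2;-2;0;0;0;0;0;0;0;0;0;0;0;-2;0;-2;0;2;2;-2;0;0;0;-2]; [::
2;2;0;0;0;0;0;0;0;0;0;0;0;2;0;2;0;-2;2;2;0;0;0;-2]; [::
2;-2;0;0;0;0;0;0;0;0;0;0;0;-2;0;2;0;2;-2;-2;0;0;0;2]; [::
0;0;-2;-2;-2;0;-2;0;-2;0;-2;0;0;0;0;0;-2;0;0;0;0;0;-2;0]; [::
0;0;0;2;0;2;2;0;2;2;2;-2;0;0;0;0;0;0;0;0;0;-2;0;0]; [::
0;0;0;-2;0;0;-2;0;0;0;0;2;2;0;2;0;2;0;0;0;0;2;2;0]; [::
1;-1;1;1;-1;-3;1;-1;-1;-1;1;-1;-1;1;-1;1;-1;1;1;-1;1;-1;-1;1]; [::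
-1;1;-1;1;1;-1;1;1;1;-3;-1;-1;-1;-1;-1;-1;-1;-1;-1;1;-1;-1;-1;-1]; [::
0;0;2;0;0;2;0;0;-2;2;0;0;-2;2;0;0;0;0;2;0;0;2;0;0]; [::
1;-1;-1;1;1;-1;-1;-1;1;1;-1;1;1;-1;-1;-1;1;1;-3;-1;1;-1;-1;1]; [::
-2;0;0;-2;0;0;2;0;0;0;0;0;0;-2;0;2;-2;0;2;0;0;0;2;0]]
| DIH8_16_0 => [:: [:: 0;0;0;0;0;0;0;0;0;0;0;0;0;0;0;0;0;4;0;0;0;0;0;4]; [::
0;-4;0;0;0;0;0;0;0;0;0;0;0;0;0;0;0;0;0;0;0;0;0;-4]; [::
0;4;0;0;0;0;0;0;0;0;0;0;0;-4;0;0;0;0;0;0;0;0;0;0]; [::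
-2;-2;0;0;0;0;0;0;0;0;0;0;0;2;0;-2;0;-2;2;2;0;0;0;2]; [::
2;-2;0;0;0;0;0;0;0;0;0;0;0;2;0;2;0;-2;-2;-2;0;0;0;2]; [::
-2;2;0;0;0;0;0;0;0;0;0;0;0;2;0;-2;0;2;2;-2;0;0;0;-2]; [::
0;0;0;0;0;0;0;0;0;0;0;0;0;0;0;4;0;0;0;4;0;0;0;0]; [::
0;0;0;0;0;0;0;0;0;0;0;0;0;0;0;-4;0;0;-4;0;0;0;0;0]; [::
-3;-1;1;1;-1;-1;-1;1;-1;-1;1;-1;1;-1;1;1;-1;1;-1;-1;1;-1;1;1]; [::
0;2;-2;0;0;0;2;0;0;0;0;2;0;2;0;0;0;-2;0;0;-2;0;0;-2]; [::
1;-1;1;-1;-1;1;-1;-1;1;-1;-1;-1;-1;-3;-1;-1;-1;-1;-1;1;1;-1;-1;1]; [::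
0;-2;0;0;2;-2;0;0;0;0;0;0;0;2;0;2;0;0;2;0;0;2;2;0]; [::
-1;1;-1;1;1;1;-1;1;-1;1;1;1;1;1;1;-1;1;3;1;1;1;1;-1;-1]; [::
1;1;1;-1;-1;-1;1;-1;1;1;1;-1;-1;1;1;1;1;-1;-1;-1;-1;-1;1;3]; [::
1;-1;1;1;1;1;1;1;-1;-1;-1;-1;1;-1;-1;1;-1;1;-1;-1;-1;1;-1;-3]; [::
-1;-1;-1;1;-1;-1;-1;1;1;1;-1;1;-1;1;-1;-3;1;-1;1;-1;1;-1;1;1]]
| DIH10_16 => [:: [:: 4;0;0;0;0;0;0;0;0;0;0;0;0;0;0;0;0;4;0;0;0;0;0;0]; [::
-2;-2;0;0;0;0;0;0;0;0;0;0;0;2;0;-2;0;-2;2;-2;0;0;0;-2]; [::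
0;4;0;0;0;0;0;0;0;0;0;0;0;0;0;0;0;0;0;4;0;0;0;0]; [::
0;-4;0;0;0;0;0;0;0;0;0;0;0;0;0;4;0;0;0;0;0;0;0;0]; [::
0;0;0;0;0;0;0;0;0;0;0;0;0;0;0;0;0;0;-4;-4;0;0;0;0]; [::
2;-2;0;0;0;0;0;0;0;0;0;0;0;-2;0;-2;0;-2;2;2;0;0;0;2]; [::
-2;2;0;0;0;0;0;0;0;0;0;0;0;2;0;2;0;2;2;-2;0;0;0;2]; [::
0;0;0;0;0;0;0;0;0;0;0;0;0;-4;0;0;0;0;0;0;0;0;0;-4]; [::
1;1;-1;-1;1;-1;-1;1;-3;-1;1;1;1;-1;-1;1;-1;-1;1;-1;-1;1;1;-1]; [::
0;0;2;0;0;0;0;0;2;2;-2;2;0;2;0;0;0;0;0;0;0;0;-2;2]; [::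
1;-1;1;1;1;-1;1;-1;-1;-1;1;-3;1;-1;1;-1;-1;-1;-1;1;1;-1;1;-1]; [::
1;1;-1;1;-1;1;-1;1;1;-1;1;1;-3;1;1;1;1;1;1;-1;-1;1;-1;-1]; [::
-2;0;-2;-2;-2;0;0;0;0;0;0;2;0;0;-2;0;2;0;-2;0;0;0;0;0]; [::
-1;1;1;1;1;1;1;1;1;1;-1;-1;1;-1;1;1;-1;1;3;1;-1;1;1;-1]; [::
2;-2;-2;0;0;0;-2;-2;0;0;0;0;0;0;0;0;0;0;0;-2;0;-2;0;2]; [::
-2;0;2;0;0;0;0;2;-2;0;0;0;-2;0;0;-2;0;0;0;0;2;2;0;0]]
| DIH12_16 => [:: [:: 2;2;0;0;0;0;0;0;0;0;0;0;0;-2;0;-2;0;-2;2;-2;0;0;0;2]; [::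
-2;-2;0;0;0;0;0;0;0;0;0;0;0;2;0;2;0;-2;-2;-2;0;0;0;-2]; [::
0;4;0;0;0;0;0;0;0;0;0;0;0;0;0;0;0;0;0;4;0;0;0;0]; [::
0;-4;0;0;0;0;0;0;0;0;0;0;0;0;0;0;0;0;0;0;0;0;0;4]; [::
-2;-2;0;0;0;0;0;0;0;0;0;0;0;-2;0;-2;0;2;2;-2;0;0;0;-2]; [::
4;0;0;0;0;0;0;0;0;0;0;0;0;0;0;4;0;0;0;0;0;0;0;0]; [::
0;0;0;0;0;0;0;0;0;0;0;0;0;4;0;-4;0;0;0;0;0;0;0;0]; [::
-2;2;0;0;0;0;0;0;0;0;0;0;0;-2;0;2;0;2;-2;-2;0;0;0;2]; [::
0;0;0;0;4;0;0;0;0;0;-4;0;0;0;0;0;0;0;0;0;0;0;0;0]; [::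
0;0;-4;0;0;0;0;0;0;0;4;0;0;0;0;0;0;0;0;0;0;0;0;0]; [::
-1;1;3;1;-1;1;1;1;1;1;-1;1;1;1;1;1;-1;1;1;-1;-1;-1;1;1]; [::
1;-1;-1;1;-1;1;-1;-1;-1;-1;-1;-1;-1;-1;-1;-1;1;-3;1;1;1;-1;-1;-1]; [::
0;-2;0;-2;0;-2;0;0;-2;0;0;0;0;0;0;0;0;0;-2;2;0;2;0;-2]; [::
1;1;1;1;1;1;-1;-1;1;-1;1;-1;-1;-1;-1;-1;1;3;1;-1;1;-1;-1;1]; [::
1;1;-1;-1;-1;-1;1;1;1;-1;-1;1;1;1;-1;1;-1;-3;-1;-1;-1;1;-1;1]; [::
-2;0;0;0;0;0;-2;0;0;2;0;0;-2;0;2;-2;0;0;0;0;2;0;2;0]]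
  end)%BZ.

Definition model_check (ty : dih) : bool :=
  [&& wide 24 (model_rows ty), size (model_rows ty) == 16 &
      eqZ 16 16 (mulZ 16 (model_rows ty) (trZ 16 24 (model_rows ty)))
        (mulcZ 16 8 (gramZ (pairing ty)))].

Definition in_leech_check (ty : dih) : bool :=
  eqZ 16 24 (mulZ 24 (divZ 8%BZ (mulZ 24 (model_rows ty) leech_inv8)) leech_rows) (model_rows ty).

Lemma model_ok ty : model_check ty.
Proof. by case: ty; vm_cast_no_check (erefl true). Qed.

Lemma in_leech_ok ty : ty <> DIH4_15 -> in_leech_check ty.
Proof. by case: ty => // _; vm_cast_no_check (erefl true). Qed.

Lemma all_bitsP n P l : all_bits n P -> size l = n ->
  P [seq if Z.odd x then 1%BZ else 0%BZ | x <- l].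
Proof.
elim: n P l => [|n IH] P [|a l] //= /andP[h0 h1] [sl].
by case: (Z.odd a); [apply: (IH (fun l => P (1%BZ :: l)))|apply: (IH (fun l => P (0%BZ :: l)))].
Qed.

Section Leech.
Context {R : realType}.
Local Notation rz := (@rz R _ _).

Definition leech_basis : 'M[R]_24 := (Num.sqrt 8)^-1 *: rz (mxZ 24 24 leech_rows).

Definition leech : set 'rV[R]_24 := zspan leech_basis.

Lemma leech_basis_gram : leech_basis *m leech_basis^T = rz (mxZ 24 24 leech_gram).
Proof.
have /andP[/and5P[/and4P[wB _ /eqP sB _] _ /eqZP e2 _ _] _] := leech_ok.
rewrite /leech_basis scale_gram -rz_tr -rzM -mxZ_tr -(@mxZ_mul 24 24 24) ?wide_tr ?size_tr //.
rewrite e2 mulcZE rzZ scalerA exprVn sqr_sqrtr ?ler0n // (_ : int_of_Z 8 = 8) //.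
by rewrite mulVf ?pnatr_eq0 // scale1r.
Qed.

Lemma leech_unimodular : mxZ 24 24 leech_gram *m mxZ 24 24 leech_igram = 1%:M.
Proof.
have /andP[/and5P[_ _ _ /eqZP e _] _] := leech_ok.
by rewrite -(@mxZ_mul 24 24 24) ?e ?mxZ_scal //; vm_cast_no_check (erefl true).
Qed.

Lemma even_form n G (x : 'rV[int]_n) :
  eqZ n n (addZ n n 1 (lower_half n G) (trZ n n (lower_half n G))) G ->
  exists k, (x *m mxZ n n G *m x^T) 0 0 = 2 * k.
Proof.
move=> /eqZP e; exists ((x *m mxZ n n (lower_half n G) *m x^T) 0 0).
rewrite -e mxZ_add (_ : int_of_Z 1%BZ = 1) // scale1r mxZ_tr mulmxDr mulmxDl mxE.
rewrite mulr2n mulrDl !mul1r; congr (_ + _).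
by rewrite -[x *m _^T *m x^T]trmxK mxE !trmx_mul !trmxK mulmxA.
Qed.

Lemma leech_integral x y : leech x -> leech y -> dot x y \is a Num.int.
Proof.
move=> [a _ <-] [b _ <-].
by rewrite dot_mul leech_basis_gram -rz_tr -!rzM mxE intr_int.
Qed.

Lemma leech_rank : has_rank leech 24.
Proof.
exists leech_basis; split=> //; apply/row_freeP.
exists (leech_basis^T *m rz (mxZ 24 24 leech_igram)).
by rewrite mulmxA leech_basis_gram -rzM leech_unimodular rz_scalar.
Qed.

Lemma leech_dual : dual leech = leech.
Proof.
rewrite eqEsubset; split=> x.
  move=> [sx hx]; have [w xw] := real_span_zspan sx.
  have [c xc] : exists c, x *m leech_basis^T = rz c.
    apply: rz_int => i j; rewrite (ord1 i).
    by have := hx _ (zspan_row leech_basis j); rewrite -{1}[x](row_id 0) dot_row.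
  exists (c *m mxZ 24 24 leech_igram) => //; apply/esym/subr0_eq/dot_eq0.
  rewrite {2}xw -mulmxBl /dot trmx_mul mulmxA mulmxBl xc -(mulmxA _ leech_basis).
  rewrite leech_basis_gram -rzM -mulmxA (mulmx1C leech_unimodular) mulmx1 subrr.
  by rewrite mul0mx mxE.
move=> xL; split; last by move=> y; exact: leech_integral.
exists 1%N, x; split; last exact: submx_refl.
by move=> i; rewrite (ord1 i) row_id.
Qed.

Lemma leech_even : even_lattice leech.
Proof.
split; first exact: leech_integral.
have /andP[/and5P[_ _ _ _ ev] _] := leech_ok.
move=> _ [c _ <-]; rewrite dot_mul leech_basis_gram -rz_tr -!rzM mxE.
by have [k ->] := even_form c ev; exists k.
Qed.

Lemma odd_sq (x : int) : ~~ (2 %| x)%Z -> 1 <= x ^+ 2.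
Proof. by move=> h; have : x != 0 by [apply: contraNneq h => ->]; rewrite expr2; nia. Qed.

Lemma count_le (F : 'I_24 -> int) (s : seq bool) : size s = 24 ->
  (forall i : 'I_24, nth false s i -> 1 <= F i) -> (forall i, 0 <= F i) ->
  (count id s)%:Z <= \sum_i F i.
Proof.
move=> ss h F0; rewrite -sumn_count sumnE big_map (big_nth false) ss big_mkord.
rewrite -natz natr_sum; apply: ler_sum => i _.
by case e: (nth false s i) => //=; rewrite ?F0 // h.
Qed.

Section Short.
Variables (c z : 'rV[int]_24).
Hypothesis zc : z = c *m mxZ 24 24 leech_rows.

Lemma leech_coord i : z 0 i = c 0 0 * int_of_Z (nth 0%BZ (head [::] leech_rows) i) +
   2 * \sum_(k < 23) c 0 (lift ord0 k) * int_of_Z (nth 0%BZ (nth [::] half_rows k.+1) i).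
Proof.
have /andP[_ /and5P[wH /eqP sH _ /eqZP e _]] := leech_ok.
rewrite zc mxE big_ord_recl; congr (_ + _); first by rewrite mxE.
rewrite mulr_sumr; apply: eq_bigr => k _; rewrite mxE lift0 mulrCA; congr (_ * _).
have {}e : mxZ 23 24 (behead leech_rows) = 2 *: mxZ 23 24 (behead half_rows).
  rewrite e (@mxZ_mul 23 23 24) ?mxZ_scal ?mul_scalar_mx ?size_behead ?sH //.
by move/matrixP: e => /(_ k i); rewrite !mxE !nth_behead.
Qed.

(** An odd multiple of the first row makes all 24 coordinates odd. *)
Lemma odd_short : ~~ (2 %| c 0%R 0%R)%Z -> 24 <= \sum_i z 0 i ^+ 2.
Proof.
move=> c0; have /andP[_ /and5P[_ _ _ _ /andP[_ /andP[/allP ho _]]]] := leech_ok.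
have {1}-> : (24 : int) = \sum_(i < 24) 1 by rewrite sumr_const card_ord.
apply: ler_sum => i _; apply: odd_sq; rewrite leech_coord rpredDr; last exact: dvdz_mulr.
rewrite dvdzE abszM Euclid_dvdM // -!dvdzE negb_or c0 oddZ_dvd negbK.
by apply: ho; rewrite mem_nth.
Qed.

Hypothesis c0 : (2 %| c 0%R 0%R)%Z.

(** The first row has coordinate sum 20, a multiple of 4, and an even coefficient; the other rows
    have sums divisible by 8. *)
Lemma sum_short : (8 %| (\sum_i z 0 i)%R)%Z.
Proof.
have /andP[/and5P[/and4P[wB _ /eqP sB _] _ _ _ _] /and5P[_ _ _ _ /andP[/allP h8 /andP[_ h4]]]] := leech_ok.
have sumE k : (k < 24)%N -> \sum_(i < 24) int_of_Z (nth 0%BZ (nth [::] leech_rows k) i) =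
    int_of_Z (dotl (nseq 24 1%BZ) (nth [::] leech_rows k)).
  move=> ltk; rewrite (@dotlE _ _ 24) ?size_nseq ?orbT //; apply: eq_bigr => i _.
  by rewrite nth_nseq ltn_ord mul1r.
have -> : \sum_i z 0 i = \sum_k c 0 k * int_of_Z (dotl (nseq 24 1%BZ) (nth [::] leech_rows k)).
  rewrite zc; under eq_bigr do rewrite mxE.
  rewrite exchange_big; apply: eq_bigr => k _; rewrite -sumE // mulr_sumr.
  by apply: eq_bigr => i _; rewrite mxE.
rewrite big_ord_recl rpredD //.
  have /dvdzP[m ->] := c0.
  have /dvdzP[q ->] : (4 %| int_of_Z (dotl (nseq 24 1%BZ) (nth [::] leech_rows (@ord0 23))))%Z.
    exact: modZ_dvd.
  by apply/dvdzP; exists (m * q); ring.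
apply: rpred_sum => k _; apply: dvdz_mull; rewrite lift0.
have := h8 (nth [::] leech_rows k.+1); rewrite -nth_behead mem_nth ?size_behead ?sB //.
move=> /(_ isT)/Z.eqb_eq h; apply/dvdzP.
exists (int_of_Z (Z.div (dotl (nseq 24 1%BZ) (nth [::] (behead leech_rows) k)) 8%BZ)).
rewrite (_ : 8 = int_of_Z 8%BZ) // -intZM; congr int_of_Z.
by rewrite Z.mul_comm -(Z_div_exact_full_2 _ 8%BZ).
Qed.

(** Here z = 2 w with squares of w adding up to 4, so the Golay word of w modulo 2 has weight below
    8 and is zero. Then w = 2 u with squares of u adding up to 1, while divisibility of the sum of z
    by 8 makes the sum of u even, against u^2 = u modulo 2. *)
Lemma even_short : \sum_i z 0 i ^+ 2 <> 16.
Proof.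
move=> z16; have /dvdzP[m mE] := c0.
have /andP[_ /and5P[wH /eqP sH /allP ev _ _]] := leech_ok.
(* For the first row, which [half_rows] leaves unhalved, the coefficient is halved instead. *)
pose c' : 'rV[int]_24 := \row_k (if k == ord0 then m else c 0 k).
pose w := c' *m mxZ 24 24 half_rows.
have zw i : z 0 i = 2 * w 0 i.
  rewrite leech_coord mE /w mxE [in RHS]big_ord_recl [in RHS]mulrDr.
  congr (_ + _); first by rewrite !mxE eqxx mulrA (mulrC m).
  by congr (2 * _); apply: eq_bigr => k _; rewrite !mxE lift0.
have w4 : \sum_i w 0 i ^+ 2 = 4.
  apply: (@mulfI _ 4) => //; rewrite mulr_sumr -[RHS]/(16 : int) -z16.
  by apply: eq_bigr => i _; rewrite zw; ring.
pose l := [seq Z_of_int (c' 0 (inord k)) | k <- iota 0 12].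
pose b := [seq if Z.odd x then 1%BZ else 0%BZ | x <- l].
have wt : wide 24 (take 12 half_rows) by apply/allP => x /mem_take; exact: (allP wH).
have sc : size (codeword b) = 24 by rewrite size_map size_lcomb.
have par (i : 'I_24) : nth false (codeword b) i = ~~ (2 %| w 0%R i)%Z.
  rewrite /codeword (nth_map 0%BZ) ?size_lcomb // -[LHS]negbK -oddZ_dvd; congr (~~ _).
  rewrite (@nth_lcomb 24 _ _ _ 24) ?size_take ?sH //.
  set S := \sum_(_ < _) _.
  have : (2 %| (w 0 i - S)%R)%Z.
    rewrite /w mxE -sumrB rpred_sum // => k _; rewrite [mxZ _ _ _ _ _]mxE.
    case: (ltnP k 12) => ltk.
      rewrite nth_take // -mulrBl dvdz_mulr //.
      rewrite /b (nth_map 0%BZ) ?size_map ?size_iota // (nth_map 0%N) ?size_iota //.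
      rewrite nth_iota // add0n inord_val.
      have := oddZ_dvd (Z_of_int (c' 0 k)); rewrite Z_of_intK.
      case: (Z.odd _) => h; last by rewrite subr0 h.
      by rewrite -[1%BZ]/(1%BZ) (_ : int_of_Z 1 = 1) //; move: (c' 0 k) h => x; lia.
    rewrite [nth 0%BZ b k]nth_default ?size_map ?size_iota // mul0r subr0 dvdz_mull //.
    rewrite oddZ_dvd Z.negb_odd.
    have /allP h : all Z.even (nth [::] half_rows k).
      by apply: ev; rewrite -[nat_of_ord k](subnKC ltk) -nth_drop mem_nth // size_drop sH ltn_sub2r.
    by apply: h; rewrite mem_nth ?(wide_nth wH) ?sH.
  by move=> h; rewrite -[w 0 i](subrK S) rpredDl.
have := all_bitsP golay_ok (_ : size l = 12); rewrite size_map size_iota => /(_ erefl).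
rewrite -/b => /orP[/eqP n0|n8]; last first.
  have : (count id (codeword b))%:Z <= \sum_i w 0 i ^+ 2.
    apply: count_le => // [i|i]; last exact: sqr_ge0.
    by rewrite par; exact: odd_sq.
  by rewrite w4; lia.
have /choice[u uE] : forall i, exists u, w 0 i = u * 2.
  move=> i; apply/dvdzP; apply/negPn; rewrite -par; apply/negP => hi.
  have : has id (codeword b) by apply/(has_nthP false); exists i; rewrite ?sc.
  by rewrite has_count n0.
have u1 : \sum_i u i ^+ 2 = 1.
  apply: (@mulfI _ 4) => //; rewrite mulr1 -[RHS]w4 mulr_sumr.
  by apply: eq_bigr => i _; rewrite uE; ring.
have su : (2 %| \sum_i u i)%Z.
  have : \sum_i z 0 i = 4 * \sum_i u i.
    by rewrite mulr_sumr; apply: eq_bigr => i _; rewrite zw uE; ring.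
  have /dvdzP[q ->] := sum_short; move=> e; apply/dvdzP; exists q.
  by apply: (@mulfI _ 4) => //; rewrite -e; ring.
have : (2 %| \sum_i u i ^+ 2 - \sum_i u i)%Z.
  rewrite -sumrB rpred_sum // => i _.
  rewrite (_ : u i ^+ 2 - u i = u i * (u i - 1)); last by ring.
  by move: (u i) => x; have := divz_eq x 2;
     have := modz_ge0 x (isT : 2 != 0 :> int); have := ltz_mod x (isT : 2 != 0 :> int);
     rewrite dvdzE abszM Euclid_dvdM // -!dvdzE; lia.
by rewrite u1 rpredBr.
Qed.

End Short.

Lemma leech_rootless : rootless leech.
Proof.
move=> _ [c _ <-]; apply/eqP => h.
pose z := c *m mxZ 24 24 leech_rows.
(* The basis is scaled by the inverse square root of 8, so norm 2 means that the squares of the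
   integral coordinates add up to 16. *)
have z16 : \sum_i z 0 i ^+ 2 = 16.
  have : dot (rz z) (rz z) = 16.
    move: h; rewrite /leech_basis -scalemxAr -rzM -/z !dotE' mulrA -expr2 exprVn sqr_sqrtr ?ler0n //.
    by move=> h; apply: (@mulfI _ 8^-1); rewrite ?invr_eq0 ?pnatr_eq0 // h; field.
  rewrite dot_rz; under eq_bigr do rewrite -expr2.
  by rewrite [RHS]pmulrn => /eqP; rewrite eqr_int => /eqP.
case: (boolP (2 %| c 0%R 0%R)%Z) => c0; first exact: (even_short erefl c0 z16).
by have := odd_short (erefl z) c0; rewrite z16.
Qed.

Lemma leechP : is_Leech leech.
Proof.
by split; [exact: leech_rank|exact: leech_even|exact: leech_dual|exact: leech_rootless].
Qed.

Definition model (ty : dih) : 'M[R]_(16, 24) := (Num.sqrt 8)^-1 *: rz (mxZ 16 24 (model_rows ty)).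

Lemma model_gram ty : model ty *m (model ty)^T = rz (mxZ 16 16 (gramZ (pairing ty))).
Proof.
have /and3P[wW _ /eqZP e] := model_ok ty.
rewrite /model scale_gram -rz_tr -rzM -mxZ_tr -(@mxZ_mul 16 24 16) ?wide_tr ?size_tr //.
rewrite e mulcZE rzZ scalerA exprVn sqr_sqrtr ?ler0n // (_ : int_of_Z 8 = 8) //.
by rewrite mulVf ?pnatr_eq0 // scale1r.
Qed.

Lemma model_leech ty : ty <> DIH4_15 -> zspan (model ty) `<=` leech.
Proof.
move=> /in_leech_ok /eqZP e; have /andP[/and5P[/and4P[wB _ /eqP sB _] _ _ _ _] _] := leech_ok.
apply: (@zspan_le _ _ _ _ _ _ (mxZ 16 24 (divZ 8%BZ (mulZ 24 (model_rows ty) leech_inv8)))).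
by rewrite /model /leech_basis -scalemxAr -rzM -(@mxZ_mul 16 24 24) ?sB // e.
Qed.

End Leech.

(** * The type DIH_4(15) *)

Lemma gramZ_block t : (mxZ 16 16 (gramZ t) : 'M_(8 + 8)) =
  block_mx (2 *: ec) (mxZ 8 8 t)^T (mxZ 8 8 t) (2 *: ec).
Proof.
have G i j : mxZ 16 16 (gramZ t) i j = int_of_Z (if (i < 8)%N then
    if (j < 8)%N then Z.mul 2 (nth 0%BZ (nth [::] cartan i) j) else nth 0%BZ (nth [::] t (j - 8)) i
  else if (j < 8)%N then nth 0%BZ (nth [::] t (i - 8)) j
  else Z.mul 2 (nth 0%BZ (nth [::] cartan (i - 8)) (j - 8))) by rewrite mxE !nth_mkseq.
have L (k : 'I_8) : nat_of_ord (lshift 8 k) = k by [].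
have L' (k : 'I_8) : nat_of_ord (rshift 8 k) = (8 + k)%N by [].
apply/matrixP => i j; rewrite G; case: (split_ordP i) => k ->; case: (split_ordP j) => l ->.
- by rewrite !L ?ltn_ord block_mxEul !mxE intZM.
- by rewrite L L' ?ltn_ord ?ltnNge ?leq_addr addKn block_mxEur !mxE.
- by rewrite L L' ?ltn_ord ?ltnNge ?leq_addr addKn block_mxEdl !mxE.
- by rewrite !L' ?ltnNge ?leq_addr !addKn block_mxEdr !mxE intZM.
Qed.

Definition form8 (x y : 'rV[int]_8) : int := (x *m ec *m y^T) 0 0.
Definition pair8 (x w : 'rV[int]_8) : int := (x *m w^T) 0 0.

Lemma pair8C x y : pair8 x y = pair8 y x.
Proof. by rewrite /pair8 -[y in RHS]trmxK -trmx_mul [RHS]mxE. Qed.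

(** For a pairing matrix of rank one the mixed term of the norm factors into a product of two
    pairings. *)
Lemma gramZ_norm t (w v x y : 'rV[int]_8) : mxZ 8 8 t = w^T *m v ->
  (row_mx x y *m (mxZ 16 16 (gramZ t) : 'M_(8 + 8)) *m (row_mx x y)^T) 0 0 =
  2 * (form8 x x + form8 y y + pair8 x v * pair8 y w).
Proof.
move=> e; rewrite gramZ_block mul_row_block tr_row_mx mul_row_col e trmx_mul trmxK.
rewrite !mulmxDl mxE ![(_ + _ : 'M_(1, 1)) 0 0]mxE -!scalemxAr -!scalemxAl.
rewrite ![(_ *: _ : 'M_(1, 1)) 0 0]mxE -/(form8 x x) -/(form8 y y).
have h (a b c e' : 'rV[int]_8) : (a *m (b^T *m c) *m e'^T) 0 0 = pair8 a b * pair8 e' c.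
  rewrite mulmxA -mulmxA mxE big_ord1; congr (_ * _).
  by rewrite -/(pair8 c e') pair8C.
by rewrite !h; ring.
Qed.

Section Root.
Variables (w : 'rV[int]_8).
Hypothesis ww : w *m eic *m w^T = 2%:M.
Let r := w *m eic.

Lemma pair8_root x : pair8 x w = form8 x r.
Proof. by rewrite /pair8 /form8 /r trmx_mul eicT !mulmxA -(mulmxA x) ecK mulmx1. Qed.

Lemma form8_root : form8 r r = 2.
Proof. by rewrite -pair8_root /pair8 ww mxE. Qed.

Lemma form8_shift x k : form8 (x - k *: r) (x - k *: r) = form8 x x - 2 * k * pair8 x w + 2 * k ^+ 2.
Proof.
have sym : form8 r x = form8 x r.
  by rewrite /form8 -[r *m ec *m _]trmxK mxE !trmx_mul trmxK ecT mulmxA.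
rewrite pair8_root {1}/form8 [(_ - _)^T]linearB /= [(_ *: _)^T]linearZ /= !mulmxBl !mulmxBr.
rewrite -!scalemxAl -!scalemxAr.
transitivity (form8 x x - k * form8 x r - (k * form8 r x - k * (k * form8 r r))).
  by rewrite /form8; do 3 rewrite ?mxE /=; rewrite /form8; ring.
by rewrite sym form8_root; ring.
Qed.
End Root.

Section E8min.
Context {R : realType}.
Local Notation rz := (@rz R _ _).

Lemma form8_min x : x != 0 -> 2 <= form8 x x.
Proof.
move=> x0; have [k kE] := @even_form 8 cartan x isT.
have q : dot (rz x *m basisE8) (rz x *m basisE8) = (form8 x x)%:~R :> R.
  by rewrite dot_mul basisE8_gram -rz_tr -!rzM mxE.
have := dot_ge0 (rz x *m basisE8); rewrite q ler0z.
have : form8 x x != 0.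
  apply: contra x0 => /eqP f0; move: q; rewrite f0 => /dot_eq0 xB.
  apply/eqP/(@rz_inj R); rewrite rz0 -[LHS]mulmx1 -(@rz_scalar R 8 1) -ecK rzM -basisE8_gram.
  by rewrite !mulmxA xB !mul0mx.
by rewrite /form8 -/ec in kE *; rewrite kE; lia.
Qed.

(** With r the root of w and pairing 2k + 1, the vector x - k r still pairs to 1 with r. It is
    therefore nonzero and has norm at least 2. *)
Lemma odd_norm w x : w *m eic *m w^T = 2%:M -> ~~ (2 %| pair8 x w)%Z ->
  exists k, pair8 x w = 2 * k + 1 /\ 2 + 2 * k + 2 * k ^+ 2 <= form8 x x.
Proof.
move=> ww h; exists (pair8 x w %/ 2)%Z; set k := (_ %/ 2)%Z.
have e : pair8 x w = 2 * k + 1.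
  have := divz_eq (pair8 x w) 2; have := modz_ge0 (pair8 x w) (isT : 2 != 0 :> int).
  have := ltz_mod (pair8 x w) (isT : 2 != 0 :> int); move: h; rewrite -/k.
  by move=> /dvdz_mod0P; lia.
split=> //; have := form8_shift ww x k; rewrite e => s.
have : 2 <= form8 (x - k *: (w *m eic)) (x - k *: (w *m eic)).
  apply: form8_min; apply/eqP => x0; move: e.
  have -> : pair8 x w = 2 * k.
    rewrite -[x](subrK (k *: (w *m eic))) x0 add0r.
    by rewrite /pair8 -scalemxAl ww mxE mxE eqxx mulr1n mulrC.
  by lia.
by rewrite s; nia.
Qed.

End E8min.

Definition dih415_left : seq Z := [:: 0; 0; 0; 0; 0; 0; 1; -1]%BZ.
Definition dih415_right : seq Z := [:: 0; 0; 0; 0; 0; 0; 0; 1]%BZ.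

Lemma dih415_pairing :
  mxZ 8 8 (pairing DIH4_15) = (rowZ 8 dih415_left)^T *m rowZ 8 dih415_right.
Proof.
have e a : rowZ 8 a = mxZ 1 8 [:: a] by apply/rowP => j; rewrite !mxE.
rewrite !e -mxZ_tr -(@mxZ_mul 8 1 8) //; apply/eqZP; vm_cast_no_check (erefl true).
Qed.

Lemma dih415_root a : a \in [:: dih415_left; dih415_right] ->
  rowZ 8 a *m eic *m (rowZ 8 a)^T = 2%:M.
Proof.
have e b : rowZ 8 b = mxZ 1 8 [:: b] by apply/rowP => j; rewrite !mxE.
move=> ha; rewrite !e -mxZ_tr -(@mxZ_mul3 1 8 8 1) ?wide_tr ?size_tr //.
rewrite -(@mxZ_scal 1 2%BZ); apply/eqZP.
by move: ha; rewrite !inE => /orP[] /eqP ->; vm_compute.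
Qed.

(** For a root, the E_8 norms of x and y and the product of their pairings with the two roots would
    add up to 1. The norms are even, so both pairings are odd, say 2k + 1 and 2l + 1; the bounds of
    [odd_norm] then make the sum at least 3 + 2 (k + l + 1)^2. *)
Lemma dih415_rootless (R : realType) d (X : 'M[R]_(16, d)) :
  X *m X^T = rz (mxZ 16 16 (gramZ (pairing DIH4_15))) -> rootless (zspan X).
Proof.
move=> XX _ [c _ <-]; rewrite dot_mul XX -rz_tr -!rzM mxE.
rewrite -[c](@hsubmxK _ 1 8 8) (gramZ_norm _ _ dih415_pairing).
set x := lsubmx _; set y := rsubmx _.
rewrite [X in _ != X]pmulrn eqr_int; apply/eqP => h.
have oL := dih415_root (mem_head _ _); have oR := dih415_root (mem_last dih415_left [:: dih415_right]).
have ex := @even_form 8 cartan x isT; have ey := @even_form 8 cartan y isT.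
have [kx qx] := ex; have [ky qy] := ey.
have : ~~ (2 %| pair8 x (rowZ 8 dih415_right) * pair8 y (rowZ 8 dih415_left))%Z.
  by move: h; rewrite /form8 qx qy; lia.
rewrite dvdzE abszM Euclid_dvdM // -!dvdzE negb_or => /andP[hx hy].
have [k [kE kn]] := odd_norm (R := R) oR hx; have [l [lE ln]] := odd_norm (R := R) oL hy.
move: h kn ln (sqr_ge0 (k + l + 1)); rewrite kE lE !expr2; nia.
Qed.

Section Unimodular.
Context {R : realType}.
Local Notation rz := (@rz R _ _).

(** The dual basis, given by the transposed inverse of F, lies in the dual lattice and hence in K;
    its integral coordinates U invert the Gram matrix. *)
Lemma unimodular_gram n (K : set 'rV[R]_n) (F : 'M[R]_n) : int_basis F K -> integral K ->
  dual K = K -> exists H U, F *m F^T = rz H /\ U *m H = 1%:M.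
Proof.
move=> [freeF KE] Kint Kdual.
have {}KE : K = zspan F by [].
have uF : F \in unitmx by rewrite -row_free_unit.
have [H FF] : exists H, F *m F^T = rz H.
  by apply: rz_int => i j; rewrite -dot_row; apply: Kint; rewrite KE; exact: zspan_row.
have WF : (invmx F)^T *m F^T = 1%:M by rewrite -trmx_mul mulmxV // trmx1.
have [U WE] : exists U, (invmx F)^T = rz U *m F.
  apply: zspan_rows => i; rewrite -KE -Kdual; split.
    exists n, F; split; first by move=> j; rewrite KE; exact: zspan_row.
    by apply: submx_full; rewrite row_full_unit.
  move=> y; rewrite KE => -[c _ <-].
  rewrite rowE dot_mul WF mulmx1 -(@rz_delta R) -rz_tr -rzM mxE; exact: intr_int.
exists H, U; split=> //; apply: (@rz_inj R).
by rewrite rzM -FF mulmxA -WE WF rz_scalar.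
Qed.
End Unimodular.

(* Sylvester's inequality over the field with two elements. *)
Lemma even_combination m n k (c : 'M[int]_(m, n)) (H U : 'M_n) (S : 'M_m)
    (P : 'M_(m, k)) (Q : 'M_(k, m)) (z : 'rV['F_2]_m) :
  U *m H = 1%:M -> c *m H *m c^T = 2 *: S + P *m Q -> (n + k + 2 < 2 * m)%N ->
  exists (e : 'rV[int]_m) (g : 'rV[int]_n),
    e *m c = 2 *: g /\ ~~ ((map_mx intr e : 'rV['F_2]_m) <= z)%MS.
Proof.
move=> UH cc lt; pose red p q (a : 'M[int]_(p, q)) : 'M['F_2]_(p, q) := map_mx intr a.
have two : red _ _ (2 *: S) = 0.
  by apply/matrixP => i j; rewrite !mxE; apply/eqP; rewrite F2_intr dvdz_mulr.
have rH : row_free (red _ _ H).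
  have UH2 : red _ _ U *m red _ _ H = 1%:M by rewrite /red -map_mxM UH map_mx1.
  by rewrite row_free_unit; case: (mulmx1_unit UH2).
have rk : (\rank (red _ _ c *m red _ _ H *m (red _ _ c)^T) <= k)%N.
  rewrite /red map_trmx -!map_mxM cc map_mxD [X in X + _]two add0r map_mxM.
  by apply: leq_trans (mxrankM_maxl _ _) (rank_leq_col _).
(* Modulo 2 the product has rank at most k, and H is invertible; hence twice the rank of c is at
   most n + k. *)
have := mxrank_mul_min (red _ _ c *m red _ _ H) (red _ _ c)^T.
rewrite (mxrankMfree _ rH) mxrank_tr => rk2.
(* The left kernel of c has dimension at least 2, too large for the line of z. *)
have /row_subPn[i hi] : ~~ (kermx (red _ _ c) <= z)%MS.
  apply/negP => /mxrankS; rewrite mxrank_ker => /leq_trans /(_ (rank_leq_row z)).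
  by move: (leq_trans rk2 rk) (rank_leq_row (red _ _ c)) lt; set r := \rank _; lia.
pose e2 := row i (kermx (red _ _ c)).
pose e : 'rV[int]_m := map_mx (fun a : 'F_2 => (nat_of_ord a)%:Z) e2.
have ee : map_mx intr e = e2 by apply/rowP => j; rewrite !mxE -pmulrn natr_Zp.
have /choice[g gE] : forall j, exists q, (e *m c) 0 j = q * 2.
  move=> j; apply/dvdzP; rewrite -F2_intr.
  have : map_mx intr (e *m c) = 0 :> 'rV['F_2]_n.
    by rewrite map_mxM ee -row_mul mulmx_ker row0.
  by move=> /rowP/(_ j); rewrite !mxE => ->.
exists e, (\row_j g j); split; last by rewrite ee.
by apply/rowP => j; rewrite gE !mxE mulrC.
Qed.

(** * Classes of E_8 modulo 2 E_8 *)

Section Classes.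

Definition class_root (w : seq Z) : seq Z := [seq dotl r w | r <- icartan].

(** Representatives of the 128 classes that pair evenly with the root r of w: 0, r, the 63 positive
    roots of the E_7 orthogonal to r, and their sums with r. Their norms are 0, 2, 2 and 4, their
    pairings with r are 0, 2, 0 and 2. *)
Definition class_reps (w : seq Z) : seq (seq Z) :=
  let S := [seq p <- posroots | Z.eqb (dotl p w) 0] in
  [:: nseq 8 0%BZ, class_root w & S ++ [seq axpy 1 (class_root w) p | p <- S]].

Definition rep_check (w v : seq Z) : bool :=
  let q := dotl v [seq dotl v r | r <- cartan] in let a := dotl v w in
  [|| v == nseq 8 0%BZ, v == class_root w, Z.eqb q 2 && Z.eqb a 0 | Z.eqb q 4 && Z.eqb a 2].

Definition class_check (w : seq Z) : bool :=
  [&& size w == 8, all (fun v => (size v == 8) && rep_check w v) (class_reps w) &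
    all_bits 8 (fun l => Z.odd (dotl l w) ||
      has (fun v => all Z.even (axpy (-1) v l)) (class_reps w))].

Lemma class_checkP a : a \in [:: dih415_left; dih415_right] -> class_check a.
Proof. by rewrite !inE => /orP[] /eqP ->; vm_cast_no_check (erefl true). Qed.

Definition class_rep (w v : 'rV[int]_8) : Prop :=
  [\/ v = 0, v = w *m eic, form8 v v = 2 /\ pair8 v w = 0 | form8 v v = 4 /\ pair8 v w = 2].

Lemma rep_checkP w v : size w = 8 -> size v = 8 -> rep_check w v ->
  class_rep (rowZ 8 w) (rowZ 8 v).
Proof.
move=> sw sv.
have pE a b : size a = 8 -> pair8 (rowZ 8 a) (rowZ 8 b) = int_of_Z (dotl a b).
  move=> sa; rewrite (@dotlE _ _ 8) ?sa ?orbT // /pair8 mxE.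
  by apply: eq_bigr => i _; rewrite !mxE.
have qE : form8 (rowZ 8 v) (rowZ 8 v) = int_of_Z (dotl v [seq dotl v r | r <- cartan]).
  rewrite -pE // /form8 /pair8 -mulmxA; congr ((_ *m _) 0 0).
  apply/colP => i; rewrite !mxE (nth_map [::]) // (@dotlE _ _ 8) ?sv ?orbT //.
  by apply: eq_bigr => j _; rewrite !mxE mulrC.
case/or4P => [/eqP ->|/eqP ->|/andP[/Z.eqb_eq e1 /Z.eqb_eq e2]|/andP[/Z.eqb_eq e1 /Z.eqb_eq e2]].
- by constructor 1; apply/rowP => i; rewrite !mxE nth_nseq; case: ltnP.
- constructor 2; apply/rowP => i; rewrite !mxE (nth_map [::]) // (@dotlE _ _ 8) ?sw //.
  by apply: eq_bigr => j _; rewrite -[eic]eicT !mxE mulrC.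
- by constructor 3; rewrite qE pE // e1 e2.
- by constructor 4; rewrite qE pE // e1 e2.
Qed.

Lemma class_repP w (x : 'rV[int]_8) : class_check w -> (2 %| pair8 x (rowZ 8 w))%Z ->
  exists u, class_rep (rowZ 8 w) (x + 2 *: u).
Proof.
move=> /and3P[/eqP sw /allP reps bits] xw.
pose l := [seq Z_of_int (x 0 (inord k)) | k <- iota 0 8].
pose b := [seq if Z.odd a then 1%BZ else 0%BZ | a <- l].
have bE (i : 'I_8) : (2 %| (x 0 i - int_of_Z (nth 0%BZ b i))%R)%Z.
  rewrite /b (nth_map 0%BZ) ?size_map ?size_iota // (nth_map 0%N) ?size_iota //.
  rewrite nth_iota // add0n inord_val.
  have := oddZ_dvd (Z_of_int (x 0 i)); rewrite Z_of_intK.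
  case: (Z.odd _) => h; last by rewrite subr0 h.
  by rewrite (_ : int_of_Z 1%BZ = 1) //; move: (x 0 i) h => y; lia.
have := all_bitsP bits (_ : size l = 8); rewrite size_map size_iota => /(_ erefl); rewrite -/b.
have -> : Z.odd (dotl b w) = false.
  apply: negbTE; rewrite -oddZ_dvd (@dotlE _ _ 8) ?sw //.
  have : (2 %| (pair8 x (rowZ 8 w) - \sum_(i < 8) int_of_Z (nth 0%BZ b i) * int_of_Z (nth 0%BZ w i))%R)%Z.
    rewrite /pair8 mxE -sumrB rpred_sum // => i _.
    by rewrite !mxE -mulrBl dvdz_mulr.
  by move=> h; rewrite -[X in (_ %| X)%Z](subKr (pair8 x (rowZ 8 w))) rpredB.
move=> /hasP[v vr ev]; have /andP[/eqP sv rv] := reps _ vr.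
have /choice[u uE] : forall i : 'I_8, exists q, rowZ 8 v 0 i - x 0 i = q * 2.
  move=> i; apply/dvdzP; rewrite rowZE.
  have sb : size b = 8 by rewrite !size_map.
  have := allP ev (nth 0%BZ (axpy (-1) v b) i); rewrite mem_nth ?size_axpy ?sv ?sb // => /(_ isT).
  rewrite -Z.negb_odd -oddZ_dvd nth_axpy ?sv ?sb // => h.
  rewrite (_ : _ - _ = - ((x 0 i - int_of_Z (nth 0%BZ b i)) +
     (int_of_Z (-1) * int_of_Z (nth 0%BZ v i) + int_of_Z (nth 0%BZ b i)))).
    by rewrite rpredN rpredD.
  by rewrite (_ : int_of_Z (-1) = -1) //; ring.
exists (\row_i u i); rewrite (_ : x + _ = rowZ 8 v); first exact: rep_checkP.
by apply/rowP => i; rewrite [LHS]mxE [in X in _ + X]mxE [in X in 2 * X]mxE mulrC -uE; ring.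
Qed.

End Classes.

Lemma rep_zero w : pair8 0 w = 0 /\ form8 0 0 = 0.
Proof. by rewrite /pair8 /form8 !mul0mx mxE. Qed.

(* The last alternative is where a sign of [y] has to be changed. *)
Lemma rep_pair w v x y : w *m eic *m w^T = 2%:M -> v *m eic *m v^T = 2%:M ->
  class_rep v x -> class_rep w y ->
  (forall s, s \in [:: 1; -1] -> exists2 k, 
     form8 x x + form8 y y + s * (pair8 x v * pair8 y w) = 4 * k & k <> 1) ->
  (x = 0 /\ y = 0) \/ (x = v *m eic /\ y = w *m eic).
Proof.
move=> ww vv hx hy h.
have [k] := h 1 (mem_head _ _); have [l] := h (-1) (mem_last 1 [:: -1]).
have r0 := rep_zero; have rw := form8_root ww; have rv := form8_root vv.
have pw : pair8 (w *m eic) w = 2 by rewrite /pair8 ww mxE.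
have pv : pair8 (v *m eic) v = 2 by rewrite /pair8 vv mxE.
case: hx hy => [->|->|[-> ->]|[-> ->]] [->|->|[-> ->]|[-> ->]];
  rewrite ?(r0 v).1 ?(r0 w).1 ?(r0 w).2 ?rw ?rv ?pw ?pv; try lia.
- by left.
- by right.
Qed.

Section NotLeech.
Context {R : realType}.
Local Notation rz := (@rz R _ _).

Lemma dih415_not_Leech d (X : 'M[R]_(16, d)) :
  X *m X^T = rz (mxZ 16 16 (gramZ (pairing DIH4_15))) -> ~ embeds_in_Leech (zspan X).
Proof.
set G : 'M_(8 + 8) := mxZ _ _ _.
move=> XX [K [[F bF] [Kint Keven] Kdual Kroot] [K' [K'K [f [[f1 _ _] _ fd]]]]].
pose Y : 'M[R]_(8 + 8, 24) := \matrix_i f (row i (X : 'M_(8 + 8, d))).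
have YY : Y *m Y^T = rz G.
  by rewrite -XX; apply/matrixP => i j; rewrite -!dot_row !rowK fd //; exact: zspan_row.
have KF : K = zspan F by case: bF.
have [c YE] : exists c, Y = rz c *m F.
  by apply: zspan_rows => i; rewrite rowK -KF; apply/K'K/f1; exact: zspan_row.
have KY e : K (rz e *m Y) by rewrite YE mulmxA -rzM KF; exact: zspan_mul.
have [H [U [FF UH]]] := unimodular_gram bF Kint Kdual.
have cc : c *m H *m c^T = G.
  by apply: (@rz_inj R); rewrite !rzM -FF -YY YE trmx_mul rz_tr !mulmxA.
pose v := rowZ 8 dih415_right; pose w := rowZ 8 dih415_left.
have vv : v *m eic *m v^T = 2%:M by apply: dih415_root; rewrite !inE eqxx orbT.
have ww : w *m eic *m w^T = 2%:M by apply: dih415_root; rewrite mem_head.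
have tE : mxZ 8 8 (pairing DIH4_15) = w^T *m v := dih415_pairing.
have GE : G = 2 *: block_mx ec 0 0 ec + block_mx v^T 0 0 w^T *m block_mx 0 w v 0.
  rewrite /G gramZ_block tE scale_block_mx mulmx_block add_block_mx trmx_mul trmxK.
  by rewrite !(scaler0, mul0mx, mulmx0, addr0, add0r).
(* The difference of the two roots encoded in z, one in M and one in N, has norm 2 (2 + 2 - 4) = 0:
   z is the reduction of a linear relation between the generators. Avoiding 0 and z excludes halves
   that already lie in L. *)
pose z : 'rV['F_2]_(8 + 8) := map_mx intr (row_mx (v *m eic) (w *m eic)).
have [e [g [ec2 ez]]] := even_combination z UH (etrans cc GE) isT.
pose x := lsubmx e; pose y := rsubmx e; have exy : e = row_mx x y by rewrite hsubmxK.
pose W := rz g *m F; have KW : K W by rewrite KF; exact: zspan_mul.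
have eY : rz e *m Y = 2 *: W by rewrite YE mulmxA -rzM ec2 rzZ -scalemxAl.
have [h eG] : exists h, e *m G = 2 *: h.
  have [h hE] : exists h, W *m Y^T = rz h.
    apply: rz_int => i j; rewrite (ord1 i).
    have : K (row j Y) by rewrite rowE -(@rz_delta R).
    by move=> /(Kint _ _ KW); rewrite -{1}[W](row_id 0) dot_row.
  by exists h; apply: (@rz_inj R); rewrite rzM -YY mulmxA eY rzZ -scalemxAl hE.
(* Half of the vector e' Y lies in K, so it has an even norm 2k, different from 2. *)
have norm e' f' : e' = e + 2 *: f' -> exists2 k, (e' *m G *m e'^T) 0 0 = 8 * k & k <> 1.
  move=> e'E; pose W' := W + rz f' *m Y.
  have KW' : K W' by rewrite /W' KF; apply: zspanD; rewrite -KF.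
  have [k kE] := Keven _ KW'.
  have e'Y : rz e' *m Y = 2 *: W' by rewrite e'E rzD mulmxDl eY rzZ -scalemxAl scalerDr.
  have : dot (rz e' *m Y) (rz e' *m Y) = (8 * k)%:~R.
    by rewrite e'Y dotZl dotZr kE !rmorphM /=; ring.
  rewrite dot_mul YY -rz_tr -!rzM mxE => /intr_inj nE; exists k => // k1.
  by move/eqP: (Kroot _ KW'); apply; rewrite kE k1.
have ev j : (2 %| (e *m G) 0%R j)%Z by rewrite eG mxE dvdz_mulr.
have evx : (2 %| pair8 x v)%Z.
  (* Entry 6 of w is 1, so this column of e G is congruent modulo 2 to the pairing of x with v.
     Entry 7 of v plays the same part for y below. *)
  have := ev (rshift 8 (inord 6)); rewrite exy /G gramZ_block mul_row_block row_mxEr mxE.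
  rewrite rpredDr; last by rewrite -scalemxAr mxE dvdz_mulr.
  by rewrite tE trmx_mul trmxK mulmxA mxE big_ord1 -/(pair8 x v) rowZE inordK // mulr1.
have evy : (2 %| pair8 y w)%Z.
  have := ev (lshift 8 (inord 7)); rewrite exy /G gramZ_block mul_row_block row_mxEl mxE.
  rewrite rpredDl; last by rewrite -scalemxAr mxE dvdz_mulr.
  by rewrite tE mulmxA mxE big_ord1 -/(pair8 y w) rowZE inordK // mulr1.
have [u xr] := class_repP (class_checkP (mem_last dih415_left [:: dih415_right])) evx.
have [u' yr] := class_repP (class_checkP (mem_head _ _)) evy.
pose x' := x + 2 *: u; pose y' := y + 2 *: u'.
have sub2 f' : map_mx intr (row_mx x' y') = f' -> (f' <= z)%MS -> False.
  move=> <-; apply/negP; rewrite -(_ : map_mx intr e = map_mx intr (row_mx x' y')) //.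
  apply/rowP => j; rewrite ![map_mx _ _ 0 j]mxE; apply/eqP; rewrite -subr_eq0 -rmorphB F2_intr.
  have -> : row_mx x' y' = e + 2 *: row_mx u u' by rewrite exy scale_row_mx add_row_mx.
  by rewrite mxE opprD addNKr mxE rpredN dvdz_mulr.
have [s|[x0 y0]|[x0 y0]] := rep_pair ww vv xr yr.
- rewrite !inE => /orP[] /eqP ->.
    have [|k kE k1] := norm (row_mx x' y') (row_mx u u').
      by rewrite exy scale_row_mx add_row_mx.
    exists k => //; apply: (@mulfI _ 2) => //.
    rewrite (_ : 2 * (4 * k) = 8 * k); last by ring.
    by rewrite -kE (gramZ_norm _ _ tE) mul1r.
  (* Changing the sign of y' does not change its class modulo 2, but it changes the sign of the
     mixed term. *)
  have [|k kE k1] := norm (row_mx x' (- y')) (row_mx u (- y - u')).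
    rewrite exy scale_row_mx add_row_mx; congr row_mx.
    by rewrite /y'; apply/rowP => j; rewrite !mxE; ring.
  exists k => //; apply: (@mulfI _ 2) => //.
  rewrite (_ : 2 * (4 * k) = 8 * k); last by ring.
  have fN : form8 (- y') (- y') = form8 y' y'.
    by rewrite /form8 [(- y')^T]linearN /= !mulNmx mulmxN opprK.
  have pN : pair8 (- y') w = - pair8 y' w by rewrite /pair8 mulNmx mxE.
  by rewrite -kE (gramZ_norm _ _ tE) fN pN mulN1r mulrN.
- apply: (sub2 0); rewrite ?sub0mx // /x' /y' x0 y0 row_mx0; apply/rowP => j; by rewrite !mxE.
- by apply: (sub2 z) => //; rewrite /x' /y' x0 y0.
Qed.

End NotLeech.

(** * Annihilators *)

Definition ann_rows_M : seq (seq Z) := (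
[:: [:: 0;0;0;-1;0;0;0;0]; [:: 0;0;-1;0;0;0;0;0]; [:: 0;-1;0;0;0;0;0;0]; [:: 0;0;0;0;-1;0;0;0]])%BZ.

Definition ann_section_M : seq (seq Z) := (
[:: [:: 0;0;0;0]; [:: 0;0;-1;0]; [:: 0;-1;0;0]; [:: -1;0;0;0]; [:: 0;0;0;-1]; [:: 0;0;0;0]; [::
0;0;0;0]; [:: 0;0;0;0]])%BZ.

Definition ann_cokernel_M : seq (seq Z) := (
[:: [:: 0;0;0;0;0;0;0;0]; [:: 0;0;0;0;0;0;0;0]; [:: 0;0;0;0;0;0;0;0]; [:: 0;0;0;0;0;0;1;1]; [::
0;0;0;0;0;0;0;0]; [:: 2;0;0;0;0;4;1;0]; [:: 1;0;0;0;0;2;0;0]; [:: 0;0;0;0;0;1;0;0]])%BZ.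

Definition ann_rows_N : seq (seq Z) := (
[:: [:: 0;-1;0;0;0;0;0;0]; [:: -1;0;0;0;0;0;0;0]; [:: 1;1;1;0;0;0;0;0]; [:: 1;1;1;1;1;0;0;0]])%BZ.

Definition ann_section_N : seq (seq Z) := (
[:: [:: 0;-1;0;0]; [:: -1;0;0;0]; [:: 1;1;1;0]; [:: 0;0;0;0]; [:: 0;0;-1;1]; [:: 0;0;0;0]; [::
0;0;0;0]; [:: 0;0;0;0]])%BZ.

Definition ann_cokernel_N : seq (seq Z) := (
[:: [:: 0;0;0;0;0;2;1;0]; [:: 0;0;0;0;0;0;0;0]; [:: 0;0;0;0;0;0;0;0]; [:: 0;0;0;0;0;0;0;0]; [::
0;0;0;0;0;0;0;0]; [:: 0;0;0;0;0;4;2;1]; [:: 0;0;0;1;0;1;0;0]; [:: 0;0;0;1;0;0;0;0]])%BZ.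

(** Twice the inverse of the pairing matrix: in this type the pairing between M and N is
    nondegenerate, so both annihilators vanish. *)
Definition inverse2_M : seq (seq Z) := (
[:: [:: 2;4;5;3;5;4;4;3]; [:: 0;1;0;1;2;2;4;4]; [:: 0;0;-3;0;0;0;4;5]; [:: 0;0;-2;0;0;0;2;2]; [::
0;-1;-4;-1;-1;0;3;4]; [:: 0;-1;-3;-1;0;0;2;3]; [:: 0;0;-2;-1;0;0;1;2]; [:: 0;0;-1;0;0;0;0;1]])%BZ.

Definition inverse2_N : seq (seq Z) := (
[:: [:: 2;0;0;0;0;0;0;0]; [:: 4;1;0;0;-1;-1;0;0]; [:: 5;0;-3;-2;-4;-3;-2;-1]; [::
3;1;0;0;-1;-1;-1;0]; [:: 5;2;0;0;-1;0;0;0]; [:: 4;2;0;0;0;0;0;0]; [:: 4;4;4;2;3;2;1;0]; [::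
3;4;5;2;4;3;2;1]])%BZ.

(* [V] splits [W] off the kernel of [P]: the columns of [D (1 - V W)] are      *)
(* combinations of those of [P].                                               *)
Definition ann_check (k : nat) (P W V H : seq (seq Z)) (D : Z) : bool :=
  [&& all (wide 8) [:: P; W; H], size P == 8, size W == k, size H == 8 &
    [&& zeroZ (mulZ 8 W P), ~~ Z.eqb D 0 &
      eqZ 8 8 (addZ 8 8 1 (mulZ 8 P H) (mulcZ 8 D (mulZ 8 V W))) (scalZ 8 D)]].

Section Annihilators.
Context {R : realType}.
Local Notation rz := (@rz R _ _).

Lemma ann_span d k (A B : 'M[R]_(8, d)) P W V H D :
  A *m B^T = rz (mxZ 8 8 P) -> ann_check k P W V H D ->
  ann (zspan A) (zspan B) = zspan (rz (mxZ k 8 W) *m A).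
Proof.
move=> AB /and5P[/and4P[wP wW wH _] /eqP sP /eqP sW /eqP sH /and3P[/(@mxZ_zero k 8)]].
rewrite (@mxZ_mul k 8 8) ?sP // => WP D0 /eqZP.
rewrite mxZ_add (_ : int_of_Z 1 = 1) // scale1r mulcZE mxZ_scal.
rewrite (@mxZ_mul 8 8 8) ?sH // (@mxZ_mul 8 k 8) ?sW // => e.
rewrite eqEsubset; split=> x.
  move=> [[c _ <-] oB].
  have cP : c *m mxZ 8 8 P = 0.
    apply: (@rz_inj R); rewrite rz0 rzM -AB; apply/rowP => j; rewrite [RHS]mxE.
    by have := oB _ (zspan_row B j); rewrite -{1}[rz c *m A](row_id 0) dot_row -mulmxA.
  exists (c *m mxZ 8 k V) => //; rewrite mulmxA -rzM; congr (rz _ *m A).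
  have D1 : int_of_Z D != 0 by apply: contra D0 => /eqP h; apply/Z.eqb_eq/intZ_inj.
  apply/rowP => j; apply: (mulfI D1).
  have := congr1 (mulmx c) e; rewrite mulmxDr mulmxA cP mul0mx add0r mul_mx_scalar -scalemxAr.
  by move=> /rowP/(_ j); rewrite !mulmxA [LHS]mxE [RHS]mxE.
move=> [f _ <-]; split.
  by rewrite mulmxA -rzM; exact: zspan_mul.
move=> _ [g _ <-]; rewrite mulmxA -rzM dot_mul AB -rzM -mulmxA WP mulmx0 rz0 mul0mx.
by rewrite mxE.
Qed.

Lemma ann_DD4 d (A B : 'M[R]_(8, d)) P W V H : A *m A^T = 2 *: rz ec ->
  A *m B^T = rz (mxZ 8 8 P) -> ann_check 4 P W V H 1 ->
  eqZ 4 4 (mulZ 4 (mulZ 8 W cartan) (trZ 4 8 W)) (cartanD 4) ->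
  isometric (ann (zspan A) (zspan B)) (DD 4).
Proof.
move=> AA AB ck e; rewrite (ann_span AB ck).
have /and5P[/and4P[_ wW _ _] _ /eqP sW _ _] := ck.
have D4 := gram_model_scale 2 (@rootD_model R true 4 isT).
apply: (gram_model_isometric (G := mulcZ 4 2 (cartanD 4)) (W := scalZ 4 1) (V := scalZ 4 1) _ D4).
- rewrite trmx_mul mulmxA -(mulmxA _ A) AA -scalemxAr -scalemxAl -rz_tr -!rzM mulcZE rzZ.
  move/eqZP: e => <-; rewrite (@mxZ_mul3 4 8 8 4) ?wide_tr ?size_tr // mxZ_tr.
  by rewrite (_ : int_of_Z 2 = 2).
- by vm_compute.
- by vm_compute.
Qed.

Lemma ann_zeroL d (A B : 'M[R]_(8, d)) P H : A *m B^T = rz (mxZ 8 8 P) ->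
  ann_check 0 P [::] [::] H 2 -> isometric (ann (zspan A) (zspan B)) zeroL.
Proof.
move=> AB ck; rewrite (ann_span AB ck).
have -> : zeroL = zspan (0 : 'M[R]_(0, 0)).
  by rewrite eqEsubset; split=> x; [move=> ->; exact: zspan0|move=> [c _ <-]; rewrite mulmx0].
by apply: isometric_gram; apply/matrixP => -[].
Qed.

Lemma dih_annP ty d (M N : set 'rV[R]_d) (A B : 'M[R]_(8, d)) : framed M N A B ->
  B *m A^T = rz (mxZ 8 8 (pairing ty)) -> dih_ann ty M N.
Proof.
move=> [[-> AA] [-> BB]] BA.
have AB : A *m B^T = rz (mxZ 8 8 (trZ 8 8 (pairing ty))).
  by rewrite mxZ_tr rz_tr -BA trmx_mul trmxK.
case: ty BA AB => // BA AB; split.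
- by apply: (ann_DD4 (W := ann_rows_M) (V := ann_section_M) (H := ann_cokernel_M) AA AB); vm_compute.
- by apply: (ann_DD4 (W := ann_rows_N) (V := ann_section_N) (H := ann_cokernel_N) BB BA); vm_compute.
- by apply: (ann_zeroL (H := inverse2_M) AB); vm_compute.
- by apply: (ann_zeroL (H := inverse2_N) BA); vm_compute.
Qed.

End Annihilators.

(** * The classification *)

Lemma finals_cases t : t \in finals ->
  [\/ exists ty, t = pairing ty, t = nth [::] finals 2 | t = nth [::] finals 12].
Proof.
move=> /(nthP [::])[i lti <-].
case: i lti => [|[|[|[|[|[|[|[|[|[|[|[|[|//]]]]]]]]]]]]] _;
  [constructor 1; exists DIH4_16|constructor 1; exists DIH4_15|constructor 2|
   constructor 1; exists DIH4_14|constructor 1; exists DIH8_16_DD4|constructor 1; exists DIH4_12|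
   constructor 1; exists DIH12_16|constructor 1; exists DIH8_15|constructor 1; exists DIH10_16|
   constructor 1; exists DIH6_16|constructor 1; exists DIH6_14|constructor 1; exists DIH8_16_0|
   constructor 3]; by [].
Qed.

(* Norm -4 for the only member of [finals] that is not realised. *)
Definition negative_vector : seq Z :=
  [:: 2; 4; 6; 3; 5; 4; 3; 2; 2; 4; 6; 3; 5; 5; 4; 2]%BZ.

Lemma negative_norm : eqZ 1 1 (mulZ 1 (mulZ 16 [:: negative_vector] (gramZ (nth [::] finals 2)))
  (trZ 1 16 [:: negative_vector])) [:: [:: (-4)%BZ]].
Proof. by vm_cast_no_check (erefl true). Qed.

Lemma order_one : order_check (nth [::] finals 12) 1.
Proof. by vm_cast_no_check (erefl true). Qed.

Section Pairs.
Context {R : realType}.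
Local Notation rz := (@rz R _ _).

Lemma sumL_framed d (M N : set 'rV[R]_d) A B : framed M N A B -> sumL M N = zspan (col_mx A B).
Proof. by move=> [[-> _] [-> _]]; exact: sumL_span. Qed.

Lemma not_bad d (M N : set 'rV[R]_d) : ~ presents M N (nth [::] finals 2).
Proof.
move=> [_ [A [B [fAB BA]]]]; have XX := pair_gram fAB BA.
have := dot_ge0 (rz (mxZ 1 16 [:: negative_vector]) *m col_mx A B).
rewrite dot_mul XX -rz_tr -!rzM -mxZ_tr -(@mxZ_mul3 1 16 16 1) ?wide_tr ?size_tr //.
by move/eqZP: negative_norm => ->; rewrite !mxE ler0z.
Qed.

Lemma pair_pairing d (M N : set 'rV[R]_d) n : EE8_pair M N -> invol_group M N #= `I_n ->
  (3 <= n)%N -> exists ty, presents M N (pairing ty).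
Proof.
move=> pMN gn n3; have [t /finals_cases[[ty ->]|->|->] pt] := presents_finals pMN.
- by exists ty.
- by case: (not_bad pt).
(* In the case M = N the group has order 2, below the assumed 3. *)
- case: pt => _ [A [B [fAB BA]]]; have := invol_group_card fAB BA order_one.
  by move=> /card_esym/card_eq_trans/(_ gn)/card_eq_II e; rewrite -e in n3.
Qed.

Lemma discr_size ty : size (dih_discr ty) = dih_rank ty.
Proof. by case: ty. Qed.

Lemma pairing_of_type ty d (M N : set 'rV[R]_d) : EE8_pair M N -> presents M N (pairing ty) ->
  of_type ty M N.
Proof.
move=> pMN [_ [A [B [fAB BA]]]]; have XX := pair_gram fAB BA.
have [Y [_ _ bY discr]] := smith_checkP (smith_okP ty) XX.
rewrite -(sumL_framed fAB) in bY discr; split=> //; last first.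
  by rewrite (sumL_framed fAB); exact: dih_subP.
split=> //; last exact: dih_annP fAB BA.
  have := invol_group_card fAB BA (order_okP ty).
  by rewrite mul2n (_ : (dih_order ty)./2.*2 = dih_order ty) //; case: ty {BA XX Y bY discr}.
by rewrite -discr_size; exists Y.
Qed.

Lemma has_rank_uniq d (L : set 'rV[R]_d) r r' : has_rank L r -> has_rank L r' -> r = r'.
Proof.
have le m n : has_rank L m -> has_rank L n -> (m <= n)%N.
  move=> [B [fB BE]] [C [_ CE]].
  have [U BU] : exists U, B = rz U *m C.
    apply: zspan_rows => i; rewrite -[zspan C]/[set map_mx intr c *m C | c in setT] -CE BE.
    exact: (zspan_row B).
  by rewrite -(eqP fB) BU; apply: leq_trans (mxrankM_maxr _ _) (rank_leq_row _).
by move=> hr hr'; apply/eqP; rewrite eqn_leq !le.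
Qed.

Lemma DD4_not_zero d (K : set 'rV[R]_d) : isometric K (DD 4) -> isometric K zeroL -> False.
Proof.
move=> [f [[f1 f2 f3] _ _]] [g [[g1 g2 _] _ _]].
have DD0 (z : 'rV[int]_4) : (2 %| \sum_i z 0%R i)%Z -> DD 4 (Num.sqrt 2 *: rz z).
  by move=> z2; exists (rz z) => //; exists z.
have [|x Kx fx] := f3 _ (DD0 0 _); first by rewrite big1 // => i _; rewrite mxE.
have [|y Ky fy] := f3 _ (DD0 (const_mx 1) _).
  by rewrite (eq_bigr (fun=> 1)) => [|i _]; rewrite ?sumr_const ?card_ord // mxE.
have xy : x = y.
  by apply: g2; [exact/mem_set|exact/mem_set|rewrite (g1 _ Kx) (g1 _ Ky)].
have := fy; rewrite -xy fx => /rowP/(_ 0); rewrite !mxE => /eqP.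
by rewrite mulr0 mulr1 eq_sym sqrtr_eq0 lern0.
Qed.

(** Order and rank separate all names except [DIH8_16_DD4] and [DIH8_16_0], which differ in their
    annihilators. *)
Lemma has_name_uniq ty ty' d (M N : set 'rV[R]_d) : has_name ty M N -> has_name ty' M N -> ty = ty'.
Proof.
move=> [_ g r a] [_ g' r' a'].
have /card_eq_II eo := card_eq_trans (card_esym g) g'.
have er := has_rank_uniq r r'.
case: ty ty' eo er a a' {g r g' r'} => -[] //= _ _ [a1 _] [a2 _].
  by case: (DD4_not_zero a1 a2).
by case: (DD4_not_zero a2 a1).
Qed.

(** By the classification the pair presents the matrix of some type and then bears the name of that
    type too; as names exclude each other, it is the given one. *)
Lemma has_name_pairing ty d (M N : set 'rV[R]_d) : has_name ty M N -> presents M N (pairing ty).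
Proof.
move=> h; have [pMN g _ _] := h.
have [|ty' pt] := pair_pairing pMN g; first by case: ty {h g}.
by have [h' _ _] := pairing_of_type pMN pt; rewrite (has_name_uniq h h').
Qed.

Lemma presents_isometric t d d' (M N : set 'rV[R]_d) (M' N' : set 'rV[R]_d') :
  presents M N t -> presents M' N' t -> pair_isometric M N M' N'.
Proof.
move=> [_ [A [B [fAB BA]]]] [_ [A' [B' [fAB' BA']]]].
have XX : col_mx A B *m (col_mx A B)^T = col_mx A' B' *m (col_mx A' B')^T.
  by rewrite (pair_gram fAB BA) (pair_gram fAB' BA').
have [T XT] := gram_factor XX.
exists (fun x : 'rV_d => x *m T); rewrite (sumL_framed fAB) (sumL_framed fAB').
move: (XT); rewrite mul_col_mx => /eq_col_mx[AT BT].
have im m (C : 'M[R]_(m, d)) C' : C *m T = C' -> (fun x : 'rV_d => x *m T) @` zspan C = zspan C'.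
  move=> <-; rewrite eqEsubset; split=> x.
    by move=> [_ [c _ <-] <-]; rewrite -mulmxA; exact: zspan_mul.
  by move=> [c _ <-]; exists (rz c *m C); [exact: zspan_mul|rewrite mulmxA].
case: fAB => -[-> _] [-> _]; case: fAB' => -[-> _] [-> _].
by split; [exact: gram_map|exact: im|exact: im].
Qed.

Definition model_M ty : 'M[R]_(8, 24) := usubmx (model ty : 'M_(8 + 8, 24)).
Definition model_N ty : 'M[R]_(8, 24) := dsubmx (model ty : 'M_(8 + 8, 24)).

(** Ten of the models inherit this from the Leech lattice; the model of [DIH4_15] does not lie there
    and is treated through its Gram matrix. *)
Lemma model_rootless ty : rootless (zspan (@model R ty)).
Proof.
have [->|nty] : ty = DIH4_15 \/ ty <> DIH4_15 by case: ty; (try by left); right.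
  exact/dih415_rootless/model_gram.
by move=> x /(model_leech nty); exact: leech_rootless.
Qed.

Lemma model_presents ty :
  EE8_pair (zspan (model_M ty)) (zspan (model_N ty)) /\
  presents (zspan (model_M ty)) (zspan (model_N ty)) (pairing ty).
Proof.
have G : col_mx (model_M ty) (model_N ty) *m (col_mx (model_M ty) (model_N ty))^T =
    rz (mxZ 16 16 (gramZ (pairing ty))) by rewrite vsubmxK; exact: model_gram.
have := etrans G (etrans (congr1 (fun C => rz C) (gramZ_block (pairing ty)))
  (map_block_mx intr _ _ _ _)).
rewrite tr_col_mx mul_col_row => /eq_block_mx[AA _ BA BB].
have {}AA : model_M ty *m (model_M ty)^T = 2 *: rz ec by rewrite AA; exact: rzZ.
have {}BB : model_N ty *m (model_N ty)^T = 2 *: rz ec by rewrite BB; exact: rzZ.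
have fAB : framed (zspan (model_M ty)) (zspan (model_N ty)) (model_M ty) (model_N ty) by [].
split; last first.
  split; first by case: ty {G AA BB BA fAB}; vm_compute.
  by exists (model_M ty), (model_N ty).
rewrite /EE8_pair (sumL_framed fAB); split.
- by apply/EE8_frameP; exists (model_M ty).
- by apply/EE8_frameP; exists (model_N ty).
- by move=> _ _ [x _ <-] [y _ <-]; rewrite dot_mul G -rz_tr -!rzM mxE; exact: intr_int.
- by rewrite vsubmxK; exact: model_rootless.
Qed.

Lemma presents_Leech ty d (M N : set 'rV[R]_d) : presents M N (pairing ty) ->
  embeds_in_Leech (sumL M N) <-> ty <> DIH4_15.
Proof.
move=> [_ [A [B [fAB BA]]]]; have XX := pair_gram fAB BA; rewrite (sumL_framed fAB).
split=> [eL tyE|nty]; first by apply: dih415_not_Leech eL; rewrite -tyE.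
exists leech; first exact: leechP.
apply: (contains_gram (A := col_mx A B) (B := model ty)) => //; first exact: model_leech.
by rewrite XX model_gram.
Qed.

End Pairs.

Theorem theorem1p1 (R : realType) :
  (forall (d : nat) (M N : set 'rV[R]_d),
     EE8_pair M N -> dihedral_le12 M N -> exists t : dih, of_type t M N) /\
  (forall t : dih, exists (d : nat) (M N : set 'rV[R]_d), of_type t M N) /\
  (forall (t : dih) (d d' : nat)
          (M N : set 'rV[R]_d) (M' N' : set 'rV[R]_d'),
     has_name t M N -> has_name t M' N' -> pair_isometric M N M' N') /\
  (forall (t : dih) (d : nat) (M N : set 'rV[R]_d),
     has_name t M N -> (embeds_in_Leech (sumL M N) <-> t <> DIH4_15)).
Proof.
split=> [d M N pMN [n /andP[n4 _] gn]|].
  have [ty pt] := pair_pairing pMN gn (ltnW n4).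
  by exists ty; exact: pairing_of_type.
split=> [t|].
  have [pMN pt] := @model_presents R t.
  by exists 24, (zspan (@model_M R t)), (zspan (model_N t)); exact: pairing_of_type.
split=> [t d d' M N M' N' /has_name_pairing h /has_name_pairing h'|t d M N /has_name_pairing].
  exact: presents_isometric h h'.
exact: presents_Leech.
Qed.
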